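(* Let $P:[0,1]\to\mathbb R^d$ be a polygonal curve of complexity $n$ with breakpoints $0=t_1<\dots<t_m=1$, and let $\ell\in\mathbb N$, $\Delta>0$. Assume there exists $C^*\subset\mathbb X^d_\ell$ with $|C^*|=k$ and $\phi(P,C^* )\le\Delta$. Let $T_S(n,\ell)$ be the time to compute an $\ell$-simplification of any subcurve $P[t_i,t_j]$. Then there is an algorithm that computes a set $C\subset\mathbb X^d_\ell$ with $|C|=O(k\log m)$ and $\phi(P,C)\le3\Delta$ in time $O(m^3n\ell+m^4+m^2T_S(n,\ell))$.
   Context: A polygonal curve $P:[0,1]\to\mathbb R^d$ with vertices $p_1,\dots,p_n$ is obtained by linearly interpolating consecutive vertices; its complexity is $n$. For $0\le a\le b\le1$, $P[a,b]$ is the subcurve from $P(a)$ to $P(b)$. $\mathbb X^d_\ell=(\mathbb R^d)^\ell$ is the set of polygonal curves in $\mathbb R^d$ with $\ell$ vertices. The Fréchet distance is $d_F(A,B)=\inf_\gamma\sup_{t\in[0,1]}\|A(\gamma(t))-B(t)\|$, $\gamma$ over increasing homeomorphisms of $[0,1]$. An $\ell$-simplification of a curve $R$ is a curve of $\mathbb X^d_\ell$ minimizing the Fréchet distance to $R$. For finite $C\subset\mathbb X^d_\ell$, $\phi(P,C)=\min_I\max_{(i,j)\in I}\min_{q\in C}d_F(P[t_i,t_j],q)$, where $I$ ranges over sets of pairs $(i,j)$, $1\le i<j\le m$, with $\bigcup_{(i,j)\in I}[t_i,t_j]=[0,1]$. Computation is in the real-RAM model. *)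

(* Defs.v *)
From HB Require Import structures.
From mathcomp Require Import all_boot all_order all_algebra.
From mathcomp Require Import all_classical all_reals all_analysis.
From mathcomp Require Import finmap.
Set Implicit Arguments. Unset Strict Implicit. Unset Printing Implicit Defensive.
Import Order.TTheory GRing.Theory Num.Theory.
Import numFieldNormedType.Exports.
Local Open Scope classical_set_scope.
Local Open Scope ring_scope.

Section Geometry.
Variable R : realType.

Definition enorm (d : nat) (v : 'rV[R]_d) : R :=
  Num.sqrt (\sum_(i < d) v 0 i ^+ 2).

Definition clamp01 (x : R) : R := Num.min 1 (Num.max 0 x).

(* The polygonal curve [0,1] -> R^d with vertices p_1..p_N+1 (N = size p - 1),
   uniformly parametrized: vertex i is reached at time i/N, linear in between.
   Closed form: for s*N in [k,k+1] all clamps with i<k are 1, the k-th is the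
   fractional part and the others are 0. *)
Definition polycurve (d : nat) (p : seq 'rV[R]_d) : R -> 'rV[R]_d :=
  fun s => nth 0 p 0 +
    \sum_(i < (size p).-1)
       clamp01 (s * ((size p).-1)%:R - i%:R) *: (nth 0 p i.+1 - nth 0 p i).

Definition subcurve (d : nat) (A : R -> 'rV[R]_d) (a b : R) : R -> 'rV[R]_d :=
  fun s => A (a + s * (b - a)).

Definition incr_homeo : set (R -> R) :=
  [set g : R -> R | g 0 = 0 /\ g 1 = 1 /\ {within `[0%R, 1%R]%classic, continuous g} /\
           (forall x y, 0 <= x -> x < y -> y <= 1 -> g x < g y)].

Definition frechet (d : nat) (A B : R -> 'rV[R]_d) : \bar R :=
  ereal_inf [set ereal_sup [set (enorm (A (g t) - B t))%:E | t in `[0%R, 1%R]%classic]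
            | g in incr_homeo].

(* Curves of X^d_l are represented by their l vertices. *)
Definition curve_of (d l : nat) (q : l.-tuple 'rV[R]_d) : R -> 'rV[R]_d :=
  polycurve (tval q).

(* Breakpoints 0 = t_1 < ... < t_m = 1, stored 0-indexed as t 0, ..., t (m-1). *)
Definition breakpoints (m : nat) (t : nat -> R) : Prop :=
  (1 < m)%N /\ t 0%N = 0 /\ t m.-1 = 1 /\
  (forall i j, (i < j < m)%N -> t i < t j).

Definition admissible (m : nat) (t : nat -> R) (I : {set 'I_m * 'I_m}) : Prop :=
  (forall ij, ij \in I -> (val ij.1 < val ij.2)%N) /\
  (forall x, 0 <= x <= 1 ->
     exists2 ij, ij \in I & t (val ij.1) <= x <= t (val ij.2)).

Definition phi (d l m : nat) (P : R -> 'rV[R]_d) (t : nat -> R)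
    (C : {fset l.-tuple 'rV[R]_d}) : \bar R :=
  ereal_inf
    [set ereal_sup
       [set ereal_inf
          [set frechet (subcurve P (t (val ij.1)) (t (val ij.2))) (curve_of q)
          | q in [set q | q \in C]]
       | ij in [set ij | ij \in I]]
    | I in [set I : {set 'I_m * 'I_m} | admissible t I]].

Definition is_simplification (d l : nat) (A : R -> 'rV[R]_d)
    (q : l.-tuple 'rV[R]_d) : Prop :=
  forall q' : l.-tuple 'rV[R]_d, (frechet A (curve_of q) <= frechet A (curve_of q'))%E.

End Geometry.

(* Two memories: integer cells N[.] (nat) and real cells R[.].
   Register arguments below are fixed addresses; indirect access via
   NLoad/NStore/RLoad/RStore. *)
Inductive instr : Type :=
| NConst of nat & nat
| NAdd of nat & nat & nat
| NSub of nat & nat & nat      (* truncated subtraction                       *)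
| NMul of nat & nat & nat
| NLoad of nat & nat
| NStore of nat & nat
| RofN of nat & nat
| RAdd of nat & nat & nat
| RSub of nat & nat & nat
| RMul of nat & nat & nat
| RDiv of nat & nat & nat      (* x / 0 = 0 (mathcomp convention)            *)
| RSqrt of nat & nat           (* R[r] := sqrt R[a] (0 on negatives)          *)
| RLoad of nat & nat
| RStore of nat & nat
| JmpNLt of nat & nat & nat
| JmpRLt of nat & nat & nat
| Oracle of nat & nat & nat    (* Oracle a b c : writes an l-simplification of
                                  P[t_{N[a]}, t_{N[b]}] (flattened coordinates)
                                  into R[N[c]], R[N[c]+1], ...                 *)
| Halt.

Section Machine.
Variable R : realType.

Record state := mkState { pc : nat; nmem : nat -> nat; rmem : nat -> R }.

Definition updN (f : nat -> nat) (r v : nat) : nat -> nat :=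
  fun x => if x == r then v else f x.
Definition updR (f : nat -> R) (r : nat) (v : R) : nat -> R :=
  fun x => if x == r then v else f x.

Definition step (orc : nat -> nat -> seq R) (TS : nat) (ins : instr) (s : state)
    : state * nat :=
  let N := nmem s in let Rm := rmem s in let nx := (pc s).+1 in
  match ins with
  | NConst r c => (mkState nx (updN N r c) Rm, 1%N)
  | NAdd r a b => (mkState nx (updN N r (N a + N b)%N) Rm, 1%N)
  | NSub r a b => (mkState nx (updN N r (N a - N b)%N) Rm, 1%N)
  | NMul r a b => (mkState nx (updN N r (N a * N b)%N) Rm, 1%N)
  | NLoad r a => (mkState nx (updN N r (N (N a))) Rm, 1%N)
  | NStore a r => (mkState nx (updN N (N a) (N r)) Rm, 1%N)
  | RofN r a => (mkState nx N (updR Rm r (N a)%:R), 1%N)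
  | RAdd r a b => (mkState nx N (updR Rm r (Rm a + Rm b)), 1%N)
  | RSub r a b => (mkState nx N (updR Rm r (Rm a - Rm b)), 1%N)
  | RMul r a b => (mkState nx N (updR Rm r (Rm a * Rm b)), 1%N)
  | RDiv r a b => (mkState nx N (updR Rm r (Rm a / Rm b)), 1%N)
  | RSqrt r a => (mkState nx N (updR Rm r (Num.sqrt (Rm a))), 1%N)
  | RLoad r a => (mkState nx N (updR Rm r (Rm (N a))), 1%N)
  | RStore a r => (mkState nx N (updR Rm (N a) (Rm r)), 1%N)
  | JmpNLt a b l => (mkState (if (N a < N b)%N then l else nx) N Rm, 1%N)
  | JmpRLt a b l => (mkState (if Rm a < Rm b then l else nx) N Rm, 1%N)
  | Oracle a b c =>
      let q := orc (N a) (N b) in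
      (mkState nx N
         (fun x => if (N c <= x < N c + size q)%N then nth 0 q (x - N c) else Rm x),
       TS)
  | Halt => (s, 0%N)
  end.

Fixpoint exec (prog : seq instr) (orc : nat -> nat -> seq R) (TS : nat)
    (fuel : nat) (s : state) : option (state * nat) :=
  match fuel with
  | 0%N => None
  | f.+1 =>
      match nth Halt prog (pc s) with
      | Halt => Some (s, 0%N)
      | ins => let sc := step orc TS ins s in
               omap (fun p => (p.1, (sc.2 + p.2)%N)) (exec prog orc TS f sc.1)
      end
  end.

Definition flat_pts (d : nat) (p : seq 'rV[R]_d) : seq R :=
  flatten [seq [seq (v : 'rV[R]_d) ord0 c | c <- enum 'I_d] | v <- p].

Definition oracle_of (d l m : nat) (S : nat -> nat -> l.-tuple 'rV[R]_d)
    : nat -> nat -> seq R :=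
  fun i j => if (i < j < m)%N then flat_pts (tval (S i j)) else [::].

Definition init_state (d l m : nat) (p : seq 'rV[R]_d) (t : nat -> R) (Delta : R)
    : state :=
  mkState 0%N
    (fun x => match x with 0 => d | 1 => size p | 2 => m | 3 => l | _ => 0 end)%N
    (fun x => nth 0 (Delta :: [seq t i | i <- iota 0 m] ++ flat_pts p) x).

Definition decode_curve (d l : nat) (s : state) (k : nat) : l.-tuple 'rV[R]_d :=
  [tuple (\row_(c < d) rmem s (k * l * d + j * d + c)%N) | j < l].

Definition output (d l : nat) (s : state) : {fset l.-tuple 'rV[R]_d} :=
  [fset decode_curve d l s k | k in iota 0 (nmem s 0%N)]%fset.

End Machine.

(* Main.v *)
Require Import Defs.
From HB Require Import structures.
From mathcomp Require Import all_boot all_order all_algebra.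
From mathcomp Require Import all_classical all_reals all_analysis.
From mathcomp Require Import finmap.
From mathcomp Require Import zify ring lra.
Set Implicit Arguments. Unset Strict Implicit. Unset Printing Implicit Defensive.
Import Order.TTheory GRing.Theory Num.Theory.
Import numFieldNormedType.Exports.
Local Open Scope classical_set_scope.
Local Open Scope ring_scope.

(* A candidate cover is obtained by simplifying every subcurve P[t_i, t_j].  If an optimal
   centre q serves P[t_i, t_j] within Delta, then by the triangle inequality the simplification
   of P[t_i, t_j] serves within 3 Delta every subcurve that q serves.  Hence the simplifications
   contain k curves that cover, and greedy set cover on the elementary intervals selects at most
   k log m of them, since k rounds at least halve the number of uncovered intervals.

   Deciding d_F <= delta is reachability in the closed free space.  A cell of the free space
   diagram is convex, so the reachable part of a cell side is a terminal segment of its free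
   interval and only its lower end has to be propagated.  The infimum over homeomorphisms is
   matched exactly by monotone paths in the closed free space: paths are perturbed to strictly
   monotone ones in one direction, and the upper envelope of almost feasible reparametrizations
   is a feasible path in the other.  One sweep from a breakpoint t_a decides all t_b.

   The machine program is compiled from a language whose loops have constant bounds, so that it
   has a total semantics and a running time that is a syntactic expression. *)

(** * Frechet distance and monotone paths *)

(** The machine remembers pairs (i, j) and never stores the candidate curves: a candidate is present
    only while its own block of the coverage table is filled, and the chosen ones, at most one per
    elementary interval, are requested again for the output. For a fixed candidate and a fixed start
    t_a, the elementary intervals covered from t_a form the range from a to the farthest accepted
    t_b, so marking costs O(m) per sweep. There are at most m^3 sweeps (a pair and a start), which
    accounts for m^3 n l + m^4; the greedy phase has at most m active rounds, each inspecting m^2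
    pairs on m intervals. The Frechet distance is an infimum that no homeomorphism need attain,
    while the program decides a closed condition; this forces an exact passage between near-optimal
    reparametrizations and paths that may stand still in one coordinate. The number of rounds is
    bounded by k j whenever m - 1 < 2^j, so no real logarithm occurs. The dimension enters only the
    constants. The case l = 0 is separate: there is exactly one curve without vertices, and no free
    space diagram. *)

Section EuclideanNorm.
Variable (R : realType) (d : nat).
Implicit Types u v w : 'rV[R]_d.

Lemma sumsq_ge0 v : 0 <= \sum_(i < d) v 0 i ^+ 2.
Proof. by apply: sumr_ge0 => i _; exact: sqr_ge0. Qed.

Lemma enorm_ge0 v : 0 <= enorm v.
Proof. exact: sqrtr_ge0. Qed.

Lemma enorm_sqr v : enorm v ^+ 2 = \sum_(i < d) v 0 i ^+ 2.
Proof. by rewrite sqr_sqrtr // sumsq_ge0. Qed.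

Lemma enorm_le v (c : R) : 0 <= c -> (enorm v <= c) = (\sum_(i < d) v 0 i ^+ 2 <= c ^+ 2).
Proof. by move=> c0; rewrite -enorm_sqr ler_pXn2r // nnegrE enorm_ge0. Qed.

Lemma cauchy_schwarz u v : \sum_(i < d) u 0 i * v 0 i <= enorm u * enorm v.
Proof.
set a := enorm u; set b := enorm v; set c := \sum_(i < d) _.
have a0 : 0 <= a := enorm_ge0 u.
have b0 : 0 <= b := enorm_ge0 v.
have key (x y : R) : 0 <= x ^+ 2 * a ^+ 2 - x * y *+ 2 * c + y ^+ 2 * b ^+ 2.
  have -> : x ^+ 2 * a ^+ 2 - x * y *+ 2 * c + y ^+ 2 * b ^+ 2 =
            \sum_(i < d) (x * u 0 i - y * v 0 i) ^+ 2.
    rewrite !enorm_sqr !mulr_sumr -sumrB -big_split /=.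
    by apply: eq_bigr => i _; ring.
  by apply: sumr_ge0 => i _; exact: sqr_ge0.
have [ab0|] := ltP 0 (a * b).
  have : 0 <= (a * b) * (2 * (a * b - c)) by have := key b a; congr (0 <= _); ring.
  by rewrite pmulr_rge0 // pmulr_rge0 // subr_ge0.
move=> ab_le0; have ab0 : a * b = 0.
  by apply/eqP; rewrite eq_le ab_le0 mulr_ge0.
rewrite ab0; have [//|c0] := leP c 0.
(* one of the norms vanishes, and [key] is linear in the other weight *)
have [az|bz] : a = 0 \/ b = 0 by move/eqP: ab0; rewrite mulf_eq0 => /orP[]/eqP; [left|right].
  have := key (b ^+ 2 + 1) c; rewrite az; have := sqr_ge0 b; nra.
have := key c (a ^+ 2 + 1); rewrite bz; have := sqr_ge0 a; nra.
Qed.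

Lemma enormD u v : enorm (u + v) <= enorm u + enorm v.
Proof.
rewrite enorm_le ?addr_ge0 ?enorm_ge0 //.
have -> : \sum_(i < d) (u + v) 0 i ^+ 2 =
   enorm u ^+ 2 + enorm v ^+ 2 + 2 * \sum_(i < d) u 0 i * v 0 i.
  rewrite !enorm_sqr mulr_sumr -!big_split /=.
  by apply: eq_bigr => i _; rewrite mxE; ring.
have := cauchy_schwarz u v; nra.
Qed.

Lemma enormZ (c : R) v : enorm (c *: v) = `|c| * enorm v.
Proof.
rewrite /enorm (eq_bigr (fun i => c ^+ 2 * v 0 i ^+ 2)) => [|i _].
  by rewrite -mulr_sumr sqrtrM ?sqr_ge0 // sqrtr_sqr.
by rewrite mxE exprMn.
Qed.

Lemma enormN v : enorm (- v) = enorm v.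
Proof. by rewrite -scaleN1r enormZ normrN1 mul1r. Qed.

Lemma enormB u v : enorm (u - v) = enorm (v - u).
Proof. by rewrite -enormN opprB. Qed.

Lemma enorm_dist u v w : enorm (u - w) <= enorm (u - v) + enorm (v - w).
Proof. by apply: le_trans (enormD _ _); rewrite addrA subrK. Qed.

End EuclideanNorm.

Section Homeomorphisms.
Variable R : realType.
Implicit Types g h : R -> R.

(** Precomposition with the clamp onto [a, b] turns [f] into a function that is Lipschitz on the
    whole line, hence continuous without any discussion of the end points. *)
Lemma lipschitz_IVT (f : R -> R) (K a b v : R) : a <= b ->
  (forall x y, a <= x -> x <= y -> y <= b -> `|f y - f x| <= K * (y - x)) ->
  f a <= v <= f b -> exists c, a <= c <= b /\ f c = v.
Proof.
move=> ab fK /andP[av vb].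
pose cl (x : R) := Num.min b (Num.max a x).
have clP x : a <= cl x <= b.
  by rewrite /cl; case: (leP a x) => ?; case: (leP b _) => ?; lra.
have cl1 x y : x <= y -> cl x <= cl y /\ cl y - cl x <= y - x.
  rewrite /cl => xy; case: (leP a x) => ?; case: (leP a y) => ?;
      rewrite /Num.min; do 2 case: ltP => ?; lra.
have clid x : a <= x <= b -> cl x = x.
  by rewrite /cl => ?; case: (leP a x) => ?; case: (leP b _) => ?; lra.
(* [K] may be zero or negative; a positive constant is needed for the radius e / K'. *)
pose K' := `|K| + 1.
have K'0 : 0 < K' by rewrite /K'; have := normr_ge0 K; lra.
have KK' : K <= K' by rewrite /K'; have := ler_norm K; lra.
have fcl x y : x <= y -> `|f (cl y) - f (cl x)| <= K' * (y - x).
  move=> xy; have [h1 h2] := cl1 _ _ xy.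
  have /andP[? ?] := clP x; have /andP[? ?] := clP y.
  apply: le_trans (fK _ _ _ _ _) _ => //; nra.
have fcl' x y : `|f (cl y) - f (cl x)| <= K' * `|y - x|.
  have [xy|/ltW yx] := leP x y; first by rewrite [ `|y - x|]ger0_norm ?subr_ge0 // fcl.
  by rewrite distrC [ `|y - x|]distrC [ `|x - y|]ger0_norm ?subr_ge0 // fcl.
have cont : {within `[a, b]%classic, continuous (f \o cl)}.
  apply: continuous_subspaceT => x.
  apply/cvgrPdist_lt => e e0.
  near=> z.
  apply: le_lt_trans (fcl' _ _) _.
  rewrite -ltr_pdivlMl // mulrC distrC.
  near: z; rewrite near_nbhs.
  have e1 : 0 < e / K' by rewrite divr_gt0.
  by under eq_near do rewrite distrC; apply: (@nbhsx_ballx R R x _ e1).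
have [|c] := @IVT R (f \o cl) a b v ab cont.
  by rewrite /= !clid ?lexx ?ab // ge_min av /= le_max vb orbT.
by rewrite in_itv /= => cab; rewrite clid // => <-; exists c.
Unshelve. all: by end_near.
Qed.

Definition on01 (x : R) := 0 <= x <= 1.

(** A monotone function can only have jumps, and surjectivity excludes them. Inverses, composites
    and mixtures below obtain their continuity in this way. *)
Lemma surj_incr_homeo g : g 0 = 0 -> g 1 = 1 ->
  (forall x y, 0 <= x -> x < y -> y <= 1 -> g x < g y) ->
  (forall y, on01 y -> exists x, on01 x /\ g x = y) -> incr_homeo g.
Proof.
move=> g0 g1 gm gs; split=> //; split=> //; split=> //.
have mono : {in `[0, 1] &, {mono g : x y / x <= y}}.
  apply: le_mono_in => x y; rewrite !in_itv /= => /andP[x0 _] /andP[_ y1] xy.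
  exact: gm.
apply: segment_inc_surj_continuous => //.
move=> y /=; rewrite in_itv /= g0 g1 => /gs[x [x01 <-]].
by exists x => //=; rewrite in_itv.
Qed.

Lemma incr_homeo_surj g : incr_homeo g ->
  forall y, on01 y -> exists x, on01 x /\ g x = y.
Proof.
case=> g0 [g1 [gc gm]] y y01.
have [|c] := @IVT R g 0 1 y ler01 gc.
  by rewrite g0 g1 min_l ?max_r ?ler01.
by rewrite in_itv /= => c01 <-; exists c.
Qed.

Lemma incr_homeo_on01 g x : incr_homeo g -> on01 x -> on01 (g x).
Proof.
case=> g0 [g1 [gc gm]] /andP[x0 x1]; apply/andP; split.
  by move: x0; rewrite le_eqVlt => /orP[/eqP<-|/(gm _ _ (lexx 0))/(_ x1)/ltW]; rewrite g0.
by move: x1; rewrite le_eqVlt => /orP[/eqP->|/(gm _ _ x0)/(_ (lexx 1))/ltW]; rewrite g1.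
Qed.

Lemma incr_homeo_le g x y : incr_homeo g -> 0 <= x -> x <= y -> y <= 1 -> g x <= g y.
Proof.
case=> g0 [g1 [gc gm]] x0; rewrite le_eqVlt => /orP[/eqP-> //|xy] y1.
exact/ltW/gm.
Qed.

Lemma incr_homeo_inv g : incr_homeo g ->
  exists h, incr_homeo h /\ forall t, on01 t -> g (h t) = t.
Proof.
move=> gh; have /choice[h hP] : forall y, exists x, on01 y -> on01 x /\ g x = y.
  move=> y; have [y01|] := boolP (on01 y); last by exists 0.
  by have [x] := incr_homeo_surj gh y01; exists x.
have o0 : on01 0 by rewrite /on01 lexx ler01.
have o1 : on01 1 by rewrite /on01 lexx ler01.
have [g0 [g1 [gc gm]]] := gh.
have ginj x y : on01 x -> on01 y -> g x = g y -> x = y.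
  move=> /andP[x0 x1] /andP[y0 y1] gxy; case: (ltgtP x y) => // xy.
    by have := gm _ _ x0 xy y1; rewrite gxy ltxx.
  by have := gm _ _ y0 xy x1; rewrite gxy ltxx.
exists h; split; last by move=> t /hP[].
apply: surj_incr_homeo.
- by have [a b] := hP _ o0; apply: ginj => //; rewrite b g0.
- by have [a b] := hP _ o1; apply: ginj => //; rewrite b g1.
- move=> x y x0 xy y1; rewrite ltNge; apply/negP => hyx.
  have [|a b] := hP x; first by rewrite /on01 x0 (ltW (lt_le_trans xy y1)).
  have [|a' b'] := hP y; first by rewrite /on01 y1 (ltW (le_lt_trans x0 xy)).
  have {a a'} [ax ay] : h x <= 1 /\ 0 <= h y by case/andP: a; case/andP: a'.
  have := incr_homeo_le gh ay hyx ax; rewrite b b' => gyx.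
  by move: xy; rewrite ltNge gyx.
- move=> y y01; exists (g y); split; first exact: incr_homeo_on01.
  have [a b] := hP _ (incr_homeo_on01 gh y01).
  exact: ginj.
Qed.

Lemma incr_homeo_comp g h : incr_homeo g -> incr_homeo h -> incr_homeo (g \o h).
Proof.
move=> gh hh; have [g0 [g1 [_ gm]]] := gh; have [h0 [h1 [_ hm]]] := hh.
apply: surj_incr_homeo => /=.
- by rewrite h0.
- by rewrite h1.
- move=> x y x0 xy y1.
  apply: gm; [|exact: hm|].
  + have /andP[] // : on01 (h x); apply: incr_homeo_on01 => //.
    by rewrite /on01 x0 (ltW (lt_le_trans xy y1)).
  + have /andP[] // : on01 (h y); apply: incr_homeo_on01 => //.
    by rewrite /on01 y1 (ltW (le_lt_trans x0 xy)).
- move=> y /(incr_homeo_surj gh)[z [/(incr_homeo_surj hh)[x [x01 <-]] <-]].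
  by exists x.
Qed.

End Homeomorphisms.

Section FrechetDistance.
Variables (R : realType) (d : nat).
Implicit Types A B C : R -> 'rV[R]_d.

(** The slack [e] is unavoidable, because the infimum over homeomorphisms need not be attained. *)
Lemma frechet_leP A B (delta : R) : (frechet A B <= delta%:E)%E <->
  forall e, 0 < e -> exists2 g, incr_homeo g &
    forall t, on01 t -> enorm (A (g t) - B t) <= delta + e.
Proof.
split=> [H e e0|H].
  have /ereal_inf_lt[_ [g gh <-] lt] : (frechet A B < (delta + e)%:E)%E.
    by apply: le_lt_trans H _; rewrite lte_fin ltrDl.
  exists g => // t t01; rewrite -lee_fin; apply: le_trans (ltW lt).
  by apply: ereal_sup_ubound; exists t => //=; rewrite in_itv.
apply/lee_addgt0Pr => e /H[g gh gP].
apply: ge_ereal_inf.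
exists (ereal_sup [set (enorm (A (g t) - B t))%:E | t in `[0, 1]%classic]); first by exists g.
apply: ge_ereal_sup => r [t]; rewrite /= in_itv /= => t01 <-.
by rewrite -EFinD lee_fin gP.
Qed.

(** The source of the factor 3: [A] and [A'] are two subcurves served by the same centre [C], and
    [B] is the simplification of [A]. The matching runs from B to A, back to C through the inverse
    of its homeomorphism, and on to A'. *)
Lemma frechet_le3 A A' B C (a b c : R) :
  (frechet A C <= a%:E)%E -> (frechet A' C <= b%:E)%E -> (frechet A B <= c%:E)%E ->
  (frechet A' B <= (a + b + c)%:E)%E.
Proof.
move=> /frechet_leP HA /frechet_leP HA' /frechet_leP HB.
apply/frechet_leP => e e0; have e3 : 0 < e / 3 by rewrite divr_gt0.
have [g2 g2h g2P] := HA _ e3; have [g1 g1h g1P] := HA' _ e3.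
have [g3 g3h g3P] := HB _ e3; have [h [hh hP]] := incr_homeo_inv g2h.
exists (g1 \o (h \o g3)); first by do 2 apply: incr_homeo_comp => //.
move=> t t01 /=; have t3 := incr_homeo_on01 g3h t01.
have th := incr_homeo_on01 hh t3.
apply: le_trans (enorm_dist _ (C (h (g3 t))) _) _.
apply: le_trans (lerD (lexx _) (enorm_dist _ (A (g3 t)) _)) _.
have := g1P _ th; have := g2P _ th; have := g3P _ t01.
rewrite hP // [enorm (A _ - C _)]enormB; lra.
Qed.

End FrechetDistance.

Section MonotonePaths.
Variable R : realType.
Implicit Types (free : R -> R -> Prop) (x y s u : R).

(* A monotone path is parametrized by s = x + y, which makes both coordinates 1-Lipschitz. *)
Definition mpath free x0 y0 x1 y1 := exists X : R -> R,
  [/\ X (x0 + y0) = x0, X (x1 + y1) = x1, x0 + y0 <= x1 + y1,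
      forall s s', x0 + y0 <= s -> s <= s' -> s' <= x1 + y1 -> 0 <= X s' - X s <= s' - s &
      forall s, x0 + y0 <= s <= x1 + y1 -> free (X s) (s - X s)].

Lemma mpath_refl free x y : free x y -> mpath free x y x y.
Proof.
move=> fxy; exists (fun=> x); split=> // [s s' *|s]; first by lra.
by rewrite -eq_le => /eqP <-; have -> : x + y - x = y by lra.
Qed.

Lemma mpath_end free x0 y0 x1 y1 : mpath free x0 y0 x1 y1 -> free x1 y1.
Proof.
case=> X [_ X1 le _ /(_ (x1 + y1))]; rewrite X1 lexx andbT => /(_ le).
by have -> : x1 + y1 - x1 = y1 by lra.
Qed.

(** The progress [w] along the segment is affine in s = x + y, so appending the segment keeps both
    coordinates monotone and 1-Lipschitz. *)
Lemma mpath_segment free x0 y0 x1 y1 x2 y2 : mpath free x0 y0 x1 y1 ->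
  x1 <= x2 -> y1 <= y2 ->
  (forall u, on01 u -> free (x1 + u * (x2 - x1)) (y1 + u * (y2 - y1))) ->
  mpath free x0 y0 x2 y2.
Proof.
move=> [X [X0 X1 le Xm Xf]] x12 y12 seg.
(* A segment of length zero would make [w] divide by zero. *)
have [e12|/eqP n12] := eqVneq (x1 + y1) (x2 + y2).
  have [-> ->] : x2 = x1 /\ y2 = y1 by lra.
  by exists X; split.
pose w s := (s - (x1 + y1)) / (x2 + y2 - (x1 + y1)).
have D0 : 0 < x2 + y2 - (x1 + y1) by lra.
have wE s : w s * (x2 - x1) + w s * (y2 - y1) = s - (x1 + y1).
  by rewrite -mulrDr /w -mulrA [X in _ * X](_ : _ = 1) ?mulr1 //; field; lra.
have w_le s s' : s <= s' -> w s <= w s'.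
  by move=> ss'; rewrite ler_pM2r ?invr_gt0 // lerB.
have w0 s : x1 + y1 <= s -> 0 <= w s by move=> h; rewrite /w divr_ge0 ?(ltW D0) // subr_ge0.
have w1 s : s <= x2 + y2 -> w s <= 1.
  by move=> h; rewrite /w ler_pdivrMr // mul1r lerB.
pose X' s := if s <= x1 + y1 then X s else x1 + w s * (x2 - x1).
exists X'; split.
- by rewrite /X' le.
- rewrite /X' ifF; last by lra.
  have := wE (x2 + y2); have : w (x2 + y2) = 1 by rewrite /w divff //; lra.
  by move=> ->; lra.
- lra.
- move=> s s' h1 h2 h3; rewrite /X'; have [a|a] := leP s' (x1 + y1).
    by rewrite (le_trans h2 a); apply: Xm.
  have [b|b] := leP s (x1 + y1).
    have := Xm s (x1 + y1) h1 b (lexx _); rewrite X1.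
    have := w0 s' (ltW a); have := wE s'; nra.
  have := w_le _ _ h2; have := wE s'; have := wE s; nra.
- move=> s /andP[h1 h2]; rewrite /X'; case: leP => [a|a]; first by apply: Xf; rewrite h1.
  have -> : s - (x1 + w s * (x2 - x1)) = y1 + w s * (y2 - y1) by have := wE s; lra.
  by apply: seg; rewrite /on01 w0 ?w1 // ltW.
Qed.

(** A coordinate of a monotone path may be constant on an interval; mixing in a little of the
    identity makes it strictly increasing and moves it only slightly. *)
Lemma incr_homeo_mix (f : R -> R) (K eta : R) : f 0 = 0 -> f 1 = 1 ->
  (forall s s', 0 <= s -> s <= s' -> s' <= 1 -> 0 <= f s' - f s <= K * (s' - s)) ->
  0 < eta < 1 -> incr_homeo (fun s => (1 - eta) * f s + eta * s).
Proof.
move=> f0 f1 fK /andP[e0 e1]; apply: surj_incr_homeo; rewrite ?f0 ?f1; [lra|lra| |].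
  by move=> x y x0 xy y1; have := fK x y x0 (ltW xy) y1; nra.
move=> y /andP[y0 y1].
have [||c [? ?]] := @lipschitz_IVT R (fun s => (1 - eta) * f s + eta * s) (K + 1) 0 1 y ler01.
- move=> a b a0 ab b1; have /andP[? ?] := fK _ _ a0 ab b1.
  rewrite ger0_norm; nra.
- by rewrite f0 f1; lra.
by exists c.
Qed.

End MonotonePaths.

Section FrechetMonotonePaths.
Variables (R : realType) (d : nat) (F G : R -> 'rV[R]_d) (K delta x0 y0 x1 y1 : R).
Hypothesis FK : forall x y, enorm (F x - F y) <= K * `|x - y|.
Hypothesis GK : forall x y, enorm (G x - G y) <= K * `|x - y|.
Hypotheses (x01 : x0 < x1) (y01 : y0 < y1) (K0 : 0 <= K).

Let free x y := enorm (F x - G y) <= delta.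
Let A s := F (x0 + s * (x1 - x0)).
Let B s := G (y0 + s * (y1 - y0)).

(** Both coordinates of the path are normalised to [0, 1] and mixed with the identity. The
    displacements are at most eta Dx and eta Dy, so by the Lipschitz bound the distance grows by at
    most eta K D. *)
Lemma mpath_frechet : mpath free x0 y0 x1 y1 -> (frechet A B <= delta%:E)%E.
Proof.
case=> X [X0 X1 _ Xm Xf]; apply/frechet_leP => e e0.
pose Dx := x1 - x0; pose Dy := y1 - y0; pose D := Dx + Dy.
have Dx0 : 0 < Dx by rewrite subr_gt0.
have Dy0 : 0 < Dy by rewrite subr_gt0.
have D0 : 0 < D by rewrite addr_gt0.
have KD0 : 0 < K * D + 1 by rewrite ltr_wpDl // mulr_ge0 // ltW.
(* The first entry keeps eta below 1, the second makes eta K D at most e; the summand 1 avoids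
   division by zero. *)
pose eta := Num.min (1 / 2) (e / (K * D + 1)).
have eta0 : 0 < eta by rewrite lt_min divr_gt0 // divr_gt0.
have eta1 : eta < 1 by rewrite gt_min; apply/orP; left; lra.
have etaK : eta * (K * D) <= e.
  have : eta <= e / (K * D + 1) by rewrite ge_min lexx orbT.
  by rewrite ler_pdivlMr //; lra.
pose S s := x0 + y0 + s * D.
have S_in s : on01 s -> x0 + y0 <= S s <= x1 + y1.
  move=> /andP[? ?]; have -> : x1 + y1 = x0 + y0 + 1 * D by rewrite /D /Dx /Dy; lra.
  have : s * D <= 1 * D by rewrite ler_pM2r.
  have : 0 <= s * D by rewrite mulr_ge0 // ltW.
  by rewrite /S; lra.
have Sm s s' : 0 <= s -> s <= s' -> s' <= 1 ->
    0 <= X (S s') - X (S s) <= (s' - s) * D.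
  move=> s0 ss' s1.
  have -> : (s' - s) * D = S s' - S s by rewrite /S; lra.
  have /andP[? _] : x0 + y0 <= S s <= x1 + y1 by apply: S_in; rewrite /on01; lra.
  have /andP[_ ?] : x0 + y0 <= S s' <= x1 + y1 by apply: S_in; rewrite /on01; lra.
  by apply: Xm => //; rewrite /S lerD2l ler_pM2r.
have S0 : S 0 = x0 + y0 by rewrite /S; lra.
have S1 : S 1 = x1 + y1 by rewrite /S /D /Dx /Dy; lra.
pose fa s := (X (S s) - x0) / Dx; pose fb s := (S s - X (S s) - y0) / Dy.
have ah : incr_homeo (fun s => (1 - eta) * fa s + eta * s).
  apply: (@incr_homeo_mix R fa (D / Dx)); rewrite ?eta0 ?eta1 //.
  - by rewrite /fa S0 X0 subrr mul0r.
  - by rewrite /fa S1 X1 divff // gt_eqF.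
  - move=> s s' s0 ss' s1; have /andP[? ?] := Sm _ _ s0 ss' s1.
    rewrite /fa -mulrBl mulrAC divr_ge0 ?(ltW Dx0) /= ?ler_pM2r ?invr_gt0 //; lra.
have bh : incr_homeo (fun s => (1 - eta) * fb s + eta * s).
  apply: (@incr_homeo_mix R fb (D / Dy)); rewrite ?eta0 ?eta1 //.
  - by rewrite /fb S0 X0 (_ : _ - y0 = 0) ?mul0r //; lra.
  - by rewrite /fb S1 X1 (_ : _ - y0 = Dy) ?divff ?gt_eqF // /Dy; lra.
  - move=> s s' s0 ss' s1; have /andP[? ?] := Sm _ _ s0 ss' s1.
    rewrite /fb -mulrBl mulrAC divr_ge0 ?(ltW Dy0) /= ?ler_pM2r ?invr_gt0 //; rewrite /S; lra.
(* [frechet] reparametrizes only its first curve, so the reparametrization of the second one is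
   inverted. *)
have [h [hh hP]] := incr_homeo_inv bh.
exists ((fun s => (1 - eta) * fa s + eta * s) \o h); first exact: incr_homeo_comp.
move=> t t01; rewrite /A /B /= -[X in G (y0 + X * _)](hP t t01).
have /andP[s0 s1] := incr_homeo_on01 hh t01; set s := h t in s0 s1 *.
have xE : x0 + ((1 - eta) * fa s + eta * s) * Dx = X (S s) + eta * (s * Dx - (X (S s) - x0)).
  by rewrite /fa; field; rewrite gt_eqF.
have yE : y0 + ((1 - eta) * fb s + eta * s) * Dy =
    (S s - X (S s)) + eta * (s * Dy - (S s - X (S s) - y0)).
  by rewrite /fb; field; rewrite gt_eqF.
rewrite -/Dx -/Dy xE yE; set ex := eta * _; set ey := eta * _.
have /andP[a1 a2] := Sm 0 s (lexx _) s0 s1; have /andP[b1 b2] := Sm s 1 s0 s1 (lexx _).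
rewrite S0 X0 in a1 a2; rewrite S1 X1 in b1 b2.
have nx : `|ex| <= eta * Dx.
  rewrite normrM (gtr0_norm eta0) ler_pM2l // ler_norml.
  by rewrite /Dx; rewrite /Dx in Dx0; apply/andP; split; nra.
have ny : `|ey| <= eta * Dy.
  rewrite normrM (gtr0_norm eta0) ler_pM2l // ler_norml /S.
  move: a1 a2 b1 b2; rewrite /D => a1 a2 b1 b2.
  have ? : x1 = x0 + Dx by rewrite /Dx; lra.
  by apply/andP; split; nra.
apply: le_trans (enorm_dist _ (F (X (S s))) _) _.
apply: le_trans (lerD (FK _ _) (enorm_dist _ (G (S s - X (S s))) _)) _.
apply: le_trans (lerD (lexx _) (lerD (Xf _ (S_in _ _)) (GK _ _))) _; first by rewrite /on01 s0.
rewrite [X in K * `|X|]addrAC subrr add0r.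
rewrite [X in _ + (_ + K * `|X|)](_ : _ = - ey); last by lra.
rewrite normrN; move: etaK; rewrite /D.
have : K * `|ex| <= K * (eta * Dx) by apply: ler_wpM2l.
have : K * `|ey| <= K * (eta * Dy) by apply: ler_wpM2l.
nra.
Qed.

Let feasible e (g : R -> R) := incr_homeo g /\
  forall t, on01 t -> enorm (A (g t) - B t) <= delta + e.
(** Abscissas at which the graphs of the e-feasible reparametrizations meet the antidiagonal x + y =
    s. *)
Let slice e s := [set x | exists g t, [/\ feasible e g, on01 t,
   x = x0 + g t * (x1 - x0) & x + (y0 + t * (y1 - y0)) = s]].

(* The compactness argument: the upper envelope of the almost feasible
   reparametrizations is itself a path in the closed free space. *)
Lemma frechet_mpath : (frechet A B <= delta%:E)%E -> mpath free x0 y0 x1 y1.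
Proof.
move=> /frechet_leP HF.
have feas e : 0 < e -> exists g, feasible e g.
  by move=> /HF[g gh gP]; exists g.
have x01' := x01; have y01' := y01; have K0' := K0.
have cross g s : incr_homeo g -> x0 + y0 <= s <= x1 + y1 -> exists t,
    on01 t /\ x0 + g t * (x1 - x0) + (y0 + t * (y1 - y0)) = s.
  move=> gh /andP[s0 s1].
  have [g0 [g1 [gc gm]]] := gh.
  have [||c] := @IVT R (fun t => x0 + g t * (x1 - x0) + (y0 + t * (y1 - y0))) 0 1 s ler01.
    move=> z; apply: cvgD.
      apply: cvgD; first exact: cvg_cst.
      by apply: cvgM; [exact: gc|exact: cvg_cst].
    apply: cvgD; first exact: cvg_cst.
    apply: cvgM; last exact: cvg_cst.
    by apply: continuous_subspaceT => w; exact: cvg_id.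
    by rewrite g0 g1 min_l ?max_r; lra.
  by rewrite in_itv /= => c01 <-; exists c.
have slice_rng e s x : slice e s x -> x0 <= x <= x1.
  move=> [g [t [[gh _] t01 -> _]]]; have /andP[g0 g1] := incr_homeo_on01 gh t01.
  have : g t * (x1 - x0) <= 1 * (x1 - x0) by rewrite ler_pM2r ?subr_gt0.
  have : 0 <= g t * (x1 - x0) by rewrite mulr_ge0 // subr_ge0 ltW.
  by lra.
have slice0 e s : 0 < e -> x0 + y0 <= s <= x1 + y1 -> slice e s !=set0.
  move=> /feas[g gf] /(cross g s gf.1)[t [t01 tE]].
  by exists (x0 + g t * (x1 - x0)), g, t.
have slice_sup e s : 0 < e -> x0 + y0 <= s <= x1 + y1 -> has_sup (slice e s).
  by move=> e0 hs; split; [exact: slice0|exists x1 => x /slice_rng/andP[]].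
(* No convergent sequence of reparametrizations is extracted: the suprema are nondecreasing in e and
   inherit from the graphs the monotone 1-Lipschitz dependence on s, and their infimum over e is the
   path. *)
pose u e s := sup (slice e s).
have u_ge e s x : 0 < e -> x0 + y0 <= s <= x1 + y1 -> slice e s x -> x <= u e s.
  by move=> e0 hs; apply/sup_upper_bound/slice_sup.
have u_le e s b : 0 < e -> x0 + y0 <= s <= x1 + y1 ->
    (forall x, slice e s x -> x <= b) -> u e s <= b.
  by move=> e0 hs hb; apply: ge_sup => //; exact: slice0.
have u_rng e s : 0 < e -> x0 + y0 <= s <= x1 + y1 -> x0 <= u e s <= x1.
  move=> e0 hs; have [x xs] := slice0 e s e0 hs.
  have /andP[? _] := slice_rng _ _ _ xs.
  rewrite (le_trans _ (u_ge _ _ _ e0 hs xs)) //=.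
  by apply: u_le => // z /slice_rng/andP[].
have u_e e e' s : 0 < e -> e <= e' -> x0 + y0 <= s <= x1 + y1 -> u e s <= u e' s.
  move=> e0 ee' hs; apply: u_le => // x [g [t [[gh gP] t01 xE sE]]].
  apply: u_ge => //; first exact: lt_le_trans ee'.
  by exists g, t; split=> //; split=> // z /gP/le_trans; apply; rewrite lerD2l.
have u_s e s s' : 0 < e -> x0 + y0 <= s -> s <= s' -> s' <= x1 + y1 ->
    u e s <= u e s' /\ u e s' <= u e s + (s' - s).
  move=> e0 h1 h2 h3.
  have hs : x0 + y0 <= s <= x1 + y1 by rewrite h1 (le_trans h2).
  have hs' : x0 + y0 <= s' <= x1 + y1 by rewrite h3 andbT (le_trans h1).
  (* Along one graph both coordinates grow together, so its points on two antidiagonals are ordered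
     in both coordinates. This gives monotonicity and the Lipschitz bound of [u] at once. *)
  have key g t t' : incr_homeo g -> on01 t -> on01 t' ->
      x0 + g t * (x1 - x0) + (y0 + t * (y1 - y0)) = s ->
      x0 + g t' * (x1 - x0) + (y0 + t' * (y1 - y0)) = s' ->
      g t <= g t' /\ t <= t'.
    move=> gh /andP[t0 t1] /andP[t0' t1'] E1 E2; have [tt|tt] := leP t t'.
      by split=> //; apply: incr_homeo_le.
    have gtt := incr_homeo_le gh t0' (ltW tt) t1; exfalso.
    have : g t' * (x1 - x0) <= g t * (x1 - x0) by rewrite ler_pM2r ?subr_gt0.
    have : t' * (y1 - y0) < t * (y1 - y0) by rewrite ltr_pM2r ?subr_gt0.
    lra.
  split; apply: u_le => // x [g [t [gf t01 -> sE]]].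
    have [t' [t01' E']] := cross g s' gf.1 hs'.
    have [gtt _] := key g t t' gf.1 t01 t01' sE E'.
    apply: (@le_trans _ _ (x0 + g t' * (x1 - x0))); first by nra.
    by apply: u_ge => //; exists g, t'.
  have [t' [t01' E']] := cross g s gf.1 hs.
  have [gtt tt] := key g t' t gf.1 t01' t01 E' sE.
  have : x0 + g t' * (x1 - x0) <= u e s by apply: u_ge => //; exists g, t'.
  by nra.
pose X s := inf [set u e s | e in [set e | 0 < e]].
have inf_ok s : x0 + y0 <= s <= x1 + y1 -> has_inf [set u e s | e in [set e | 0 < e]].
  move=> hs; split; first by exists (u 1 s), 1 => //=; exact: ltr01.
  by exists x0 => _ [e e0 <-]; have /andP[] := u_rng e s e0 hs.
have X_le e s : 0 < e -> x0 + y0 <= s <= x1 + y1 -> X s <= u e s.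
  by move=> e0 hs; apply: ge_inf; [exact: (inf_ok s hs).2|exists e].
have X_ge s b : x0 + y0 <= s <= x1 + y1 -> (forall e, 0 < e -> b <= u e s) -> b <= X s.
  by move=> hs hb; apply: lb_le_inf; [exact: (inf_ok s hs).1|move=> _ [e e0 <-]; exact: hb].
have Dle : x0 + y0 <= x1 + y1 by lra.
exists X; split=> //.
- have hs : x0 + y0 <= x0 + y0 <= x1 + y1 by rewrite lexx.
  apply/le_anti/andP; split; last by apply: X_ge => // e e0; have /andP[] := u_rng e _ e0 hs.
  apply: le_trans (X_le 1 _ ltr01 hs) _; apply: u_le => // x xs.
  have [g [t [_ /andP[t0 _] _ E]]] := xs; have := slice_rng _ _ _ xs; nra.
- have hs : x0 + y0 <= x1 + y1 <= x1 + y1 by rewrite lexx andbT.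
  apply/le_anti/andP; split.
    by apply: le_trans (X_le 1 _ ltr01 hs) _; have /andP[] := u_rng 1 _ ltr01 hs.
  apply: X_ge => // e e0; have [x xs] := slice0 _ _ e0 hs.
  apply: le_trans (u_ge _ _ _ e0 hs xs).
  have [g [t [_ /andP[_ t1] _ E]]] := xs; have := slice_rng _ _ _ xs; nra.
- move=> s s' h1 h2 h3.
  have hs : x0 + y0 <= s <= x1 + y1 by rewrite h1 (le_trans h2).
  have hs' : x0 + y0 <= s' <= x1 + y1 by rewrite h3 andbT (le_trans h1).
  rewrite subr_ge0; apply/andP; split.
    apply: X_ge => // e e0; apply: le_trans (X_le e s e0 hs) _.
    by have [] := u_s e s s' e0 h1 h2 h3.
  rewrite lerBlDl -lerBlDr; apply: X_ge => // e e0.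
  have [_ us] := u_s e s s' e0 h1 h2 h3; have := X_le e s' e0 hs'; lra.
- move=> s hs; apply/ler_addgt0Pr => e e0.
  (* Shifting both arguments by at most eta costs 2 K eta, and the tolerance e2 <= eta of the chosen
     reparametrization costs eta; together this is e. *)
  pose eta := e / (2 * K + 1).
  have eta0 : 0 < eta by rewrite divr_gt0 //; lra.
  have etaK : 2 * K * eta + eta = e.
    by rewrite -[X in _ + X]mul1r -mulrDl mulrC divfK //; lra.
  have [_ [e1 e10 <-] e1P] := inf_adherent eta0 (inf_ok s hs).
  pose e2 := Num.min e1 eta.
  have e20 : 0 < e2 by rewrite lt_min e10.
  have ue2 : u e2 s < X s + eta by apply: le_lt_trans e1P; apply: u_e => //; rewrite ge_min lexx.
  have [x xs xP] := sup_adherent eta0 (slice_sup e2 s e20 hs).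
  have xle := u_ge _ _ _ e20 hs xs; have Xle := X_le e2 s e20 hs.
  have dX : `|X s - x| <= eta by rewrite ler_norml; apply/andP; split; rewrite -/(u e2 s) in xP; lra.
  have [g [t [[_ gP] t01 xE sE]]] := xs.
  have := gP t t01; rewrite /A /B -xE.
  have -> : y0 + t * (y1 - y0) = s - x by lra.
  have e2e : e2 <= eta by rewrite ge_min lexx orbT.
  move=> dxy; rewrite /free.
  apply: le_trans (enorm_dist _ (F x) _) _.
  apply: le_trans (lerD (FK _ _) (enorm_dist _ (G (s - x)) _)) _.
  apply: le_trans (lerD (lexx _) (lerD dxy (GK _ _))) _.
  rewrite [X in _ + (_ + K * `|X|)](_ : _ = X s - x); last by lra.
  have : K * `|X s - x| <= K * eta by apply: ler_wpM2l.
  lra.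
Qed.

End FrechetMonotonePaths.

(** * Free space of polygonal curves *)

Section PolygonalCurves.
Variables (R : realType) (d : nat).
Implicit Types (p : seq 'rV[R]_d) (x y : R).

Definition edges (n : nat) := maxn 1 n.-1.
(* A one-vertex curve is treated as one degenerate edge. *)
Definition vertex p i : 'rV[R]_d := nth 0 p (minn i (size p).-1).
(** In this time scale vertex i is passed at time i, so the cells of the free space diagram are unit
    squares with integer corners. *)
Definition stretched p x := polycurve p (x / (edges (size p))%:R).

Lemma edges_gt0 n : (0 < edges n)%N.
Proof. by rewrite leq_max. Qed.

Lemma edgesR_gt0 n : 0 < (edges n)%:R :> R.
Proof. by rewrite ltr0n edges_gt0. Qed.

Lemma clamp01_ge1 x : 1 <= x -> clamp01 x = 1.
Proof. by move=> x1; rewrite /clamp01 min_l // le_max x1 orbT. Qed.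

Lemma clamp01_le0 x : x <= 0 -> clamp01 x = 0.
Proof. by move=> x0; rewrite /clamp01 max_l // min_r. Qed.

Lemma clamp01_id x : 0 <= x <= 1 -> clamp01 x = x.
Proof. by move=> /andP[x0 x1]; rewrite /clamp01 max_r // min_r. Qed.

Lemma clamp01_lip x y : `|clamp01 x - clamp01 y| <= `|x - y|.
Proof.
wlog xy : x y / x <= y.
  by move=> H; case: (leP x y) => [|/ltW] /H //; rewrite distrC [X in _ <= X -> _]distrC.
rewrite distrC [X in _ <= X]distrC [X in _ <= X]ger0_norm ?subr_ge0 //.
rewrite ler_norml /clamp01; case: (leP 0 x) => ?; case: (leP 0 y) => ?;
rewrite /Num.min; do 2 case: ltP => ?; lra.
Qed.

Lemma stretched_edge p i x : (i < edges (size p))%N -> i%:R <= x <= i%:R + 1 ->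
  stretched p x = vertex p i + (x - i%:R) *: (vertex p i.+1 - vertex p i).
Proof.
rewrite /stretched /edges /vertex /polycurve; case: (posnP (size p).-1) => [-> _ _|N0].
  by rewrite big_ord0 !minn0 subrr scaler0.
have -> : maxn 1 (size p).-1 = (size p).-1 by apply/maxn_idPr.
move: (size p).-1 N0 => N N0 iN /andP[ix xi].
rewrite divfK ?pnatr_eq0 -?lt0n // (minn_idPl (ltnW iN)) (minn_idPl iN).
rewrite -(big_mkord xpredT (fun j => clamp01 (x - j%:R) *: (nth 0 p j.+1 - nth 0 p j))).
rewrite (@big_cat_nat _ _ _ i) ?(ltnW iN) //= [X in _ + (_ + X)]big_ltn //=.
rewrite [X in _ + (_ + (_ + X))]big_nat_cond [X in _ + (_ + (_ + X))]big1 => [|j]; last first.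
  move=> H. have ij : (i < j)%N by move: H; rewrite andbT => /andP[].
  rewrite clamp01_le0 ?scale0r //.
  have : (i.+1)%:R <= j%:R :> R by rewrite ler_nat.
  by rewrite -natr1; lra.
rewrite addr0 clamp01_id; last by lra.
rewrite addrA; congr (_ + _).
rewrite (@eq_big_nat _ _ _ _ _ _ (fun j => nth 0 p j.+1 - nth 0 p j)) => [|j /andP[_ ji]].
  by rewrite telescope_sumr // addrC subrK.
rewrite clamp01_ge1 ?scale1r //.
have : (j.+1)%:R <= i%:R :> R by rewrite ler_nat.
by rewrite -natr1; lra.
Qed.

(** Any constant will do: it enters the limit arguments that relate homeomorphisms and paths, never
    the algorithm. *)
Lemma stretched_lip p : exists2 K, 0 <= K &
  forall x y, enorm (stretched p x - stretched p y) <= K * `|x - y|.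
Proof.
pose e i := enorm (nth 0 p i.+1 - nth 0 p i).
pose c := (edges (size p))%:R^-1 * (size p).-1%:R : R.
have c0 : 0 <= c by rewrite mulr_ge0 // invr_ge0.
exists (c * \sum_(i < (size p).-1) e i).
  by rewrite mulr_ge0 // sumr_ge0 // => i _; exact: enorm_ge0.
move=> x y; rewrite /stretched /polycurve opprD addrACA subrr add0r -sumrB.
rewrite mulr_sumr.
elim/big_ind2: _ => [|u a v b ua vb|i _].
- by rewrite /enorm (eq_bigr (fun=> 0)) ?big1 ?sqrtr0 // => i _; rewrite mxE expr0n.
- by apply: le_trans (enormD _ _) _; rewrite mulrDl; exact: lerD.
rewrite -scalerBl enormZ [c * e i * _]mulrAC; apply: ler_wpM2r; first exact: enorm_ge0.
apply: le_trans (clamp01_lip _ _) _.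
have -> : x / (edges (size p))%:R * (size p).-1%:R - i%:R -
  (y / (edges (size p))%:R * (size p).-1%:R - i%:R) = c * (x - y) by rewrite /c; ring.
by rewrite normrM ger0_norm.
Qed.

Definition free_space p q (delta : R) x y := enorm (stretched p x - stretched q y) <= delta.

(** Over one cell both curves are affine, hence so is their difference, and the norm is convex. *)
Lemma free_space_convex p q delta (i j : nat) x1 y1 x2 y2 u :
  (i < edges (size p))%N -> (j < edges (size q))%N ->
  i%:R <= x1 <= i%:R + 1 -> i%:R <= x2 <= i%:R + 1 ->
  j%:R <= y1 <= j%:R + 1 -> j%:R <= y2 <= j%:R + 1 -> on01 u ->
  free_space p q delta x1 y1 -> free_space p q delta x2 y2 ->
  free_space p q delta (x1 + u * (x2 - x1)) (y1 + u * (y2 - y1)).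
Proof.
move=> iN jM hx1 hx2 hy1 hy2 /andP[u0 u1]; rewrite /free_space.
have aff (s : seq 'rV[R]_d) k z1 z2 : (k < edges (size s))%N ->
    k%:R <= z1 <= k%:R + 1 -> k%:R <= z2 <= k%:R + 1 ->
    stretched s (z1 + u * (z2 - z1)) = (1 - u) *: stretched s z1 + u *: stretched s z2.
  move=> ks h1 h2; rewrite !(@stretched_edge s k) //; last first.
    by move/andP: h1 => [? ?]; move/andP: h2 => [? ?]; apply/andP; split; nra.
  by apply/rowP => c; rewrite !mxE; ring.
rewrite (aff p i) // (aff q j) // => f1 f2.
have -> : (1 - u) *: stretched p x1 + u *: stretched p x2 -
  ((1 - u) *: stretched q y1 + u *: stretched q y2) =
  (1 - u) *: (stretched p x1 - stretched q y1) + u *: (stretched p x2 - stretched q y2).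
  by apply/rowP => c; rewrite !mxE; ring.
apply: le_trans (enormD _ _) _; rewrite !enormZ !ger0_norm //; last by lra.
have : (1 - u) * enorm (stretched p x1 - stretched q y1) <= (1 - u) * delta.
  by apply: ler_wpM2l => //; lra.
have : u * enorm (stretched p x2 - stretched q y2) <= u * delta by apply: ler_wpM2l.
lra.
Qed.

(** A subcurve occupies a vertical strip of the diagram of the whole curve, so one diagram serves
    all subcurves. *)
Lemma frechet_subcurve p l (q : l.-tuple 'rV[R]_d) (a b delta : R) : a < b ->
  (frechet (subcurve (polycurve p) a b) (curve_of q) <= delta%:E)%E <->
  mpath (free_space p q delta) (a * (edges (size p))%:R) 0
    (b * (edges (size p))%:R) (edges l)%:R.
Proof.
move=> ab.
have [K1 K10 K1P] := stretched_lip p; have [K2 K20 K2P] := stretched_lip q.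
pose K := Num.max K1 K2.
have KP x y : enorm (stretched p x - stretched p y) <= K * `|x - y|.
  by apply: le_trans (K1P _ _) _; rewrite ler_wpM2r // le_max lexx.
have KQ x y : enorm (stretched q x - stretched q y) <= K * `|x - y|.
  by apply: le_trans (K2P _ _) _; rewrite ler_wpM2r // le_max lexx orbT.
set N := (edges (size p))%:R; set M := (edges l)%:R.
have N0 : 0 < N := edgesR_gt0 _; have M0 : 0 < M := edgesR_gt0 _.
have -> : subcurve (polycurve p) a b = fun s => stretched p (a * N + s * (b * N - a * N)).
  apply/funext => s; rewrite /subcurve /stretched; congr polycurve.
  by rewrite -/N; field; rewrite gt_eqF.
have -> : curve_of q = fun s => stretched q (0 + s * (M - 0)).
  apply/funext => s; rewrite /curve_of /stretched; congr polycurve.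
  by rewrite size_tuple -/M; field; rewrite gt_eqF.
have abN : a * N < b * N by rewrite ltr_pM2r.
have K0 : 0 <= K by rewrite le_max K10.
split; [exact: (@frechet_mpath R d _ _ K) | exact: (@mpath_frechet R d _ _ K)].
Qed.

End PolygonalCurves.

(** * Reachability in the free space diagram *)

Section Reachability.
Variables (R : realType) (N M : nat) (free : R -> R -> Prop).
Variables (fl fb : nat -> nat -> R * R).

(** Emptiness is not a separate case: any pair with [f.1 > f.2], such as (2, 0), describes the empty
    set. *)
Definition describes (f : R * R) (Q : R -> Prop) :=
  [/\ 0 <= f.1, f.2 <= 1 & forall u, on01 u -> Q u <-> f.1 <= u <= f.2].

(* The lower end of the reachable part of a cell side with free interval f,
   when a and b are those of the orthogonal and the parallel side through which the
   cell is entered; an empty set is encoded by 2. *)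
Definition propagate (f : R * R) (a b : R) : R :=
  let c := if a <= 1 then f.1 else Num.max f.1 b in if c <= f.2 then c else 2.

(** The outer boundary x = 0 gets the value 2 (empty): a path climbing along it is already seen as
    passing through the bottom sides of its cells. *)
Fixpoint reach_left (row : nat -> R) (j i : nat) : R :=
  if i is i'.+1 then propagate (fl i j) (row i') (reach_left row j i') else 2.

Fixpoint reach_row (init : nat -> R) (j : nat) : nat -> R :=
  if j is j'.+1 then
    fun i => propagate (fb i j) (reach_left (reach_row init j') j' i) (reach_row init j' i)
  else init.

(** The other bottom sides start as empty even if a path can run along y = 0: it then leaves cell
    [ia] through its right side and is propagated by [reach_left]. *)
Definition start_row (ia : nat) (ua : R) (i : nat) : R :=
  if (i == ia) && ((fb ia 0).1 <= ua <= (fb ia 0).2) then ua else 2.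

Hypothesis flP : forall i j, (i <= N)%N -> (j < M)%N ->
  describes (fl i j) (fun u => free i%:R (j%:R + u)).
Hypothesis fbP : forall i j, (i < N)%N -> (j <= M)%N ->
  describes (fb i j) (fun u => free (i%:R + u) j%:R).
Hypothesis freeC : forall i j x1 y1 x2 y2 u, (i < N)%N -> (j < M)%N ->
  i%:R <= x1 <= i%:R + 1 -> i%:R <= x2 <= i%:R + 1 ->
  j%:R <= y1 <= j%:R + 1 -> j%:R <= y2 <= j%:R + 1 -> on01 u ->
  free x1 y1 -> free x2 y2 -> free (x1 + u * (x2 - x1)) (y1 + u * (y2 - y1)).

(** Completeness of one step; [propagate_sound] is its converse at the computed lower end, where a
    value at most 1 signals a nonempty reachable part. *)
Lemma propagate_le f Q a b v : describes f Q -> on01 v -> Q v ->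
  a <= 1 \/ b <= v -> propagate f a b <= v.
Proof.
move=> [_ _ fQ] v01 Qv H; have /andP[f1 f2] := (fQ v v01).1 Qv.
have cv : (if a <= 1 then f.1 else Num.max f.1 b) <= v.
  by case: ifP H => // a1 [//|bv]; rewrite ge_max f1.
by rewrite /propagate (le_trans cv f2).
Qed.

Lemma propagate_sound f Q a b : describes f Q -> propagate f a b <= 1 ->
  [/\ on01 (propagate f a b), Q (propagate f a b) & a <= 1 \/ b <= propagate f a b].
Proof.
move=> [f0 f1 fQ]; rewrite /propagate.
set c := if a <= 1 then _ else _; have [cf c1|_ ?] := leP c f.2; last by exfalso; lra.
have fc : f.1 <= c by rewrite /c; case: ifP => // _; rewrite le_max lexx.
have c01 : on01 c by rewrite /on01 c1 (le_trans f0).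
split=> //; first by apply/fQ => //; rewrite fc.
by rewrite /c; case: ifP => _; [left|right; rewrite le_max lexx orbT].
Qed.

Variables (ia : nat) (ua : R).
Hypotheses (iaN : (ia < N)%N) (ua01 : on01 ua) (M0 : (0 < M)%N).
Let x0 : R := ia%:R + ua.
Let row := reach_row (start_row ia ua).
Let left j := reach_left (row j) j.

(** The computed lower end is joined to the entry point of the cell by a straight segment, which is
    free by convexity and runs up and right. *)
Lemma left_sound j : (j < M)%N ->
  (forall i, (i < N)%N -> row j i <= 1 ->
     on01 (row j i) /\ mpath free x0 0 (i%:R + row j i) j%:R) ->
  forall i, (i <= N)%N -> left j i <= 1 ->
     on01 (left j i) /\ mpath free x0 0 i%:R (j%:R + left j i).
Proof.
move=> jM rowP; elim=> [_|i IHi iN]; first by rewrite /left /= => ?; exfalso; lra.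
rewrite /left /= -/(left j i) => le1.
have [c01 fc H] := propagate_sound (flP iN jM) le1; set c := propagate _ _ _ in le1 c01 fc H *.
split=> //; have /andP[c0 c1] := c01.
have iE : i.+1%:R = i%:R + 1 :> R by rewrite natr1.
have [r1|[lc l1]] : row j i <= 1 \/ left j i <= c /\ left j i <= 1.
- by case: H => H; [left|right; split=> //; apply: le_trans H c1].
- have [/andP[r0 _] path] := rowP i iN r1; have free1 := mpath_end path.
  apply: (mpath_segment path); [rewrite iE; lra|lra|move=> u u01].
  by apply: (freeC iN jM) => //; rewrite ?iE; apply/andP; split; lra.
- have [/andP[r0 _] path] := IHi (ltnW iN) l1; have free1 := mpath_end path.
  apply: (mpath_segment path); [rewrite iE; lra|lra|move=> u u01].
  by apply: (freeC iN jM) => //; rewrite ?iE; apply/andP; split; lra.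
Qed.

Lemma row_sound j : (j <= M)%N -> forall i, (i < N)%N -> row j i <= 1 ->
  on01 (row j i) /\ mpath free x0 0 (i%:R + row j i) j%:R.
Proof.
elim: j => [_|j IHj jM] i iN.
  rewrite /row /= /start_row; case: ifP => [/andP[/eqP-> fu] _|_ ?]; last by exfalso; lra.
  split; first by [].
  have [_ _ fP] := fbP iaN (leq0n M).
  by apply: mpath_refl; apply/fP.
rewrite /row /= -/(row j) -/(left j i) => le1.
have [c01 fc H] := propagate_sound (fbP iN jM) le1; set c := propagate _ _ _ in le1 c01 fc H *.
split=> //; have /andP[c0 c1] := c01.
have jE : j.+1%:R = j%:R + 1 :> R by rewrite natr1.
have [r1|[lc l1]] : left j i <= 1 \/ row j i <= c /\ row j i <= 1.
- by case: H => H; [left|right; split=> //; apply: le_trans H c1].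
- have [/andP[r0 _] path] := left_sound jM (IHj (ltnW jM)) (ltnW iN) r1.
  have free1 := mpath_end path.
  apply: (mpath_segment path); [lra|rewrite jE; lra|move=> u u01].
  by apply: (freeC iN jM) => //; rewrite ?jE; apply/andP; split; lra.
- have [/andP[r0 _] path] := IHj (ltnW jM) i iN l1.
  have free1 := mpath_end path.
  apply: (mpath_segment path); [lra|rewrite jE; lra|move=> u u01].
  by apply: (freeC iN jM) => //; rewrite ?jE; apply/andP; split; lra.
Qed.

Section Completeness.
Variables (X : R -> R) (s1 : R).
Hypothesis X0 : X x0 = x0.
Hypothesis Xm : forall s s', x0 <= s -> s <= s' -> s' <= s1 -> 0 <= X s' - X s <= s' - s.
Hypothesis Xf : forall s, x0 <= s <= s1 -> free (X s) (s - X s).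

Lemma cross_x v s : x0 <= s <= s1 -> x0 <= v <= X s ->
  exists2 s', x0 <= s' <= s & X s' = v.
Proof.
move=> /andP[h0 h1] /andP[v0 v1].
have [||t [t0 ft]] := @lipschitz_IVT R X 1 x0 s v h0; last by exists t.
- move=> x y hx xy hy; have := Xm hx xy (le_trans hy h1).
  by rewrite ler_norml => /andP[? ?]; apply/andP; split; lra.
- by rewrite X0 v0.
Qed.

Lemma cross_y v s : x0 <= s <= s1 -> 0 <= v <= s - X s ->
  exists2 s', x0 <= s' <= s & s' - X s' = v.
Proof.
move=> /andP[h0 h1] /andP[v0 v1].
have [||t [t0 ft]] := @lipschitz_IVT R (fun s => s - X s) 1 x0 s v h0; last by exists t.
- move=> x y hx xy hy; have := Xm hx xy (le_trans hy h1).
  by rewrite ler_norml => /andP[? ?]; apply/andP; split; lra.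
- by rewrite X0 subrr v0.
Qed.

Lemma path_le s s' : x0 <= s' <= s -> s <= s1 -> X s' <= X s /\ s' - X s' <= s - X s.
Proof. by move=> /andP[h1 h2] h3; have := Xm h1 h2 h3; lra. Qed.

Lemma row_step i j s : (i < N)%N -> (j < M)%N -> x0 <= s <= s1 ->
  i%:R <= X s <= i%:R + 1 -> s - X s = j.+1%:R ->
  row j i <= X s - i%:R \/ left j i <= (s - X s) - j%:R -> row j.+1 i <= X s - i%:R.
Proof.
move=> iN jM hs hx hy H; rewrite /row /= -/(row j) -/(left j i).
apply: (propagate_le (fbP iN jM)); first by rewrite /on01; lra.
  by rewrite addrC subrK -hy; exact: Xf.
case: H => H; [by right|left; apply: le_trans H _].
by rewrite hy -natr1; lra.
Qed.

Lemma left_step i j s : (i < N)%N -> (j < M)%N -> x0 <= s <= s1 ->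
  j%:R <= s - X s <= j%:R + 1 -> X s = i.+1%:R ->
  row j i <= X s - i%:R \/ left j i <= (s - X s) - j%:R -> left j i.+1 <= (s - X s) - j%:R.
Proof.
move=> iN jM hs hy hx H; rewrite /left /= -/(left j i).
apply: (propagate_le (flP iN jM)); first by rewrite /on01; lra.
  by rewrite addrC subrK -hx; exact: Xf.
case: H => H; [left; apply: le_trans H _|by right].
by rewrite hx -natr1; lra.
Qed.

(** Induction on i + j: going back along the path to where it entered the cell leads to the
    neighbour on the left or below. *)
Lemma reach_complete j i s : (j < M)%N -> (ia <= i < N)%N -> x0 <= s <= s1 ->
  i%:R <= X s <= i%:R + 1 -> j%:R <= s - X s <= j%:R + 1 ->
  row j i <= X s - i%:R \/ left j i <= (s - X s) - j%:R.
Proof.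
have /andP[ua0 ua1] := ua01.
have start : x0 - ia%:R = ua by rewrite /x0; lra.
have [n le_n] := ubnP (i + j); elim: n i j s le_n => // n IH i j s le_n jM /andP[ii iN] hs hx hy.
have /andP[hs0 hs1] := hs; have /andP[hx0 hx1] := hx; have /andP[hy0 hy1] := hy.
(* the path enters the cell through its left or its bottom side *)
have from_left s' : (ia < i)%N -> x0 <= s' <= s -> X s' = i%:R -> j%:R <= s' - X s' ->
    left j i <= (s - X s) - j%:R.
  move=> ii' hs' xE yj; have [_ yl] := path_le hs' hs1.
  case: i ii ii' iN hx hx0 hx1 le_n xE => // i' _ ii' iN hx hx0 hx1 le_n xE.
  have i'E : i'.+1%:R = i'%:R + 1 :> R by rewrite natr1.
  have hs1' : x0 <= s' <= s1 by case/andP: hs' => -> /le_trans; apply.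
  have yb : j%:R <= s' - X s' <= j%:R + 1 by rewrite yj (le_trans yl).
  apply: le_trans (_ : s' - X s' - j%:R <= _); last by lra.
  apply: (left_step (ltnW iN)) => //; apply: IH => //; first by apply/andP; split=> //; exact: ltnW.
  by rewrite xE i'E; apply/andP; split; lra.
have from_bottom s' : (0 < j)%N -> x0 <= s' <= s -> s' - X s' = j%:R -> i%:R <= X s' ->
    row j i <= X s - i%:R.
  move=> j0 hs' yE xi; have [xl _] := path_le hs' hs1.
  case: j j0 jM hy hy0 hy1 le_n yE {from_left} => // j' _ jM hy hy0 hy1 le_n yE.
  have j'E : j'.+1%:R = j'%:R + 1 :> R by rewrite natr1.
  have hs1' : x0 <= s' <= s1 by case/andP: hs' => -> /le_trans; apply.
  have xb : i%:R <= X s' <= i%:R + 1 by rewrite xi (le_trans xl).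
  apply: le_trans (_ : X s' - i%:R <= _); last by lra.
  apply: (row_step iN (ltnW jM)) => //; apply: IH => //.
  - by rewrite addnS in le_n.
  - exact: ltnW.
  - by rewrite ii.
  - by rewrite yE j'E; apply/andP; split; lra.
have [ixs|ixe] : (ia < i)%N \/ i = ia by case: ltngtP ii => //; [left|right].
  have iaE : ia%:R + 1 <= i%:R :> R by rewrite natr1 ler_nat.
  have ivx : x0 <= i%:R <= X s by rewrite hx0 andbT /x0; lra.
  have [sx hsx xE] := cross_x hs ivx.
  (* If the path meets x = i at height at least j, it came through the left side. Otherwise it meets
     y = j only to the right of x = i, that is, on the bottom side. *)
  have [yj|yj] := leP j%:R (sx - X sx); first by right; apply: (from_left sx).
  case: (posnP j) => [j0|j0]; last first.
    have jvy : (0 : R) <= j%:R <= s - X s by rewrite ler0n hy0.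
    have [sy hsy yE] := cross_y hs jvy.
    left; apply: (from_bottom sy) => //; rewrite -xE.
    have [//|ltxy] := leP (X sx) (X sy).
    have [lexy|/ltW lexy] := leP sx sy.
      have /andP[? ?] := hsx; have /andP[? ?] := hsy.
      have := @path_le sy sx; rewrite lexy andbT => H.
      by have [] := H _ _; lra.
    have /andP[? ?] := hsx; have /andP[? ?] := hsy.
    have [] := @path_le sx sy; [by rewrite lexy andbT|lra|lra].
  have /andP[? ?] := hsx; have [] := @path_le sx x0; first by rewrite lexx.
    by lra.
  by move: yj; rewrite X0 j0; lra.
(* In column [ia] the path never lies to the left of its start, so every entry counts as an entry
   through the bottom side. *)
left; case: (posnP j) => [j0|j0].
  rewrite j0 ixe /row /= /start_row eqxx /=.
  have [_ _ fP] := fbP iaN (leq0n M).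
  have -> : (fb ia 0).1 <= ua <= (fb ia 0).2.
    apply/fP => //; have := Xf (s := x0); rewrite lexx X0 subrr; apply.
    exact: le_trans hs1.
  have [] := @path_le s x0; rewrite ?lexx //.
  by rewrite X0; lra.
have jvy : (0 : R) <= j%:R <= s - X s by rewrite ler0n hy0.
have [sy hsy yE] := cross_y hs jvy.
apply: (from_bottom sy) => //; rewrite ixe.
have /andP[? ?] := hsy.
have [] := @path_le sy x0; rewrite ?lexx //; first by lra.
by rewrite X0 /x0; lra.
Qed.

End Completeness.

Lemma reach_correct ib ub : (ia <= ib < N)%N -> on01 ub -> x0 <= ib%:R + ub ->
  (row M ib <= ub <= (fb ib M).2) <-> mpath free x0 0 (ib%:R + ub) M%:R.
Proof.
move=> /andP[iib ibN] ub01 xab; have [f0 f1 fP] := fbP ibN (leqnn M).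
have /andP[ub0 ub1] := ub01.
split=> [/andP[h1 h2]|path].
  have r1 : row M ib <= 1 by lra.
  have [/andP[r0 _] path] := row_sound (leqnn M) ibN r1.
  have frow := mpath_end path.
  have fub : free (ib%:R + ub) M%:R.
    apply/fP => //; rewrite h2 andbT; apply: le_trans h1.
    case/fP/andP: frow => //; by rewrite /on01 r0.
  apply: (mpath_segment path); [lra|lra|move=> u u01].
  (* The final move runs along the top side of the diagram, which is convex as a side of a cell in
     row [M.-1]. *)
  have Mp : M.-1%:R + 1 = M%:R :> R by rewrite natr1 prednK.
  have MM : (M.-1 < M)%N by rewrite prednK.
  by apply: (freeC ibN MM) => //; rewrite ?Mp; apply/andP; split; lra.
have fub := mpath_end path; have /andP[_ u2] := (fP _ ub01).1 fub.
rewrite u2 andbT; case: path => X []; rewrite !addr0 => X0 X1 le Xm Xf.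
have MM : (M.-1 < M)%N by rewrite prednK.
have Mp : M.-1%:R + 1 = M%:R :> R by rewrite natr1 prednK.
have s1in : x0 <= ib%:R + ub + M%:R <= ib%:R + ub + M%:R by rewrite le lexx.
have Mk : (M.-1).+1 = M by rewrite prednK.
have := @row_step X _ Xf ib M.-1 _ ibN MM s1in; rewrite X1 Mk => H.
apply: le_trans (H _ _ _) _; [lra|ring| |lra].
have := @reach_complete X _ X0 Xm Xf M.-1 ib _ MM _ s1in; rewrite X1 iib ibN => H1.
by apply: H1 => //; lra.
Qed.

End Reachability.

(** * Free intervals of cell sides and the decision criterion *)

Section FreeIntervals.
Variables (R : realType) (d : nat).
Implicit Types (p q : seq 'rV[R]_d).

(* Solution set in [0, 1] of al u^2 + 2 be u + ga <= 0. *)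
Definition quad_interval (al be ga : R) : R * R :=
  if 0 < al then
    if be * be - al * ga < 0 then (2, 0)
    else let s := Num.sqrt (be * be - al * ga) in
         (Num.max 0 ((- be - s) / al), Num.min 1 ((- be + s) / al))
  else if 0 < ga then (2, 0) else (0, 1).

(** Multiplication by [al] completes the square to (al u + be)^2 <= be^2 - al ga. The leading
    coefficient vanishes only on a degenerate edge; the linear one then vanishes too and the
    condition is independent of u. *)
Lemma quad_intervalP al be ga : 0 <= al -> (al = 0 -> be = 0) ->
  describes (quad_interval al be ga) (fun u => al * u ^+ 2 + 2 * be * u + ga <= 0).
Proof.
move=> al0 albe; rewrite /quad_interval; have [al1|al1] := ltP 0 al; last first.
  have alE : al = 0 by apply/le_anti/andP.
  rewrite alE albe //; case: ltP => ga0; split=> //=; rewrite ?ler01 //.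
  - by move=> u _; split=> [|/andP[]]; lra.
  - by move=> u u01; split=> // _; lra.
have [D0|D0] := ltP (be * be - al * ga) 0.
  split=> //= u _; split=> [H|/andP[]]; last by lra.
  exfalso; have : 0 <= (al * u + be) ^+ 2 by apply: sqr_ge0.
  have : al * (al * u ^+ 2 + 2 * be * u + ga) <= 0 by rewrite pmulr_rle0.
  nra.
set s := Num.sqrt _; have s0 : 0 <= s := sqrtr_ge0 _.
have sE : s ^+ 2 = be * be - al * ga by rewrite sqr_sqrtr.
split=> /=; [by rewrite le_max lexx|by rewrite ge_min lexx|move=> u /andP[u0 u1]].
rewrite ge_max le_min u0 u1 /= ler_pdivrMr // ler_pdivlMr //.
have -> : (al * u ^+ 2 + 2 * be * u + ga <= 0) = ((al * u + be) ^+ 2 <= s ^+ 2).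
  rewrite -(pmulr_rle0 _ al1) sE -subr_ge0 -[RHS]subr_ge0; congr (_ <= _); ring.
rewrite -ler_sqrt ?sqr_ge0 // !sqrtr_sqr [X in _ <= X]ger0_norm // ler_norml.
by split=> /andP[h1 h2]; apply/andP; split; lra.
Qed.

(** The coefficients are those of |b + u (b' - b) - a|^2 - delta^2 as a polynomial in u, with the
    linear one halved. *)
Definition segment_interval (delta : R) (a b b' : 'rV[R]_d) : R * R :=
  quad_interval (\sum_(c < d) (b' 0 c - b 0 c) * (b' 0 c - b 0 c))
                (\sum_(c < d) (b 0 c - a 0 c) * (b' 0 c - b 0 c))
                (\sum_(c < d) (b 0 c - a 0 c) * (b 0 c - a 0 c) - delta * delta).

Lemma segment_intervalP delta a b b' : 0 <= delta ->
  describes (segment_interval delta a b b')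
    (fun u => enorm (b + u *: (b' - b) - a) <= delta).
Proof.
move=> d0; rewrite /segment_interval; set al := \sum_c _; set be := \sum_c _; set g := \sum_c _.
have [||f0 f1 fP] := @quad_intervalP al be (g - delta * delta).
- by apply: sumr_ge0 => c _; rewrite -expr2 sqr_ge0.
- move=> alE; rewrite /be big1 // => c _.
  have /eqP := alE; rewrite /al psumr_eq0 => [/allP/(_ c)|i _]; last by rewrite -expr2 sqr_ge0.
  by rewrite mem_index_enum mulf_eq0 orbb => /(_ isT)/eqP ->; rewrite mulr0.
split=> // u /fP <-; rewrite enorm_le // (_ : \sum_i _ = al * u ^+ 2 + 2 * be * u + g).
  by rewrite expr2 addrA subr_le0.
rewrite /al /be /g mulr_suml mulr_sumr mulr_suml -!big_split /=.
by apply: eq_bigr => c _; rewrite !mxE; ring.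
Qed.

Definition left_interval p q delta (i j : nat) :=
  segment_interval delta (vertex p i) (vertex q j) (vertex q j.+1).
Definition bottom_interval p q delta (i j : nat) :=
  segment_interval delta (vertex q j) (vertex p i) (vertex p i.+1).

Lemma stretched_vertex p i : (i <= edges (size p))%N -> stretched p i%:R = vertex p i.
Proof.
rewrite leq_eqVlt => /orP[/eqP ->|iN]; last first.
  by rewrite (stretched_edge iN) ?subrr ?scale0r ?addr0 // lexx lerDl ler01.
have N0 := edges_gt0 (size p); have NE := prednK N0.
rewrite (@stretched_edge _ _ _ (edges (size p)).-1) ?NE //.
  by rewrite -[X in (X%:R - _)]NE -natr1 addrAC subrr add0r scale1r addrC subrK.
by rewrite natr1 NE lexx andbT ler_nat leq_pred.
Qed.

Lemma left_intervalP p q delta i j : 0 <= delta ->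
  (i <= edges (size p))%N -> (j < edges (size q))%N ->
  describes (left_interval p q delta i j) (fun u => free_space p q delta i%:R (j%:R + u)).
Proof.
move=> d0 iN jM; have [f0 f1 fP] := segment_intervalP (vertex p i) (vertex q j) (vertex q j.+1) d0.
split=> // u u01; rewrite -fP // /free_space stretched_vertex // (stretched_edge jM).
  by rewrite enormB [X in X *: _]addrAC subrr add0r.
by rewrite lerDl lerD2l.
Qed.

Lemma bottom_intervalP p q delta i j : 0 <= delta ->
  (i < edges (size p))%N -> (j <= edges (size q))%N ->
  describes (bottom_interval p q delta i j) (fun u => free_space p q delta (i%:R + u) j%:R).
Proof.
move=> d0 iN jM; have [f0 f1 fP] := segment_intervalP (vertex q j) (vertex p i) (vertex p i.+1) d0.
split=> // u u01; rewrite -fP // /free_space (stretched_vertex jM) (stretched_edge iN).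
  by rewrite [X in X *: _]addrAC subrr add0r.
by rewrite lerDl lerD2l.
Qed.

(** Cells are half-open, except that the last one also has to receive the end point x = N. *)
Definition is_cell (N : nat) (x : R) (i : nat) :=
  [/\ (i < N)%N, i%:R <= x & x < i%:R + 1 \/ i.+1 = N].

Definition final_row p q delta ia ua : nat -> R :=
  reach_row (left_interval p q delta) (bottom_interval p q delta)
    (start_row (bottom_interval p q delta) ia ua) (edges (size q)).

(** The row does not depend on [b], which enters only the two final comparisons. *)
Lemma frechet_decision p l (q : l.-tuple 'rV[R]_d) (delta a b : R) ia ib :
  0 <= delta -> 0 <= a -> a < b -> b <= 1 ->
  is_cell (edges (size p)) (a * (edges (size p))%:R) ia ->
  is_cell (edges (size p)) (b * (edges (size p))%:R) ib ->
  (final_row p q delta ia (a * (edges (size p))%:R - ia%:R) ib <=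
     b * (edges (size p))%:R - ib%:R <= (bottom_interval p q delta ib (edges l)).2) <->
  (frechet (subcurve (polycurve p) a b) (curve_of q) <= delta%:E)%E.
Proof.
move=> d0 a0 ab b1; set N := edges (size p).
have N0 : 0 < N%:R :> R := edgesR_gt0 _ _.
have abN : a * N%:R < b * N%:R by rewrite ltr_pM2r.
have aN0 : 0 <= a * N%:R by rewrite mulr_ge0 // ltW.
have bN : b * N%:R <= N%:R by rewrite -[X in _ <= X]mul1r ler_pM2r.
have cell_le x i : x <= N%:R -> is_cell N x i -> on01 (x - i%:R).
  move=> xN [iN ix ix1]; apply/andP; split; first by lra.
  case: ix1 => [|iN1]; first by lra.
  have : N%:R = i%:R + 1 :> R by rewrite natr1 iN1.
  lra.
move=> ca cb; have ua01 := cell_le _ _ (ltW (lt_le_trans abN bN)) ca.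
have ub01 := cell_le _ _ bN cb.
have iab : (ia <= ib)%N.
  rewrite leqNgt; apply/negP => ba; case: ca => iaN iax _; case: cb => ibN ibx ibx1.
  have ibia : ib%:R + 1 <= ia%:R :> R by rewrite natr1 ler_nat.
  case: ibx1 => [|ibE]; first by lra.
  by move: ba; rewrite -ltnS ibE ltnNge iaN.
have [iaN _ _] := ca; have [ibN _ _] := cb.
rewrite frechet_subcurve // -/N.
have M0 := edges_gt0 l.
have -> : a * N%:R = ia%:R + (a * N%:R - ia%:R) by lra.
have -> : b * N%:R = ib%:R + (b * N%:R - ib%:R) by lra.
rewrite ![ _ + (_ - _) - _]addrAC !subrr !add0r.
rewrite /final_row size_tuple.
apply: (@reach_correct R N (edges l) (free_space p q delta)) => //.
- by move=> i j iN jM; apply: left_intervalP => //; rewrite size_tuple.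
- by move=> i j iN jM; apply: bottom_intervalP => //; rewrite size_tuple.
- by move=> i j x1 y1 x2 y2 u *; apply: (@free_space_convex _ _ p q delta i j) => //; rewrite size_tuple.
- by rewrite iab.
- by lra.
Qed.

End FreeIntervals.

(** * Coverage of elementary intervals and the greedy bound *)

Section Covering.
Variables (R : realType) (d l m : nat) (P : R -> 'rV[R]_d) (t : nat -> R).
Hypothesis tP : breakpoints m t.
Local Notation curve := (l.-tuple 'rV[R]_d).
Local Notation piece i j := (subcurve P (t i) (t j)).

(** Over a finite list the infimum is attained; otherwise the values would have a common lower bound
    above delta. The empty list is harmless, its infimum being +oo. *)
Lemma ereal_inf_seq_le (T : eqType) (s : seq T) (F : T -> \bar R) (delta : R) :
  (ereal_inf [set F x | x in [set x | x \in s]] <= delta%:E)%E ->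
  exists2 x, x \in s & (F x <= delta%:E)%E.
Proof.
move=> H; apply: contrapT => Hn.
have gt x : x \in s -> (delta%:E < F x)%E.
  by move=> xs; rewrite ltNge; apply/negP => Fx; apply: Hn; exists x.
have [e de eF] : exists2 e, (delta%:E < e)%E & forall x, x \in s -> (e <= F x)%E.
  elim: s gt {H Hn} => [_|x s IH gt]; first by exists +oo%E; rewrite ?ltry.
  have [y ys|e de eF] := IH; first by apply: gt; rewrite inE ys orbT.
  exists (Order.min e (F x)); first by rewrite lt_min de gt // mem_head.
  by move=> y; rewrite inE ge_min => /orP[/eqP->|/eF ->]; rewrite ?lexx ?orbT.
have : (e <= delta%:E)%E.
  by apply: le_trans H; apply: le_ereal_inf_tmp => _ [x xs <-]; exact: eF.
by rewrite leNgt de.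
Qed.

(** Index sets and centres range over finite sets, so both infima in [phi] yield witnesses without
    slack. *)
Lemma phi_leP (C : {fset curve}) (delta : R) : (phi m P t C <= delta%:E)%E <->
  exists2 I : {set 'I_m * 'I_m}, admissible t I &
    forall ij, ij \in I -> exists2 q, q \in C &
      (frechet (piece (val ij.1) (val ij.2)) (curve_of q) <= delta%:E)%E.
Proof.
split.
  rewrite /phi => H.
  pose adm := [seq I <- enum {: {set 'I_m * 'I_m}} | `[< admissible t I >]].
  have [|I] := @ereal_inf_seq_le _ adm (fun I => ereal_sup
     [set ereal_inf [set frechet (piece (val ij.1) (val ij.2)) (curve_of q) | q in [set q | q \in C]]
     | ij in [set ij | ij \in I]]) delta.
    apply: le_trans H; apply: le_ereal_inf => x [I It <-]; exists I => //=.
    by rewrite mem_filter mem_enum andbT; apply/asboolP.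
  rewrite mem_filter => /andP[/asboolP It _] HI; exists I => // ij ijI.
  have [|q qC qd] := @ereal_inf_seq_le _ (C : seq curve)
     (fun q => frechet (piece (val ij.1) (val ij.2)) (curve_of q)) delta.
    by apply: le_trans HI; apply: ereal_sup_ubound; exists ij.
  by exists q.
move=> [I It IP]; apply: ge_ereal_inf; eexists; first by exists I.
apply: ge_ereal_sup => x [ij ijI <-]; have [q qC qd] := IP ij ijI.
by apply: ge_ereal_inf; eexists; first by exists q.
Qed.

(** Here [e] stands for the elementary interval from t_e to t_(e+1). *)
Definition covers (delta : R) (q : curve) (e : nat) : Prop := exists a b,
  (a <= e < b)%N /\ (b < m)%N /\ (frechet (piece a b) (curve_of q) <= delta%:E)%E.

Lemma t_le i j : (i <= j < m)%N -> t i <= t j.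
Proof.
case: tP => _ [_ [_ tm]] /andP[]; rewrite leq_eqVlt => /orP[/eqP->//|ij jm].
by apply/ltW/tm; rewrite ij.
Qed.

(** The index set may consist of all pairs within [delta] of some centre; every point lies in an
    elementary interval, and that interval in one of these pairs. *)
Lemma phi_of_covers (C : {fset curve}) (delta : R) :
  (forall e, (e < m.-1)%N -> exists2 q, q \in C & covers delta q e) ->
  (phi m P t C <= delta%:E)%E.
Proof.
move=> cov; apply/phi_leP.
pose ok (ij : 'I_m * 'I_m) := (val ij.1 < val ij.2)%N /\ exists2 q, q \in C &
      (frechet (piece (val ij.1) (val ij.2)) (curve_of q) <= delta%:E)%E.
exists [set ij | `[< ok ij >]]%SET; last by move=> ij; rewrite inE => /asboolP[].
split=> [ij|x /andP[x0 x1]]; first by rewrite inE => /asboolP[].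
have [m1 [t0 [t1 _]]] := tP.
have [e em /andP[te ts]] : exists2 e, (e < m.-1)%N & t e <= x <= t e.+1.
  have : (0 < m.-1)%N by case: (m) m1 => [|[]].
  rewrite -t1 in x1; have : x <= t m.-1 by [].
  elim: (m.-1) => // n IH xn _.
  have [n0|n0] := posnP n; first by exists 0%N => //; rewrite n0 in xn *; rewrite t0 x0.
  have [xtn|/ltW tnx] := leP x (t n); last by exists n => //; rewrite tnx.
  by have [e en ex] := IH xtn n0; exists e => //; exact: ltnW.
have [q qC [a [b [/andP[ae eb] [bm fd]]]]] := cov e em.
have am : (a < m)%N by apply: leq_ltn_trans bm; apply: leq_trans ae (ltnW eb).
exists (Ordinal am, Ordinal bm) => /=.
  rewrite inE; apply/asboolP; split; first exact: leq_ltn_trans ae eb.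
  by exists q.
rewrite (le_trans (t_le _) te) ?(le_trans ts (t_le _)) ?eb ?ae //=.
by apply: leq_trans em (leq_pred _).
Qed.

(** By averaging, one of the k centres covers at least a k-th of the uncovered intervals; it is
    replaced by the simplification of any piece that it serves. *)
Lemma greedy_progress (Cs : {fset curve}) (Delta : R) (S : nat -> nat -> curve) (U : pred nat) :
  (phi m P t Cs <= Delta%:E)%E ->
  (forall i j, (i < j < m)%N -> is_simplification (piece i j) (S i j)) ->
  (0 < count U (iota 0 m.-1))%N ->
  exists i j, (i < j < m)%N /\ (count U (iota 0 m.-1) <= #|` Cs| *
     count (fun e => U e && `[< covers (3 * Delta) (S i j) e >]) (iota 0 m.-1))%N.
Proof.
move=> /phi_leP[I [Ilt Icov] IP] Sopt u0.
pose close (q : curve) (ij : 'I_m * 'I_m) := ij \in I /\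
  (frechet (piece (val ij.1) (val ij.2)) (curve_of q) <= Delta%:E)%E.
pose cov (q : curve) e := `[< exists ij : 'I_m * 'I_m, close q ij /\ (val ij.1 <= e < val ij.2)%N >].
pose cnt (q : curve) := count (fun e => U e && cov q e) (iota 0 m.-1).
set u := count U _ in u0 *; set k := #|` Cs|.
have ex_q e : (e < m.-1)%N -> exists2 q, q \in Cs & cov q e.
  move=> em; have [_ [t0 [t1 tm]]] := tP.
  have em1 : (e.+1 < m)%N by move: em; case: (m).
  have lt_e : t e < t e.+1 by apply: tm; rewrite ltnSn.
  have e0 : 0 <= t e by rewrite -t0; apply: t_le; rewrite /= ltnW.
  have e1 : t e.+1 <= 1 by rewrite -t1; apply: t_le; rewrite em /=; case: (m) em1.
  (* Pairs end at breakpoints, so a pair that contains the midpoint contains the whole elementary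
     interval; an end point would not determine the side. *)
  have [|ij ijI /andP[h1 h2]] := Icov ((t e + t e.+1) / 2); first by apply/andP; split; lra.
  have [q qC qd] := IP ij ijI; exists q => //; apply/asboolP; exists ij; split=> //.
  apply/andP; split; rewrite leqNgt; apply/negP => lt.
    have : t e.+1 <= t (val ij.1) by apply: t_le; rewrite lt ltn_ord.
    lra.
  have : t (val ij.2) <= t e by apply: t_le; rewrite -ltnS lt ltnW.
  lra.
have sum_ge : (u <= \sum_(q <- Cs) cnt q)%N.
  rewrite /u /cnt; under eq_bigr do rewrite -sum1_count big_mkcond.
  rewrite exchange_big -sum1_count big_mkcond /= big_seq [X in (_ <= X)%N]big_seq.
  apply: leq_sum => e; rewrite mem_iota add0n => /andP[_ em]; case: ifP => // Ue.
  have [q qC qe] := ex_q e em.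
  by rewrite (big_rem q) //= qe leq_addr.
have [q qC qmax] : exists2 q, q \in Cs & (u <= k * cnt q)%N.
  apply: contrapT => Hn.
  have lt q : q \in Cs -> (k * cnt q < u)%N.
    by move=> qC; rewrite ltnNge; apply/negP => ?; apply: Hn; exists q.
  have : (k * \sum_(q <- Cs) cnt q <= k * u.-1)%N.
    rewrite big_distrr /= [X in (_ <= X * _)%N]cardfE.
    have -> : (#|{: Cs}| * u.-1 = \sum_(q <- Cs) u.-1)%N.
      by rewrite big_const_seq count_predT iter_addn_0 mulnC -cardfE.
    rewrite big_seq [X in (_ <= X)%N]big_seq; apply: leq_sum => q qC.
    by rewrite -ltnS prednK // lt.
  have k0 : (0 < k)%N.
    have : (0 < \sum_(q <- Cs) cnt q)%N by apply: leq_trans sum_ge.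
    by rewrite /k; case: (enum_fset Cs) => //; rewrite big_nil.
  rewrite leq_pmul2l // => H; have := leq_trans sum_ge H.
  by rewrite -ltnS prednK // ltnn.
(* The piece to be simplified: one exists because [q] covers at least one uncovered interval. *)
have [ij0 [ij0I d0]] : exists ij, close q ij.
  have : (0 < cnt q)%N by move: (leq_trans u0 qmax); rewrite muln_gt0 => /andP[].
  by rewrite -has_count => /hasP[e _ /andP[_ /asboolP[ij [? _]]]]; exists ij.
have ij0m : (val ij0.1 < val ij0.2 < m)%N by rewrite Ilt // ltn_ord.
exists (val ij0.1), (val ij0.2); split=> //.
apply: leq_trans qmax _; rewrite leq_mul2l; apply/orP; right.
apply: sub_count => e /andP[-> /asboolP[ij [[ijI dij] /andP[ie ej]]]] /=.
apply/asboolP; exists (val ij.1), (val ij.2); rewrite ie ej ltn_ord; do 2 split => //.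
have -> : 3 * Delta = Delta + Delta + Delta by ring.
apply: (frechet_le3 d0 dij).
exact: le_trans (Sopt _ _ ij0m q) d0.
Qed.

End Covering.

(** Here [u i] is the number of uncovered intervals before round i. If at least 2^j remained after k
    rounds, each round would have removed at least 2^j / k, hence 2^j in all, leaving fewer than 2^j
    because [u 0] is below 2^(j+1). So k rounds lower the exponent by one. *)
Lemma greedy_rounds (k j r : nat) (u : nat -> nat) :
  (forall i, (i < r)%N -> (0 < u i)%N /\ (u i <= k * (u i - u i.+1))%N) ->
  (u 0%N < 2 ^ j)%N -> (r <= k * j)%N.
Proof.
elim: j r u => [|j IH] r u uP u0.
  case: r uP => // r /(_ 0%N isT)[]; by case: (u 0%N) u0.
have [rk|kr] := leqP r k; first by apply: leq_trans rk _; rewrite mulnS leq_addr.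
have dec i : (i < r)%N -> (u i.+1 < u i)%N.
  move=> ir; have [ui le] := uP i ir; rewrite ltnNge; apply/negP => h.
  by move: le; rewrite (eqP h) muln0; lia.
have k0 : (0 < k)%N.
  by case: (posnP k) => // kz; have [] := uP 0%N (leq_ltn_trans (leq0n _) kr); rewrite kz; lia.
have half : (u k < 2 ^ j)%N.
  rewrite ltnNge; apply/negP => big.
  have : forall i, (i <= k)%N -> (2 ^ j <= u (k - i))%N.
    elim=> [|i IHi ik]; first by rewrite subn0.
    apply: leq_trans (IHi (ltnW ik)) _; have := dec (k - i.+1)%N.
    by rewrite -subSn // subSS => /(_ _)/ltnW; apply; lia.
  move=> bigs; have ge i : (i <= k)%N -> (i * 2 ^ j <= k * (u 0 - u i))%N.
    elim: i => [//|i IHi ik]; have := IHi (ltnW ik).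
    have [_] := uP i (ltn_trans ik kr); have := bigs (k - i)%N (leq_subr _ _).
    rewrite subKn ?(ltnW ik) // => h1 h2 h3.
    have h4 := dec i (ltn_trans ik kr).
    have h5 : (u i <= u 0)%N.
      elim: i ik {IHi h1 h2 h3 h4} => // i IHi ik.
      exact: leq_trans (ltnW (dec i (ltn_trans (ltnW ik) kr))) (IHi (ltnW ik)).
    have -> : (u 0 - u i.+1 = (u 0 - u i) + (u i - u i.+1))%N by lia.
    rewrite mulSn mulnDr; lia.
  have := ge k (leqnn k); rewrite leq_pmul2l //.
  move: u0; rewrite expnS; lia.
have := IH (r - k)%N (fun i => u (k + i)%N) _ _; rewrite addn0 => /(_ _ half) H.
have : (r - k <= k * j)%N by apply: H => i ir; rewrite /= addnS; apply: uP; lia.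
rewrite mulnS; lia.
Qed.

(** * A structured language for the machine *)

Inductive nexp : Type :=
| NV of nat | NC of nat | NP of nexp & nexp | NM of nexp & nexp | NT of nexp & nexp | NL of nexp.

Inductive rexp : Type :=
| RV of nat | RN of nexp | RP of rexp & rexp | RM of rexp & rexp | RT of rexp & rexp
| RD of rexp & rexp | RQ of rexp | RL of nexp.

Inductive cond : Type := CN of nexp & nexp | CR of rexp & rexp.

Inductive cmd : Type :=
| Skip
| NSet of nat & nexp
| NPut of nexp & nexp
| RSet of nat & rexp
| RPut of nexp & rexp
| Seq of cmd & cmd
| If of cond & cmd & cmd
| For of nat & nat & cmd
| Ask of nexp & nexp & nexp.

Section Semantics.
Variables (R : realType) (orc : nat -> nat -> seq R).

Record store := Store { nv : nat -> nat; nh : nat -> nat; rv : nat -> R; rh : nat -> R }.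

Fixpoint evn (s : store) (e : nexp) : nat :=
  match e with
  | NV v => nv s v
  | NC c => c
  | NP a b => evn s a + evn s b
  | NM a b => evn s a - evn s b
  | NT a b => evn s a * evn s b
  | NL a => nh s (evn s a)
  end%N.

Fixpoint evr (s : store) (e : rexp) : R :=
  match e with
  | RV v => rv s v
  | RN a => (evn s a)%:R
  | RP a b => evr s a + evr s b
  | RM a b => evr s a - evr s b
  | RT a b => evr s a * evr s b
  | RD a b => evr s a / evr s b
  | RQ a => Num.sqrt (evr s a)
  | RL a => rh s (evn s a)
  end.

Definition evc (s : store) (c : cond) : bool :=
  match c with CN a b => (evn s a < evn s b)%N | CR a b => evr s a < evr s b end.

Definition setv (s : store) v x := Store (updN (nv s) v x) (nh s) (rv s) (rh s).

Definition block (f : nat -> R) (a : nat) (q : seq R) (x : nat) : R :=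
  if (a <= x < a + size q)%N then nth 0 q (x - a) else f x.

(** The last assignment of [For] mirrors the compiled counter, which equals the bound when the loop
    is left. *)
Fixpoint den (c : cmd) (s : store) : store :=
  match c with
  | Skip => s
  | NSet v e => setv s v (evn s e)
  | NPut a e => Store (nv s) (updN (nh s) (evn s a) (evn s e)) (rv s) (rh s)
  | RSet v e => Store (nv s) (nh s) (updR (rv s) v (evr s e)) (rh s)
  | RPut a e => Store (nv s) (nh s) (rv s) (updR (rh s) (evn s a) (evr s e))
  | Seq a b => den b (den a s)
  | If c a b => if evc s c then den a s else den b s
  | For v b c =>
      setv (foldl (fun s i => den c (setv s v i)) s (iota 0 (nv s b))) v (nv s b)
  | Ask a b c => Store (nv s) (nh s) (rv s) (block (rh s) (evn s c) (orc (evn s a) (evn s b)))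
  end.

Fixpoint asg (c : cmd) : seq nat :=
  match c with
  | NSet v _ => [:: v]
  | Seq a b | If _ a b => asg a ++ asg b
  | For v _ c => v :: asg c
  | _ => [::]
  end.

Fixpoint rasg (c : cmd) : seq nat :=
  match c with
  | RSet v _ => [:: v]
  | Seq a b | If _ a b => rasg a ++ rasg b
  | For _ _ c => rasg c
  | _ => [::]
  end.

Fixpoint nput_free (c : cmd) : bool :=
  match c with
  | NPut _ _ => false
  | Seq a b | If _ a b => nput_free a && nput_free b
  | For _ _ c => nput_free c
  | _ => true
  end.

Fixpoint rput_free (c : cmd) : bool :=
  match c with
  | RPut _ _ | Ask _ _ _ => false
  | Seq a b | If _ a b => rput_free a && rput_free b
  | For _ _ c => rput_free c
  | _ => true
  end.

Lemma foldl_inv (T : Type) (I : T -> Prop) (f : T -> nat -> T) (s : T) (r : seq nat) :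
  I s -> (forall s i, I s -> I (f s i)) -> I (foldl f s r).
Proof. by move=> Is If; elim: r s Is => //= i r IH s Is; apply: IH; apply: If. Qed.

Lemma den_nv c s v : v \notin asg c -> nv (den c s) v = nv s v.
Proof.
elim: c s => //= [w e|a IHa b IHb|c a IHa b IHb|w b c IH] s.
- by rewrite inE /updN => /negbTE ->.
- by rewrite mem_cat negb_or => /andP[? ?]; rewrite IHb // IHa.
- by rewrite mem_cat negb_or => /andP[? ?]; case: ifP; rewrite ?IHa ?IHb.
- rewrite inE negb_or => /andP[/negbTE vw vc]; rewrite /updN vw.
  by apply: (foldl_inv (I := fun s' => nv s' v = nv s v)) => // s' i <-; rewrite IH //= /updN vw.
Qed.

Lemma den_rv c s v : v \notin rasg c -> rv (den c s) v = rv s v.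
Proof.
elim: c s => //= [w e|a IHa b IHb|c a IHa b IHb|w b c IH] s.
- by rewrite inE /updR => /negbTE ->.
- by rewrite mem_cat negb_or => /andP[? ?]; rewrite IHb // IHa.
- by rewrite mem_cat negb_or => /andP[? ?]; case: ifP; rewrite ?IHa ?IHb.
- move=> vc; apply: (foldl_inv (I := fun s' => rv s' v = rv s v)) => // s' i <-.
  by rewrite IH.
Qed.

Lemma den_nh c s : nput_free c -> nh (den c s) = nh s.
Proof.
elim: c s => //= [a IHa b IHb|c a IHa b IHb|w b c IH] s.
- by move=> /andP[? ?]; rewrite IHb // IHa.
- by move=> /andP[? ?]; case: ifP; rewrite ?IHa ?IHb.
- move=> vc; apply: (foldl_inv (I := fun s' => nh s' = nh s)) => // s' i <-.
  by rewrite IH.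
Qed.

Lemma den_rh c s : rput_free c -> rh (den c s) = rh s.
Proof.
elim: c s => //= [a IHa b IHb|c a IHa b IHb|w b c IH] s.
- by move=> /andP[? ?]; rewrite IHb // IHa.
- by move=> /andP[? ?]; case: ifP; rewrite ?IHa ?IHb.
- move=> vc; apply: (foldl_inv (I := fun s' => rh s' = rh s)) => // s' i <-.
  by rewrite IH.
Qed.

Lemma den_for (I : nat -> store -> Prop) v b c s :
  I 0%N s -> (forall i s', (i < nv s b)%N -> I i s' -> I i.+1 (den c (setv s' v i))) ->
  (forall s', I (nv s b) s' -> I (nv s b) (setv s' v (nv s b))) ->
  I (nv s b) (den (For v b c) s).
Proof.
move=> I0 IS Iset /=; apply: Iset; move: (nv s b) IS => n.
have -> : foldl (fun s i => den c (setv s v i)) s (iota 0 n) =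
          iteri n (fun i s => den c (setv s v i)) s.
  by elim: n => // n IHn'; rewrite -[in LHS]addn1 iotaD foldl_cat IHn'.
elim: n => //= n IHn IS; apply: (IS) => //.
by apply: IHn => i s' /ltnW; exact: IS.
Qed.

End Semantics.

(** * Compilation to machine code *)

Section Compilation.

(* Integer cells 0-37 hold the integer variables, cell 38 the constant 0, cell 39 the
   constant 1, cells 40-63 temporaries and 64+x the integer heap cell x; real cells 0-15
   hold the real variables, cells 16-31 temporaries and 32+x the real heap cell x. *)
Fixpoint cn (e : nexp) (k : nat) : seq instr :=
  match e with
  | NV v => [:: NAdd k v 38]
  | NC c => [:: NConst k c]
  | NP a b => cn a k ++ cn b k.+1 ++ [:: NAdd k k k.+1]
  | NM a b => cn a k ++ cn b k.+1 ++ [:: NSub k k k.+1]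
  | NT a b => cn a k ++ cn b k.+1 ++ [:: NMul k k k.+1]
  | NL a => cn a k ++ [:: NConst k.+1 64; NAdd k k k.+1; NLoad k k]
  end.

(** There is no move instruction: copies are additions of zero, and a real zero is obtained from
    integer cell 38. *)
Fixpoint cr (e : rexp) (k : nat) : seq instr :=
  match e with
  | RV v => [:: RofN k 38; RAdd k k v]
  | RN a => cn a 40 ++ [:: RofN k 40]
  | RP a b => cr a k ++ cr b k.+1 ++ [:: RAdd k k k.+1]
  | RM a b => cr a k ++ cr b k.+1 ++ [:: RSub k k k.+1]
  | RT a b => cr a k ++ cr b k.+1 ++ [:: RMul k k k.+1]
  | RD a b => cr a k ++ cr b k.+1 ++ [:: RDiv k k k.+1]
  | RQ a => cr a k ++ [:: RSqrt k k]
  | RL a => cn a 40 ++ [:: NConst 41 32; NAdd 40 40 41; RLoad k 40]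
  end.

Definition cc (c : cond) : seq instr :=
  match c with CN a b => cn a 40 ++ cn b 41 | CR a b => cr a 16 ++ cr b 17 end.
Definition jc (c : cond) (l : nat) : instr :=
  match c with CN _ _ => JmpNLt 40 41 l | CR _ _ => JmpRLt 16 17 l end.

Definition cput (a e : nexp) :=
  cn a 40 ++ [:: NConst 41 64; NAdd 40 40 41] ++ cn e 41 ++ [:: NStore 40 41].
Definition crput (a : nexp) (e : rexp) :=
  cr e 16 ++ cn a 40 ++ [:: NConst 41 32; NAdd 40 40 41; RStore 40 16].
Definition cask (a b c : nexp) :=
  cn a 40 ++ cn b 41 ++ cn c 42 ++ [:: NConst 43 32; NAdd 42 42 43].

(** Jump targets are absolute, hence the start address [p]. [JmpNLt 38 39] compares 0 with 1 and is
    an unconditional jump. The loop test follows the body and is entered by a jump, so that a bound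
    of 0 runs no iteration. *)
Fixpoint comp (c : cmd) (p : nat) : seq instr :=
  match c with
  | Skip => [::]
  | NSet v e => cn e 40 ++ [:: NAdd v 40 38]
  | NPut a e => cput a e
  | RSet v e => cr e 16 ++ [:: RofN 17 38; RAdd v 16 17]
  | RPut a e => crput a e
  | Seq a b => let ca := comp a p in ca ++ comp b (p + size ca)
  | If c a b =>
      let p1 := (p + size (cc c)).+1 in
      let cb := comp b p1 in
      let p2 := (p1 + size cb).+1 in
      let ca := comp a p2 in
      cc c ++ [:: jc c p2] ++ cb ++ [:: JmpNLt 38 39 (p2 + size ca)] ++ ca
  | For v b c =>
      let cb := comp c p.+2 in
      [:: NConst v 0; JmpNLt 38 39 (p.+2 + size cb).+1] ++ cb ++
      [:: NAdd v v 39; JmpNLt v b p.+2]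
  | Ask a b c => cask a b c ++ [:: Oracle 40 41 42]
  end.

(** Temporaries form a stack growing from [k]; the test bounds its depth, so that a fixed block of
    cells suffices. *)
Fixpoint wfn (e : nexp) (k : nat) : bool :=
  match e with
  | NV v => (v < 38) && (k < 64)
  | NC _ => k < 64
  | NP a b | NM a b | NT a b => wfn a k && wfn b k.+1
  | NL a => wfn a k && (k.+1 < 64)
  end%N.

Fixpoint wfr (e : rexp) (k : nat) : bool :=
  match e with
  | RV v => (v < 16) && (k < 32)
  | RN a => wfn a 40 && (k < 32)
  | RP a b | RM a b | RT a b | RD a b => wfr a k && wfr b k.+1
  | RQ a => wfr a k
  | RL a => wfn a 40 && (k < 32)
  end%N.

Definition wfc (c : cond) : bool :=
  match c with CN a b => wfn a 40 && wfn b 41 | CR a b => wfr a 16 && wfr b 17 end.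

Fixpoint bounds (c : cmd) : seq nat :=
  match c with
  | Seq a b | If _ a b => bounds a ++ bounds b
  | For _ b c => b :: bounds c
  | _ => [::]
  end.

(* Loop bounds are constant throughout, which makes the running time static. *)
Fixpoint wf (c : cmd) : bool :=
  match c with
  | Skip => true
  | NSet v e => (v < 38)%N && wfn e 40
  | NPut a e => wfn a 40 && wfn e 41
  | RSet v e => (v < 16)%N && wfr e 16
  | RPut a e => wfn a 40 && wfr e 16
  | Seq a b => [&& wf a, wf b & all (fun x => x \notin asg a) (bounds b)]
  | If c a b => [&& wfc c, wf a & wf b]
  | For v b c => [&& (v < 38)%N, (b < 38)%N, v \notin asg c, b != v, wf c &
       all (fun x => x \notin v :: asg c) (b :: bounds c)]
  | Ask a b c => [&& wfn a 40, wfn b 41 & wfn c 42]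
  end.

(** [be] supplies the values of the loop bounds. The else branch pays for the jump over the then
    branch; a loop pays 3 for initialisation, entry jump and failing test, and 2 per iteration for
    increment and test. *)
Fixpoint time (TS : nat) (c : cmd) (be : nat -> nat) : nat :=
  match c with
  | Seq a b => time TS a be + time TS b be
  | If c a b => size (cc c) + 1 + maxn (time TS a be) (time TS b be + 1)
  | For v b c => 3 + be b * (time TS c be + 2)
  | Ask a b c => size (cask a b c) + TS
  | _ => size (comp c 0)
  end%N.

End Compilation.

(** * Simulation of commands by the compiled code *)

Section Correctness.
Variables (R : realType) (prog : seq instr) (orc : nat -> nat -> seq R) (TS : nat).
Implicit Types (s : state R) (sg : store R).

(** Stated as an equation between executions with arbitrary remaining fuel, the relation composes
    without knowing whether or when the machine halts. *)
Definition steps s s' (k : nat) := exists f0, forall f,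
  exec prog orc TS (f0 + f)%N s = omap (fun p => (p.1, (k + p.2)%N)) (exec prog orc TS f s').

Lemma steps_refl s : steps s s 0.
Proof.
by exists 0%N => f; rewrite add0n; case: exec => //= -[? ?].
Qed.

Lemma steps_trans s1 s2 s3 k1 k2 : steps s1 s2 k1 -> steps s2 s3 k2 -> steps s1 s3 (k1 + k2).
Proof.
move=> [f1 H1] [f2 H2]; exists (f1 + f2)%N => f; rewrite -addnA H1 H2.
by case: exec => //= -[? ?] /=; rewrite addnA.
Qed.

Definition is_halt i := if i is Halt then true else false.

Lemma steps1 s i : nth Halt prog (pc s) = i -> ~~ is_halt i ->
  steps s (step orc TS i s).1 (step orc TS i s).2.
Proof. by move=> pi ih; exists 1%N => f; rewrite add1n /= pi; case: i ih pi. Qed.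

Definition code_at p (code : seq instr) :=
  forall i, (i < size code)%N -> nth Halt prog (p + i) = nth Halt code i.

Lemma code_at_cat p c1 c2 : code_at p (c1 ++ c2) -> code_at p c1 /\ code_at (p + size c1) c2.
Proof.
move=> H; split=> i hi.
  by rewrite H ?size_cat ?ltn_addr // nth_cat hi.
rewrite -addnA H ?size_cat ?ltn_add2l // nth_cat ltnNge leq_addr /= addKn //.
Qed.

Lemma code_at1 p i : code_at p [:: i] -> nth Halt prog p = i.
Proof. by move=> /(_ 0%N isT); rewrite addn0. Qed.

Lemma code_at_cons p i c : code_at p (i :: c) -> nth Halt prog p = i /\ code_at p.+1 c.
Proof. by rewrite -cat1s => /code_at_cat[/code_at1 ? ]; rewrite addn1. Qed.

Definition simple i := match i with
  | Halt | JmpNLt _ _ _ | JmpRLt _ _ _ | Oracle _ _ _ => false | _ => true end.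

Definition run (code : seq instr) s := foldl (fun s i => (step orc TS i s).1) s code.

Lemma run_cat c1 c2 s : run (c1 ++ c2) s = run c2 (run c1 s).
Proof. exact: foldl_cat. Qed.

Lemma steps_run code s p : all simple code -> pc s = p -> code_at p code ->
  steps s (run code s) (size code) /\ pc (run code s) = (p + size code)%N.
Proof.
elim: code s p => [|i code IH] s p; first by rewrite addn0; split=> //; exact: steps_refl.
move=> /= /andP[si sc] ps.
rewrite -cat1s => /code_at_cat[/code_at1 ip cp].
have pc1 : pc (step orc TS i s).1 = (p + size [:: i])%N.
  by rewrite /= addn1 -ps; case: i si {ip cp}.
have [st pcr] := IH _ _ sc pc1 cp; split; last by rewrite pcr /= addn1 addSnnS.
have i1 : (step orc TS i s).2 = 1%N /\ ~~ is_halt i by case: i si {ip cp pc1 st pcr}.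
by rewrite -add1n -i1.1; apply: steps_trans (steps1 _ i1.2) st; rewrite ps.
Qed.

Lemma simple_cn e k : all simple (cn e k).
Proof. by elim: e k => //= [a Ha b Hb|a Ha b Hb|a Ha b Hb|a Ha] k; rewrite !all_cat ?Ha ?Hb. Qed.

Lemma simple_cr e k : all simple (cr e k).
Proof.
by elim: e k => //= [a|a Ha b Hb|a Ha b Hb|a Ha b Hb|a Ha b Hb|a Ha|a] k;
  rewrite !all_cat ?Ha ?Hb ?simple_cn.
Qed.

Definition sim sg s :=
  [/\ forall v, (v < 38)%N -> nmem s v = nv sg v,
      nmem s 38 = 0%N /\ nmem s 39 = 1%N,
      forall x, nmem s (64 + x)%N = nh sg x,
      forall v, (v < 16)%N -> rmem s v = rv sg v &
      forall x, rmem s (32 + x)%N = rh sg x].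

Definition tmp_eq k l s s' :=
  (forall x, ~~ (k <= x < 64)%N -> nmem s' x = nmem s x) /\
  (forall x, ~~ (l <= x < 32)%N -> rmem s' x = rmem s x).

Lemma tmp_eq_trans k l s1 s2 s3 : tmp_eq k l s1 s2 -> tmp_eq k l s2 s3 -> tmp_eq k l s1 s3.
Proof. by move=> [a b] [c d]; split=> x hx; rewrite ?c ?d ?a ?b. Qed.

Lemma tmp_eq_weak k l k' l' s s' : (k' <= k)%N -> (l' <= l)%N ->
  tmp_eq k l s s' -> tmp_eq k' l' s s'.
Proof. by move=> kk ll [a b]; split=> x hx; [apply: a|apply: b]; lia. Qed.

Lemma tmp_eq_sim k l sg s s' : (40 <= k)%N -> (16 <= l)%N -> tmp_eq k l s s' -> sim sg s -> sim sg s'.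
Proof.
move=> k40 l16 [a b] [h1 [h2 h2'] h3 h4 h5].
split=> [v hv||x|v hv|x].
- by rewrite a ?h1 //; lia.
- by rewrite !a ?h2 ?h2' //; lia.
- by rewrite a ?h3 //; lia.
- by rewrite b ?h4 //; lia.
- by rewrite b ?h5 //; lia.
Qed.

Lemma wfn_lt e k : wfn e k -> (k < 64)%N.
Proof.
by elim: e k => [v|c|a Ha b _|a Ha b _|a Ha b _|a Ha] k //= /andP[]//; auto.
Qed.

Lemma wfr_lt e k : wfr e k -> (k < 32)%N.
Proof.
by elim: e k => [v|a|a Ha b _|a Ha b _|a Ha b _|a Ha b _|a Ha|a] k //= => [/andP[]|/andP[]|
  /andP[/Ha]|/andP[/Ha]|/andP[/Ha]|/andP[/Ha]|/Ha|/andP[]].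
Qed.

(** The left operand waits in cell k while the right one uses only cells from k + 1 on. *)
Lemma cn_ok e k sg s : (40 <= k)%N -> wfn e k -> sim sg s ->
  tmp_eq k 32 s (run (cn e k) s) /\ nmem (run (cn e k) s) k = evn sg e.
Proof.
elim: e k s => [v|c|a Ha b Hb|a Ha b Hb|a Ha b Hb|a Ha] k s k40 /=.
- move=> /andP[v38 k64] [h1 [h2 _] _ _ _]; rewrite /updN eqxx h1 // h2 addn0; split=> //.
  by split=> x //= hx; rewrite /updN ifF //; lia.
- by move=> k64 _; rewrite /updN eqxx; split=> //; split=> x //= hx; rewrite /updN ifF //; lia.
- move=> /andP[wa wb] S0; rewrite !run_cat.
  have [ea va] := Ha k s k40 wa S0; set s1 := run _ s in ea va *.
  have S1 := tmp_eq_sim k40 (isT : (16 <= 32)%N) ea S0.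
  have [eb vb] := Hb k.+1 s1 (leqW k40) wb S1; set s2 := run _ s1 in eb vb *.
  have k64 := wfn_lt wb.
  rewrite /= /updN eqxx vb (eb.1 k) ?va; last by lia.
  split=> //; apply: tmp_eq_trans ea _; apply: tmp_eq_trans (tmp_eq_weak _ _ eb) _ => //.
  by split=> x //= hx; rewrite /updN ifF //; lia.
- move=> /andP[wa wb] S0; rewrite !run_cat.
  have [ea va] := Ha k s k40 wa S0; set s1 := run _ s in ea va *.
  have S1 := tmp_eq_sim k40 (isT : (16 <= 32)%N) ea S0.
  have [eb vb] := Hb k.+1 s1 (leqW k40) wb S1; set s2 := run _ s1 in eb vb *.
  have k64 := wfn_lt wb.
  rewrite /= /updN eqxx vb (eb.1 k) ?va; last by lia.
  split=> //; apply: tmp_eq_trans ea _; apply: tmp_eq_trans (tmp_eq_weak _ _ eb) _ => //.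
  by split=> x //= hx; rewrite /updN ifF //; lia.
- move=> /andP[wa wb] S0; rewrite !run_cat.
  have [ea va] := Ha k s k40 wa S0; set s1 := run _ s in ea va *.
  have S1 := tmp_eq_sim k40 (isT : (16 <= 32)%N) ea S0.
  have [eb vb] := Hb k.+1 s1 (leqW k40) wb S1; set s2 := run _ s1 in eb vb *.
  have k64 := wfn_lt wb.
  rewrite /= /updN eqxx vb (eb.1 k) ?va; last by lia.
  split=> //; apply: tmp_eq_trans ea _; apply: tmp_eq_trans (tmp_eq_weak _ _ eb) _ => //.
  by split=> x //= hx; rewrite /updN ifF //; lia.
- move=> /andP[wa k64] S0; rewrite !run_cat.
  have [ea va] := Ha k s k40 wa S0; set s1 := run _ s in ea va *.
  have [_ _ h3 _ _] := tmp_eq_sim k40 (isT : (16 <= 32)%N) ea S0.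
  rewrite /= /updN !eqxx (ltn_eqF (ltnSn k)) va addnC.
  have -> : (64 + evn sg a == k)%N = false by lia.
  have -> : (64 + evn sg a == k.+1)%N = false by lia.
  rewrite h3; split=> //; apply: tmp_eq_trans ea _.
  by split=> x //= hx; rewrite /updN !ifF //; lia.
Qed.

Lemma cr_ok e k sg s : (16 <= k)%N -> wfr e k -> sim sg s ->
  tmp_eq 40 k s (run (cr e k) s) /\ rmem (run (cr e k) s) k = evr sg e.
Proof.
have bin a b k0 s0 (op : instr) (f : R -> R -> R) :
  (forall k s, (16 <= k)%N -> wfr a k -> sim sg s ->
    tmp_eq 40 k s (run (cr a k) s) /\ rmem (run (cr a k) s) k = evr sg a) ->
  (forall k s, (16 <= k)%N -> wfr b k -> sim sg s ->
    tmp_eq 40 k s (run (cr b k) s) /\ rmem (run (cr b k) s) k = evr sg b) ->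
  (forall s, nmem (step orc TS op s).1 = nmem s /\
     rmem (step orc TS op s).1 = updR (rmem s) k0 (f (rmem s k0) (rmem s k0.+1))) ->
  (16 <= k0)%N -> wfr a k0 && wfr b k0.+1 -> sim sg s0 ->
  tmp_eq 40 k0 s0 (run (cr a k0 ++ cr b k0.+1 ++ [:: op]) s0) /\
  rmem (run (cr a k0 ++ cr b k0.+1 ++ [:: op]) s0) k0 = f (evr sg a) (evr sg b).
- move=> Ha Hb Hop k16 /andP[wa wb] S0; rewrite !run_cat.
  have [ea va] := Ha k0 s0 k16 wa S0; set s1 := run _ s0 in ea va *.
  have S1 := tmp_eq_sim (isT : (40 <= 40)%N) k16 ea S0.
  have [eb vb] := Hb k0.+1 s1 (leqW k16) wb S1; set s2 := run _ s1 in eb vb *.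
  have k32 := wfr_lt wa.
  have [Hn Hr] := Hop s2; rewrite /= Hr /updR eqxx vb (eb.2 k0) ?va; last by lia.
  split=> //; apply: tmp_eq_trans ea _; apply: tmp_eq_trans (tmp_eq_weak _ _ eb) _ => //.
  by split=> x hx; rewrite ?Hn ?Hr // /updR ifF //; lia.
elim: e k s => [v|a|a Ha b Hb|a Ha b Hb|a Ha b Hb|a Ha b Hb|a Ha|a] k s k16 /=.
- move=> /andP[v16 k32] [_ [h2 _] _ h4 _]; rewrite /updR eqxx h2.
  rewrite (_ : (v == k) = false); last by lia.
  rewrite add0r h4 //; split=> //.
  by split=> x //= hx; rewrite /updR !ifF //; lia.
- move=> /andP[wa k32] S0; rewrite !run_cat.
  have [ea va] := cn_ok (leqnn 40) wa S0; set s1 := run _ s in ea va *.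
  rewrite /= /updR eqxx va; split=> //.
  apply: tmp_eq_trans (tmp_eq_weak (leqnn _) (ltnW k32) ea) _.
  by split=> x //= hx; rewrite /updR ifF //; lia.
- by apply: bin.
- exact: (bin a b k s _ (fun x y => x - y)).
- exact: (bin a b k s _ (fun x y => x * y)).
- exact: (bin a b k s _ (fun x y => x / y)).
- move=> wa S0; rewrite !run_cat.
  have [ea va] := Ha k s k16 wa S0; set s1 := run _ s in ea va *.
  have k32 := wfr_lt wa.
  rewrite /= /updR eqxx va; split=> //; apply: tmp_eq_trans ea _.
  by split=> x //= hx; rewrite /updR ifF //; lia.
- move=> /andP[wa k32] S0; rewrite !run_cat.
  have [ea va] := cn_ok (leqnn 40) wa S0; set s1 := run _ s in ea va *.
  have [_ _ _ _ h5] := tmp_eq_sim (leqnn 40) (isT : (16 <= 32)%N) ea S0.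
  rewrite /= /updR /updN /= eqxx va addnC h5; split=> //.
  apply: tmp_eq_trans (tmp_eq_weak (leqnn _) (ltnW k32) ea) _.
  by split=> x //= hx; rewrite /updR /updN !ifF //; lia.
Qed.
Lemma code_at_steps code s p : all simple code -> pc s = p -> code_at p code ->
  exists2 s', steps s s' (size code) & s' = run code s /\ pc s' = (p + size code)%N.
Proof. by move=> sc ps cp; have [? ?] := steps_run sc ps cp; exists (run code s). Qed.

Lemma sim_pc sg s s' : nmem s' = nmem s -> rmem s' = rmem s -> sim sg s -> sim sg s'.
Proof. by move=> hn hr [h1 h2 h3 h4 h5]; split; rewrite ?hn ?hr. Qed.

Lemma step_jump p l s : nth Halt prog p = JmpNLt 38 39 l -> pc s = p ->
  nmem s 38 = 0%N /\ nmem s 39 = 1%N -> steps s (mkState l (nmem s) (rmem s)) 1.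
Proof.
by move=> hp ps [z o]; have := steps1 (s := s) (i := JmpNLt 38 39 l);
  rewrite /= z o; apply; rewrite ?ps.
Qed.

Lemma sim_setv sg s v x : (v < 38)%N -> sim sg s ->
  sim (setv sg v x) (mkState (pc s) (updN (nmem s) v x) (rmem s)).
Proof.
move=> v38 [h1 [h2 h2'] h3 h4 h5]; split=> // [w hw||y];
  rewrite ?[nmem (mkState _ _ _)]/= ?[nv (setv _ _ _)]/= /updN.
- by case: eqP => // _; exact: h1.
- by rewrite !ifF ?h2 ?h2' //; lia.
- by rewrite ifF ?h3 //; lia.
Qed.

Lemma cput_ok a e sg s : wfn a 40 -> wfn e 41 -> sim sg s ->
  sim (den orc (NPut a e) sg) (run (cput a e) s).
Proof.
move=> wa we S0; rewrite /cput !run_cat.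
have [ea va] := cn_ok (leqnn 40) wa S0; set s1 := run _ s in ea va *.
set s2 := run [:: NConst 41 64; NAdd 40 40 41] s1.
have e2 : tmp_eq 40 32 s1 s2 by split=> x //= hx; rewrite /updN !ifF //; lia.
have v2 : nmem s2 40 = (64 + evn sg a)%N by rewrite /s2 /= /updN /= va addnC.
have S2 := tmp_eq_sim (leqnn 40) (isT : (16 <= 32)%N) (tmp_eq_trans ea e2) S0.
have [eb vb] := cn_ok (isT : (40 <= 41)%N) we S2; set s3 := run _ s2 in eb vb *.
have S3 := tmp_eq_sim (isT : (40 <= 41)%N) (isT : (16 <= 32)%N) eb S2.
have v3 : nmem s3 40 = (64 + evn sg a)%N by rewrite eb.1.
case: S3 => h1 [h2 h2'] h3 h4 h5; split=> // [v hv||x];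
  rewrite [nmem (foldl _ _ _)]/= ?[nh (den _ _ _)]/= /updN v3.
- by rewrite ifF ?h1 //; lia.
- have -> : (38 == 64 + evn sg a)%N = false by lia.
  have -> : (39 == 64 + evn sg a)%N = false by lia.
  by rewrite h2 h2'.
- by rewrite eqn_add2l vb h3.
Qed.

Lemma crput_ok a e sg s : wfn a 40 -> wfr e 16 -> sim sg s ->
  sim (den orc (RPut a e) sg) (run (crput a e) s).
Proof.
move=> wa we S0; rewrite /crput !run_cat.
have [ea va] := cr_ok (leqnn 16) we S0; set s1 := run _ s in ea va *.
have S1 := tmp_eq_sim (leqnn 40) (leqnn 16) ea S0.
have [eb vb] := cn_ok (leqnn 40) wa S1; set s2 := run _ s1 in eb vb *.
have v2 : rmem s2 16 = evr sg e by rewrite eb.2.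
have [h1 [h2 h2'] h3 h4 h5] := tmp_eq_sim (leqnn 40) (isT : (16 <= 32)%N) eb S1.
split=> //= [v hv|v hv|x]; rewrite /updN /updR /=.
- by rewrite !ifF ?h1 //; lia.
- by rewrite vb ifF ?h4 //; lia.
- by rewrite vb [(evn sg a + 32)%N]addnC eqn_add2l v2 h5.
Qed.

Lemma rset_ok v e sg s : (v < 16)%N -> wfr e 16 -> sim sg s ->
  sim (den orc (RSet v e) sg) (run (cr e 16 ++ [:: RofN 17 38; RAdd v 16 17]) s).
Proof.
move=> v16 we S0; rewrite !run_cat.
have [ea va] := cr_ok (leqnn 16) we S0; set s1 := run _ s in ea va *.
have [h1 [h2 h2'] h3 h4 h5] := tmp_eq_sim (leqnn 40) (leqnn 16) ea S0.
split=> //= [w hw|x]; rewrite /updR.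
- by case: eqP => _; [rewrite /= va h2 addr0|rewrite ifF ?h4 //; lia].
- by rewrite !ifF ?h5 //; lia.
Qed.

Lemma nset_ok v e sg s : (v < 38)%N -> wfn e 40 -> sim sg s ->
  sim (den orc (NSet v e) sg) (run (cn e 40 ++ [:: NAdd v 40 38]) s).
Proof.
move=> v38 we S0; rewrite !run_cat.
have [ea va] := cn_ok (leqnn 40) we S0; set s1 := run _ s in ea va *.
have S1 := tmp_eq_sim (leqnn 40) (isT : (16 <= 32)%N) ea S0.
have z : nmem s1 38 = 0%N by case: S1 => _ [].
by apply: sim_pc (sim_setv (evn sg e) v38 S1) => //=; rewrite z addn0 va.
Qed.

Lemma cask_ok a b c sg s : wfn a 40 -> wfn b 41 -> wfn c 42 -> sim sg s ->
  [/\ sim sg (run (cask a b c) s), nmem (run (cask a b c) s) 40 = evn sg a,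
      nmem (run (cask a b c) s) 41 = evn sg b &
      nmem (run (cask a b c) s) 42 = (32 + evn sg c)%N].
Proof.
move=> wa wb wc S0; rewrite /cask !run_cat.
have [ea va] := cn_ok (leqnn 40) wa S0; set s1 := run _ s in ea va *.
have S1 := tmp_eq_sim (leqnn 40) (isT : (16 <= 32)%N) ea S0.
have [eb vb] := cn_ok (isT : (40 <= 41)%N) wb S1; set s2 := run _ s1 in eb vb *.
have S2 := tmp_eq_sim (isT : (40 <= 41)%N) (isT : (16 <= 32)%N) eb S1.
have [ec vc] := cn_ok (isT : (40 <= 42)%N) wc S2; set s3 := run _ s2 in ec vc *.
have S3 := tmp_eq_sim (isT : (40 <= 42)%N) (isT : (16 <= 32)%N) ec S2.
have e4 : tmp_eq 42 32 s3 (run [:: NConst 43 32; NAdd 42 42 43] s3).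
  by split=> x //= hx; rewrite /updN !ifF //; lia.
split.
- exact: tmp_eq_sim (isT : (40 <= 42)%N) (isT : (16 <= 32)%N) e4 S3.
- by rewrite e4.1 // ec.1 // eb.1.
- by rewrite e4.1 // ec.1.
- by rewrite /= /updN /= vc addnC.
Qed.

Lemma cc_ok c sg s : wfc c -> sim sg s -> sim sg (run (cc c) s) /\
  (forall l, (step orc TS (jc c l) (run (cc c) s)).1 =
     mkState (if evc sg c then l else (pc (run (cc c) s)).+1)
       (nmem (run (cc c) s)) (rmem (run (cc c) s))).
Proof.
case: c => a b /= /andP[wa wb] S0; rewrite !run_cat.
- have [ea va] := cn_ok (leqnn 40) wa S0; set s1 := run _ s in ea va *.
  have S1 := tmp_eq_sim (leqnn 40) (isT : (16 <= 32)%N) ea S0.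
  have [eb vb] := cn_ok (isT : (40 <= 41)%N) wb S1; set s2 := run _ s1 in eb vb *.
  split; first exact: tmp_eq_sim (isT : (40 <= 41)%N) (isT : (16 <= 32)%N) eb S1.
  by move=> l; rewrite vb eb.1 // va.
- have [ea va] := cr_ok (leqnn 16) wa S0; set s1 := run _ s in ea va *.
  have S1 := tmp_eq_sim (leqnn 40) (leqnn 16) ea S0.
  have [eb vb] := cr_ok (isT : (16 <= 17)%N) wb S1; set s2 := run _ s1 in eb vb *.
  split; first exact: tmp_eq_sim (leqnn 40) (isT : (16 <= 17)%N) eb S1.
  by move=> l; rewrite vb eb.2 // va.
Qed.

Lemma simple_cc c : all simple (cc c).
Proof. by case: c => a b; rewrite all_cat ?simple_cn ?simple_cr. Qed.

(** [be] has to agree with the store only at the start: [wf] forbids assignments to a bound before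
    or during its loop, so agreement persists. *)
Lemma comp_ok c : wf c -> forall p s sg be, code_at p (comp c p) -> pc s = p -> sim sg s ->
  (forall b, b \in bounds c -> be b = nv sg b) ->
  exists s' k, [/\ steps s s' k, pc s' = (p + size (comp c p))%N,
    sim (den orc c sg) s' & (k <= time TS c be)%N].
Proof.
elim: c => [|v e|a e|v e|a e|a IHa b IHb|c a IHa b IHb|v b c IH|a b c] /= W p s sg be cp ps S0 B.
- by exists s, 0%N; split=> //; [exact: steps_refl|rewrite addn0].
- case/andP: W => W1 W2; have [|s' st [sE pE]] := code_at_steps _ ps cp.
    by rewrite all_cat simple_cn.
  by exists s', (size (cn e 40 ++ [:: NAdd v 40 38])); split=> //; rewrite sE; exact: nset_ok.
- case/andP: W => W1 W2; have [|s' st [sE pE]] := code_at_steps _ ps cp.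
    by rewrite /cput !all_cat !simple_cn.
  by exists s', (size (cput a e)); split=> //; rewrite sE; exact: cput_ok.
- case/andP: W => W1 W2; have [|s' st [sE pE]] := code_at_steps _ ps cp.
    by rewrite all_cat simple_cr.
  by exists s', (size (cr e 16 ++ [:: RofN 17 38; RAdd v 16 17])); split=> //; rewrite sE; exact: rset_ok.
- case/andP: W => W1 W2; have [|s' st [sE pE]] := code_at_steps _ ps cp.
    by rewrite /crput !all_cat simple_cr simple_cn.
  by exists s', (size (crput a e)); split=> //; rewrite sE; exact: crput_ok.
- case/and3P: W => Wa Wb Wab; have [ca cb] := code_at_cat cp.
  have [|s1 [k1 [st1 pc1 S1 K1]]] := IHa Wa _ _ _ be ca ps S0.
    by move=> x xb; apply: B; rewrite mem_cat xb.
  have [|s2 [k2 [st2 pc2 S2 K2]]] := IHb Wb _ _ _ be cb pc1 S1.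
    move=> x xb; rewrite den_nv ?B ?mem_cat ?xb ?orbT //.
    by move/allP: Wab; apply.
  exists s2, (k1 + k2)%N; split=> //; first exact: steps_trans st1 st2.
    by rewrite pc2 size_cat addnA.
  exact: leq_add.
- case/and3P: W => Wc Wa Wb; have [c1 cp1] := code_at_cat cp.
  move: cp1; set p1 := (p + size (cc c)).+1; set p2 := (p1 + size (comp b p1)).+1.
  move=> /code_at_cons[cj /code_at_cat[cb /code_at_cons[ce ca]]]; rewrite -/p1 -/p2 in cb ce ca.
  have [st1 pc1] := steps_run (simple_cc c) ps c1.
  have [S1 J1] := cc_ok Wc S0; set s1 := run (cc c) s in st1 pc1 S1 J1.
  have st2 : steps s1 (mkState (if evc sg c then p2 else p1) (nmem s1) (rmem s1)) 1.
    have := @steps1 s1 (jc c p2); rewrite pc1 J1 pc1 -/p1 => H.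
    have -> : 1%N = (step orc TS (jc c p2) s1).2 by case: (c).
    by apply: H => //; case: (c).
  move: st2; case: ifP => hc st2.
    have [||s3 [k3 [st3 pc3 S3 K3]]] := IHa Wa p2 (mkState p2 (nmem s1) (rmem s1)) sg be ca erefl.
    - exact: sim_pc S1.
    - by move=> x xb; apply: B; rewrite mem_cat xb.
    exists s3, (size (cc c) + (1 + k3))%N; split=> //.
    + by apply: steps_trans st1 _; apply: steps_trans st2 st3.
    + by rewrite pc3 !size_cat /= !size_cat /= /p2 /p1; lia.
    + by rewrite addnA leq_add2l leq_max K3.
  have [||s3 [k3 [st3 pc3 S3 K3]]] := IHb Wb p1 (mkState p1 (nmem s1) (rmem s1)) sg be cb erefl.
  - exact: sim_pc S1.
  - by move=> x xb; apply: B; rewrite mem_cat xb orbT.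
  have st4 := step_jump ce pc3 (let: And5 _ h _ _ _ := S3 in h).
  eexists _, (size (cc c) + (1 + (k3 + 1)))%N; split.
  + by apply: steps_trans st1 _; apply: steps_trans st2 _; apply: steps_trans st3 st4.
  + by rewrite /= !size_cat /= !size_cat /= /p2 /p1; lia.
  + exact: sim_pc S3.
  + by rewrite addnA leq_add2l leq_max leq_add2r K3 orbT.
- case/and5P: W => v38 b38 vc /eqP bv /andP[Wc /andP[]].
  rewrite inE negb_or => /andP[_ bc] /allP Wb.
  move: cp; set L := size (comp c p.+2).
  move=> /code_at_cons[c0 /code_at_cons[c1 /code_at_cat[cb /code_at_cons[c2 /code_at_cons[c3 _]]]]].
  set n := nv sg b; have nE : be b = n by apply: B; rewrite mem_head.
  rewrite -/L in c2 c3.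
  pose sgi i := foldl (fun (r : store R) i => den orc c (setv r v i)) sg (iota 0 i).
  have sgiS i : sgi i.+1 = den orc c (setv (sgi i) v i).
    by rewrite /sgi -{1}addn1 iotaD foldl_cat.
  have sgi_nv i x : x != v -> x \notin asg c -> nv (sgi i) x = nv sg x.
    move=> xv xc; elim: i => // i IHi; rewrite sgiS den_nv //= /updN (negbTE xv); exact: IHi.
  (* The invariant is placed at the loop test, whose address this is. *)
  have loop i : (i <= n)%N -> exists s' k, [/\ steps s s' k, pc s' = (p.+2 + L).+1,
      sim (setv (sgi i) v i) s' & (k <= 2 + i * (time TS c be + 2))%N].
    elim: i => [_|i IHi iN].
      have st1 := steps1 (s := s); rewrite ps c0 in st1.
      have {st1} st1 := st1 _ erefl isT; rewrite /= ps in st1.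
      have S1 := sim_setv 0 v38 S0.
      set s1 := mkState _ _ _ in st1.
      have S1' : sim (setv sg v 0) s1 by apply: sim_pc S1.
      have st2 := step_jump (s := s1) c1 erefl (let: And5 _ h _ _ _ := S1' in h).
      eexists _, _; split; first exact: steps_trans st1 st2.
      - by [].
      - exact: sim_pc S1'.
      - by [].
    have [s1 [k1 [st1 pc1 S1 K1]]] := IHi (ltnW iN).
    have hv : nmem s1 v = i by case: S1 => h _ _ _ _; rewrite h //= /updN eqxx.
    have hb : nmem s1 b = n.
      case: S1 => h _ _ _ _; rewrite h //= /updN ifF; last exact/eqP.
      by rewrite sgi_nv //; exact/eqP.
    have st2 := steps1 (s := s1); rewrite pc1 c3 in st2.
    have {st2} st2 := st2 _ erefl isT; rewrite /= hv hb iN in st2.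
    set s2 := mkState _ _ _ in st2.
    have S2 : sim (setv (sgi i) v i) s2 by apply: sim_pc S1.
    have [|s3 [k3 [st3 pc3 S3 K3]]] := IH Wc p.+2 s2 _ be cb erefl S2.
      move=> x xb; have := Wb x xb; rewrite inE negb_or => /andP[xv xc].
      by rewrite /= /updN (negbTE xv) sgi_nv // B // inE xb orbT.
    have st4 := steps1 (s := s3); rewrite pc3 c2 in st4.
    have {st4} st4 := st4 _ erefl isT; rewrite /= pc3 in st4.
    have hv3 : nmem s3 v = i by case: S3 => h _ _ _ _; rewrite h // den_nv //= /updN eqxx.
    have h39 : nmem s3 39 = 1%N by case: S3 => _ [].
    rewrite hv3 h39 addn1 in st4.
    eexists _, _; split.
    - by apply: steps_trans st1 _; apply: steps_trans st2 _; apply: steps_trans st3 st4.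
    - by [].
    - by rewrite sgiS; apply: sim_pc (sim_setv i.+1 v38 S3).
    - by move: K1 K3; rewrite mulSn; lia.
  have [s1 [k1 [st1 pc1 S1 K1]]] := loop n (leqnn n).
  have hv : nmem s1 v = n by case: S1 => h _ _ _ _; rewrite h //= /updN eqxx.
  have hb : nmem s1 b = n.
    case: S1 => h _ _ _ _; rewrite h //= /updN ifF; last exact/eqP.
    by rewrite sgi_nv //; exact/eqP.
  have st2 := steps1 (s := s1); rewrite pc1 c3 in st2.
  have {st2} st2 := st2 _ erefl isT; rewrite /= hv hb ltnn pc1 in st2.
  eexists _, _; split; first exact: steps_trans st1 st2.
  + by rewrite /= !size_cat /= -/L; lia.
  + exact: sim_pc S1.
  + by rewrite nE; move: K1; lia.
- case/and3P: W => Wa Wb Wc; have [c1 /code_at1 co] := code_at_cat cp.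
  have sa : all simple (cask a b c) by rewrite /cask !all_cat !simple_cn.
  have [st1 pc1] := steps_run sa ps c1.
  have [S1 va vb vc] := cask_ok Wa Wb Wc S0; set s1 := run _ s in st1 pc1 S1 va vb vc.
  have st2 := steps1 (s := s1); rewrite pc1 co in st2.
  have {st2} st2 := st2 _ erefl isT; rewrite /= va vb vc in st2.
  eexists _, _; split; first exact: steps_trans st1 st2.
  + by rewrite /= pc1 size_cat addn1 addnS.
  + case: S1 => h1 h2 h3 h4 h5; split=> //= [v hv|x].
      by rewrite ifF ?h4 //; lia.
    by rewrite /block -addnA !leq_add2l ltn_add2l subnDl h5.
  + by [].
Qed.

End Correctness.

(** * The program *)

Section Frames.
Variables (R : realType) (orc : nat -> nat -> seq R).
Implicit Types s : store R.

Record frame (c : cmd) s s' : Prop := Frame {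
  fnv : forall x, x \notin asg c -> nv s' x = nv s x;
  frv : forall x, x \notin rasg c -> rv s' x = rv s x;
  fnh : nput_free c -> nh s' = nh s;
  frh : rput_free c -> rh s' = rh s }.

Lemma frame_refl c s : frame c s s.
Proof. by []. Qed.

Lemma frame_trans c s1 s2 s3 : frame c s1 s2 -> frame c s2 s3 -> frame c s1 s3.
Proof.
move=> [a1 a2 a3 a4] [b1 b2 b3 b4]; split=> [x h|x h|h|h].
- by rewrite b1 ?a1.
- by rewrite b2 ?a2.
- by rewrite b3 ?a3.
- by rewrite b4 ?a4.
Qed.

Lemma frame_den c s : frame c s (den orc c s).
Proof.
by split; [exact: den_nv|exact: den_rv|exact: den_nh|exact: den_rh].
Qed.

Lemma frame_sub c c' s s' : {subset asg c <= asg c'} -> {subset rasg c <= rasg c'} ->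
  (nput_free c' -> nput_free c) -> (rput_free c' -> rput_free c) ->
  frame c s s' -> frame c' s s'.
Proof.
move=> h1 h2 h3 h4 [a1 a2 a3 a4]; split=> [x h|x h|h|h].
- by apply: a1; apply: contra h; exact: h1.
- by apply: a2; apply: contra h; exact: h2.
- exact/a3/h3.
- exact/a4/h4.
Qed.

(** The working loop rule. The body may assume that nothing outside the syntactic footprint of the
    loop has changed since its start, which keeps the invariants short. *)
Lemma den_loop (I : nat -> store R -> Prop) v b c s :
  (forall i s' k, I i s' -> I i (setv s' v k)) ->
  I 0%N s ->
  (forall i s', (i < nv s b)%N -> frame (For v b c) s s' -> nv s' v = i -> I i s' ->
     I i.+1 (den orc c s')) ->
  I (nv s b) (den orc (For v b c) s).
Proof.
move=> Iset I0 IS.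
have fset s1 k : frame (For v b c) s s1 -> frame (For v b c) s (setv s1 v k).
  move=> [a1 a2 a3 a4]; split=> // x xn; rewrite -a1 //= /updN ifF //.
  by move: xn; rewrite /= inE negb_or => /andP[/negbTE].
have fden s1 : frame (For v b c) s s1 -> frame (For v b c) s (den orc c s1).
  move=> f1; apply: frame_trans f1 _; apply: (@frame_sub c); last exact: frame_den.
  - by move=> x xc; rewrite /= inE xc orbT.
  - by [].
  - by [].
  - by [].
pose J i s' := I i s' /\ frame (For v b c) s s'.
suff [] : J (nv s b) (den orc (For v b c) s) by [].
apply: den_for.
- by split; [|exact: frame_refl].
- move=> i s' ib [Ii fi]; split; last exact/fden/fset.
  by apply: IS => //; [exact: fset|rewrite /= /updN eqxx|exact: Iset].
- by move=> s' [Ii fi]; split; [exact: Iset|exact: fset].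
Qed.

Lemma den_Seq a b s : den orc (Seq a b) s = den orc b (den orc a s).
Proof. by []. Qed.

Lemma den_If c a b s : den orc (If c a b) s = if evc s c then den orc a s else den orc b s.
Proof. by []. Qed.

Fixpoint nreads (e : nexp) : seq nat :=
  match e with
  | NV v => [:: v]
  | NC _ => [::]
  | NP a b | NM a b | NT a b => nreads a ++ nreads b
  | NL a => nreads a
  end.

Lemma evn_ext s s' e : nh s' = nh s -> (forall x, x \in nreads e -> nv s' x = nv s x) ->
  evn s' e = evn s e.
Proof.
move=> hn; elim: e => //= [v|a Ha b Hb|a Ha b Hb|a Ha b Hb|a Ha] H; last by rewrite hn Ha.
- by rewrite H // mem_head.
all: by rewrite Ha ?Hb // => x xa; apply: H; rewrite mem_cat xa ?orbT.
Qed.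

Lemma den_Skip s : den orc Skip s = s. Proof. by []. Qed.
Lemma den_NSet v e s : den orc (NSet v e) s = Store (updN (nv s) v (evn s e)) (nh s) (rv s) (rh s).
Proof. by []. Qed.
Lemma den_RSet v e s : den orc (RSet v e) s = Store (nv s) (nh s) (updR (rv s) v (evr s e)) (rh s).
Proof. by []. Qed.
Lemma den_NPut a e s :
  den orc (NPut a e) s = Store (nv s) (updN (nh s) (evn s a) (evn s e)) (rv s) (rh s).
Proof. by []. Qed.
Lemma den_RPut a e s :
  den orc (RPut a e) s = Store (nv s) (nh s) (rv s) (updR (rh s) (evn s a) (evr s e)).
Proof. by []. Qed.

End Frames.

Arguments den : simpl never.

Declare Scope cmd_scope.
Delimit Scope cmd_scope with cmd.
Notation "a ;; b" := (Seq a b) (at level 95, right associativity) : cmd_scope.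
Local Open Scope cmd_scope.

Notation rzero := (RN (NC 0)).
Notation rone := (RN (NC 1)).
Notation rtwo := (RN (NC 2)).

Section IntervalProgram.
Let va := RL (NP (NV 22) (NV 21)).
Let vb := RL (NP (NV 23) (NV 21)).
Let vb' := RL (NP (NV 24) (NV 21)).

(** Variables 22, 23, 24 are the addresses of the points a, b, b' of [segment_interval]. Real
    variables 1, 2, 3 accumulate its three coefficients, the last one starting from - delta^2. *)
Definition coef_body : cmd :=
  RSet 1 (RP (RV 1) (RT (RM vb' vb) (RM vb' vb))) ;;
  RSet 2 (RP (RV 2) (RT (RM vb va) (RM vb' vb))) ;;
  RSet 3 (RP (RV 3) (RT (RM vb va) (RM vb va))).

Definition coef : cmd :=
  RSet 1 rzero ;; RSet 2 rzero ;; RSet 3 (RM rzero (RV 0)) ;; For 21 0 coef_body.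

Definition quad : cmd :=
  If (CR rzero (RV 1))
    (RSet 9 (RM (RT (RV 2) (RV 2)) (RT (RV 1) (RV 3))) ;;
     If (CR (RV 9) rzero)
       (RSet 4 rtwo ;; RSet 5 rzero)
       (RSet 9 (RQ (RV 9)) ;;
        RSet 4 (RD (RM (RM rzero (RV 2)) (RV 9)) (RV 1)) ;;
        RSet 5 (RD (RP (RM rzero (RV 2)) (RV 9)) (RV 1)) ;;
        If (CR rzero (RV 4)) Skip (RSet 4 rzero) ;;
        If (CR rone (RV 5)) (RSet 5 rone) Skip))
    (If (CR rzero (RV 3)) (RSet 4 rtwo ;; RSet 5 rzero) (RSet 4 rzero ;; RSet 5 rone)).

Definition interval : cmd := coef ;; quad.

Definition prop (a b r : nat) : cmd :=
  If (CR rone (RV a))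
    (If (CR (RV 4) (RV b)) (RSet r (RV b)) (RSet r (RV 4)))
    (RSet r (RV 4)) ;;
  If (CR (RV 5) (RV r)) (RSet r rtwo) Skip.
End IntervalProgram.

Section IntervalCorrect.
Variables (R : realType) (orc : nat -> nat -> seq R).
Implicit Types s : store R.

Lemma quadP s : let s' := den orc quad s in
  (rv s' 4, rv s' 5) = quad_interval (rv s 1%N) (rv s 2) (rv s 3).
Proof.
rewrite /quad /quad_interval /Order.max /Order.min den_If /=; case: ifP => h1.
  rewrite den_Seq den_RSet den_If /= /updR /=; case: ifP => h2.
    by rewrite den_Seq !den_RSet /= /updR.
  rewrite !den_Seq !den_RSet /= /updR /= !sub0r.
  rewrite [den orc (If (CR rzero _) _ _) _]den_If /=; case: ifP => h3;
    rewrite ?den_Skip ?den_RSet den_If /= /updR /=; case: ifP => h4;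
    by rewrite ?den_Skip ?den_RSet /= /updR /=.
by rewrite den_If /=; case: ifP => h2; rewrite den_Seq !den_RSet.
Qed.

Lemma coefP s : let s' := den orc coef s in
  let f k c := rh s (nv s k + c)%N in
  [/\ rv s' 1 = \sum_(0 <= c < nv s 0) (f 24 c - f 23 c) * (f 24 c - f 23 c),
      rv s' 2 = \sum_(0 <= c < nv s 0) (f 23 c - f 22 c) * (f 24 c - f 23 c) &
      rv s' 3 = (\sum_(0 <= c < nv s 0) (f 23 c - f 22 c) * (f 23 c - f 22 c)) - rv s 0%N].
Proof.
move=> s' f; rewrite {}/s' /coef !den_Seq; set s1 := den orc (RSet 3 _) _.
pose I n (s' : store R) := [/\ rv s' 1 = \sum_(0 <= c < n) (f 24 c - f 23 c) * (f 24 c - f 23 c),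
      rv s' 2 = \sum_(0 <= c < n) (f 23 c - f 22 c) * (f 24 c - f 23 c) &
      rv s' 3 = (\sum_(0 <= c < n) (f 23 c - f 22 c) * (f 23 c - f 22 c)) - rv s 0%N].
have nE : nv s1 0 = nv s 0 by [].
rewrite -nE; apply: (@den_loop R orc I).
- by [].
- by rewrite /I !big_geq // /s1 !den_RSet /= /updR /= !sub0r.
- move=> i r iN fr ri [I1 I2 I3].
  have fE k : k \in [:: 22; 23; 24]%N -> rh r (nv r k + nv r 21)%N = f k i.
    by rewrite !inE ri => /or3P[]/eqP ->; rewrite /f (fnv fr) // (frh fr).
  rewrite /I /coef_body !den_Seq !den_RSet /= /updR /= !big_nat_recr //=.
  by rewrite !fE // I1 I2 I3; split=> //; ring.
Qed.

Lemma intervalP (d : nat) (delta : R) (va vb vb' : 'rV[R]_d) s :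
  nv s 0 = d -> rv s 0%N = delta * delta ->
  (forall c : 'I_d, [/\ rh s (nv s 22 + c)%N = va 0 c, rh s (nv s 23 + c)%N = vb 0 c &
     rh s (nv s 24 + c)%N = vb' 0 c]) ->
  let s' := den orc interval s in (rv s' 4, rv s' 5) = segment_interval delta va vb vb'.
Proof.
move=> d0 del hv /=; rewrite /interval den_Seq quadP.
have [-> -> ->] := coefP s.
rewrite d0 del /segment_interval !big_mkord.
by congr quad_interval; [|..|congr (_ - _)]; apply: eq_bigr => c _;
  have [h1 h2 h3] := hv c; rewrite ?h1 ?h2 ?h3.
Qed.

Lemma propP (a b r : nat) s : r != 4%N -> r != 5%N -> a != r -> b != r ->
  rv (den orc (prop a b r) s) r = propagate (rv s 4, rv s 5) (rv s a) (rv s b).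
Proof.
move=> r4 r5 ar br; rewrite /prop /propagate /Order.max den_Seq.
have key (x : R) : rv (den orc (If (CR (RV 5) (RV r)) (RSet r rtwo) Skip)
   (Store (nv s) (nh s) (updR (rv s) r x) (rh s))) r = if x <= rv s 5 then x else 2.
  rewrite den_If /= /updR eqxx [(5%N == r)%N]eq_sym (negbTE r5).
  by case: ltP => h; rewrite ?den_RSet ?den_Skip /= /updR eqxx.
rewrite [den orc (If (CR rone _) _ _) s]den_If /=; case: leP => h1; last first.
  rewrite [den orc (If _ _ _) s]den_If /=.
  by case: ifP => h2; rewrite den_RSet key.
by rewrite den_RSet key.
Qed.

End IntervalCorrect.

(* Integer variables: 0-3 hold d, n, m, l; 4, 5, 6 the numbers of edges of the two curves
   and of elementary intervals; 7, 8, 10-13 the heap addresses of the breakpoints, the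
   vertices, the DP arrays, the local breakpoint coordinates and the current candidate.
   Integer heap: cell indices of the breakpoints at 0, uncovered flags at m, chosen pairs
   at 2m and 3m, coverage table at 4m.
   Real variables: 0 holds delta^2, 4 and 5 the ends of the last free interval, 6 the lower
   end of the reachable part of the current left side. *)
Definition pt (base last : nat) (e : nexp) : nexp :=
  NP (NV base) (NT (NM e (NM e (NM (NV last) (NC 1)))) (NV 0)).
Notation ptP := (pt 8 1).
Notation ptQ := (pt 13 3).
Notation succ e := (NP e (NC 1)).
Notation vi := (NV 14).
Notation vj := (NV 15).
Notation va := (NV 16).
Notation vx := (NV 17).
Notation vy := (NV 18).
Notation vb := (NV 19).
Notation ve := (NV 20).
Notation lo e := (NP (NV 10) e).
Notation hi e := (NP (NV 11) e).
Notation uu e := (NP (NV 12) e).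

Definition ival (a b b' : nexp) : cmd := NSet 22 a ;; NSet 23 b ;; NSet 24 b' ;; interval.

(** Real variables 10, 6, 7, 11 belong to the bottom, left, right and top side. Both outgoing sides
    are computed from the incoming ones before anything is overwritten. *)
Definition cell : cmd :=
  RSet 10 (RL (lo vx)) ;;
  ival (ptP (succ vx)) (ptQ vy) (ptQ (succ vy)) ;; prop 10 6 7 ;;
  ival (ptQ (succ vy)) (ptP vx) (ptP (succ vx)) ;; prop 6 10 11 ;;
  RSet 6 (RV 7) ;; RPut (lo vx) (RV 11) ;; RPut (hi vx) (RV 5).

Definition sweep_row : cmd := RSet 6 rtwo ;; For 17 4 cell.

Definition start : cmd :=
  For 17 4 (RPut (lo vx) rtwo) ;;
  ival (ptQ (NC 0)) (ptP (NL va)) (ptP (succ (NL va))) ;;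
  RSet 8 (RL (uu va)) ;;
  If (CR (RV 8) (RV 4)) Skip (If (CR (RV 5) (RV 8)) Skip (RPut (lo (NL va)) (RV 8))).

Definition dp : cmd := start ;; For 18 5 sweep_row.

(** Endpoints are tried in increasing order, so the last success is the farthest; no other endpoint
    covers more from the same start. *)
Definition farthest_body : cmd :=
  If (CN va vb)
    (RSet 8 (RL (uu vb)) ;;
     If (CR (RV 8) (RL (lo (NL vb)))) Skip
       (If (CR (RL (hi (NL vb))) (RV 8)) Skip (NSet 25 vb)))
    Skip.

(** The value 0 encodes failure, since a successful endpoint exceeds its start. *)
Definition farthest : cmd := NSet 25 (NC 0) ;; For 19 2 farthest_body.

Section DynamicProgram.
Variables (R : realType) (d m l : nat) (orc : nat -> nat -> seq R).
Variables (p : seq 'rV[R]_d) (t : nat -> R) (delta : R) (TB PB Z : nat).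
Implicit Types (s : store R) (q : l.-tuple 'rV[R]_d).
Let n := size p.
Let N := edges n.
Let M := edges l.
Hypotheses (n0 : (0 < n)%N) (l0 : (0 < l)%N) (d0 : 0 <= delta).
Hypotheses (TBZ : (TB + m <= 2 * Z)%N) (PBZ : (PB + n * d <= 2 * Z)%N).
Hypotheses (NZ : (N <= Z)%N).

(** The real heap is cut at multiples of [Z]: input below 2Z, lower ends from 2Z, upper ends from
    3Z, local breakpoint coordinates from 4Z, current candidate from 5Z. *)
Record env s : Prop := Env {
  env0 : nv s 0 = d; env1 : nv s 1 = n; env2 : nv s 2 = m; env3 : nv s 3 = l;
  env4 : nv s 4 = N; env5 : nv s 5 = M; env6 : nv s 6 = m.-1;
  env7 : nv s 7 = TB; env8 : nv s 8 = PB;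
  env10 : nv s 10 = (2 * Z)%N; env11 : nv s 11 = (3 * Z)%N;
  env12 : nv s 12 = (4 * Z)%N; env13 : nv s 13 = (5 * Z)%N;
  envr : rv s 0%N = delta * delta;
  envt : forall i, (i < m)%N -> rh s (TB + i)%N = t i;
  envp : forall i (c : 'I_d), (i < n)%N -> rh s (PB + i * d + c)%N = (nth 0 p i) 0 c }.

Definition has_query q s :=
  forall j (c : 'I_d), (j < l)%N -> rh s (5 * Z + j * d + c)%N = (nth 0 q j) 0 c.

Definition has_cells s := forall b, (b < m)%N ->
  is_cell N (t b * N%:R) (nh s b) /\ rh s (4 * Z + b)%N = t b * N%:R - (nh s b)%:R.

(** What has to survive the sweeps for one candidate: parameters, input, breakpoint coordinates and
    cells, and the candidate. In the real heap only the two arrays of interval ends may change. *)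
Definition keep s s' := [/\ forall x, (x < 14)%N -> nv s' x = nv s x, rv s' 0%N = rv s 0%N,
  forall x, ~~ (2 * Z <= x < 4 * Z)%N -> rh s' x = rh s x & forall x, (x < m)%N -> nh s' x = nh s x].

Lemma keep_trans s1 s2 s3 : keep s1 s2 -> keep s2 s3 -> keep s1 s3.
Proof.
move=> [a1 a2 a3 a4] [b1 b2 b3 b4]; split=> [x h||x h|x h].
- by rewrite b1 ?a1.
- by rewrite b2.
- by rewrite b3 ?a3.
- by rewrite b4 ?a4.
Qed.

Lemma keep_env s s' : keep s s' -> env s -> env s'.
Proof.
clear n0 l0 d0 NZ.
move=> [k1 k2 k3 k4] [*]; split; rewrite ?k1 ?k2 //.
- by move=> i im; rewrite k3; auto; lia.
- move=> i c im; rewrite k3; auto.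
  have := ltn_ord c; have : (i * d + d <= n * d)%N by rewrite -mulSnr leq_mul2r im orbT.
  lia.
Qed.

Lemma keep_query q s s' : keep s s' -> has_query q s -> has_query q s'.
Proof.
clear n0 l0 d0 TBZ PBZ NZ.
by move=> [_ _ k3 _] H j c jl; rewrite k3 ?H //; lia. Qed.

Lemma keep_cells s s' : keep s s' -> has_cells s -> has_cells s'.
Proof.
clear n0 l0 d0 TBZ PBZ NZ.
by move=> [_ _ k3 k4] H b bm; rewrite k3 ?k4 ?H //; [exact: H|lia]. Qed.

Lemma frame_keep c s s' : all (leq 14) (asg c) -> 0%N \notin rasg c -> nput_free c ->
  rput_free c -> frame c s s' -> keep s s'.
Proof.
clear n0 l0 d0 TBZ PBZ NZ.
move=> /allP ha hr hn hp [f1 f2 f3 f4]; split=> [x h||x h|x h].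
- by apply: f1; apply/negP => /ha; lia.
- exact: f2.
- by rewrite f4.
- by rewrite f3.
Qed.

Lemma ptPE s e i (c : 'I_d) : env s -> evn s e = i ->
  rh s (evn s (ptP e) + c)%N = vertex p i 0 c.
Proof.
move=> E ei; rewrite /= (env8 E) (env1 E) (env0 E) ei /vertex.
(* Two truncated subtractions compute the minimum of [vertex], which repeats the last vertex on a
   degenerate edge. *)
have -> : (i - (i - (n - 1)) = minn i n.-1)%N by lia.
by rewrite (envp E) //; lia.
Qed.

Lemma ptQE q s e j (c : 'I_d) : env s -> has_query q s -> evn s e = j ->
  rh s (evn s (ptQ e) + c)%N = vertex q j 0 c.
Proof.
move=> E H ej; rewrite /= (env13 E) (env3 E) (env0 E) ej /vertex size_tuple.
have -> : (j - (j - (l - 1)) = minn j l.-1)%N by lia.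
by rewrite H //; lia.
Qed.

Lemma asg_ival a b b' : asg (ival a b b') = [:: 22; 23; 24; 21]%N. Proof. by []. Qed.

Lemma ivalP a b b' (wa wb wb' : 'rV[R]_d) s : env s ->
  all (fun x => x < 22)%N (nreads a ++ nreads b ++ nreads b') ->
  (forall c : 'I_d, [/\ rh s (evn s a + c)%N = wa 0 c, rh s (evn s b + c)%N = wb 0 c &
     rh s (evn s b' + c)%N = wb' 0 c]) ->
  let s' := den orc (ival a b b') s in (rv s' 4, rv s' 5) = segment_interval delta wa wb wb'.
Proof.
move=> E; rewrite !all_cat => /and3P[/allP ra /allP rb /allP rb'] H.
rewrite /ival 3!den_Seq; set s3 := den orc (NSet 24 _) _.
have e2 s1 k v e : (22 <= v)%N -> (forall x, x \in nreads e -> (x < 22)%N) ->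
    evn (Store (updN (nv s1) v k) (nh s1) (rv s1) (rh s1)) e = evn s1 e.
  move=> v22 re; apply: evn_ext => // x /re xe.
  by rewrite /= /updN ifF //; lia.
apply: (@intervalP R orc d delta wa wb wb' s3); rewrite /s3 3!den_NSet ?e2 //; first exact: env0 E.
  exact: envr E.
Qed.

Lemma cellP q s x y : env s -> has_query q s -> nv s 17 = x -> nv s 18 = y ->
  (x < N)%N -> (y < M)%N ->
  let s' := den orc cell s in
  let a := rh s (2 * Z + x)%N in
  [/\ rv s' 6 = propagate (left_interval p q delta x.+1 y) a (rv s 6),
      rh s' = updR (updR (rh s) (2 * Z + x)%N
         (propagate (bottom_interval p q delta x y.+1) (rv s 6) a)) (3 * Z + x)%N
         (bottom_interval p q delta x y.+1).2 &
      keep s s'].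
Proof.
move=> E Q hx hy xN yM; rewrite /cell.
set c1 := RSet 10 _; set c2 := ival _ _ _; set c3 := prop 10 6 7.
set c4 := ival _ _ _; set c5 := prop 6 10 11.
rewrite 7!den_Seq.
move D1: (den orc c1 s) => s1; move D2: (den orc c2 s1) => s2; move D3: (den orc c3 s2) => s3.
move D4: (den orc c4 s3) => s4; move D5: (den orc c5 s4) => s5.
have f1 : frame c1 s s1 by rewrite -D1; exact: frame_den.
have f2 : frame c2 s1 s2 by rewrite -D2; exact: frame_den.
have f3 : frame c3 s2 s3 by rewrite -D3; exact: frame_den.
have f4 : frame c4 s3 s4 by rewrite -D4; exact: frame_den.
have f5 : frame c5 s4 s5 by rewrite -D5; exact: frame_den.
have k1 : keep s s1 by apply: frame_keep f1.
have k2 : keep s1 s2 by apply: frame_keep f2.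
have k3 : keep s2 s3 by apply: frame_keep f3.
have k4 : keep s3 s4 by apply: frame_keep f4.
have k5 : keep s4 s5 by apply: frame_keep f5.
have E1 := keep_env k1 E; have Q1 := keep_query k1 Q.
have k13 := keep_trans (keep_trans k1 k2) k3.
have E3 := keep_env k13 E; have Q3 := keep_query k13 Q.
have E5 := keep_env (keep_trans k4 k5) E3.
have x3 : nv s3 17 = x by rewrite (fnv f3) // (fnv f2) // (fnv f1).
have y3 : nv s3 18 = y by rewrite (fnv f3) // (fnv f2) // (fnv f1).
have I2 : (rv s2 4, rv s2 5) = left_interval p q delta x.+1 y.
  rewrite -D2; apply: ivalP => // c; split.
  - by apply: ptPE => //=; rewrite (fnv f1) // hx addn1.
  - by apply: (ptQE (q := q)) => //=; rewrite (fnv f1).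
  - by apply: (ptQE (q := q)) => //=; rewrite (fnv f1) // hy addn1.
have I4 : (rv s4 4, rv s4 5) = bottom_interval p q delta x y.+1.
  rewrite -D4; apply: ivalP => // c; split.
  - by apply: (ptQE (q := q)) => //=; rewrite y3 addn1.
  - by apply: ptPE.
  - by apply: ptPE => //=; rewrite x3 addn1.
have r10 : rv s2 10 = rh s (2 * Z + x)%N.
  by rewrite (frv f2) // -D1 den_RSet /= (env10 E) hx.
have r6 : rv s2 6 = rv s 6 by rewrite (frv f2) // (frv f1).
have L : rv s3 7 = propagate (left_interval p q delta x.+1 y) (rh s (2 * Z + x)%N) (rv s 6).
  by rewrite -D3 propP // I2 r10 r6.
have B : rv s5 11 = propagate (bottom_interval p q delta x y.+1) (rv s 6) (rh s (2 * Z + x)%N).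
  by rewrite -D5 propP // I4 !(frv f4) // !(frv f3) // r6 r10.
have r5 : rv s5 5 = (bottom_interval p q delta x y.+1).2.
  by rewrite (frv f5) // -I4.
have rh5 : rh s5 = rh s by rewrite (frh f5) // (frh f4) // (frh f3) // (frh f2) // (frh f1).
have nv5 z : (14 <= z < 21)%N -> nv s5 z = nv s z.
  move=> hz; rewrite (fnv f5) // (fnv f4) ?asg_ival ?inE; last by lia.
  rewrite (fnv f3) // (fnv f2) ?asg_ival ?inE; last by lia.
  by rewrite (fnv f1).
rewrite !den_RPut !den_RSet.
split.
- by rewrite /= /updR /= (frv f5) // (frv f4) // L.
- by rewrite /= /updR /= (env10 E5) (env11 E5) nv5 // hx rh5 r5 B.
- apply: keep_trans k13 _; apply: keep_trans (keep_trans k4 k5) _.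
  split=> //= z hz; rewrite /updR /= (env10 E5) (env11 E5) nv5 // hx !ifF //; lia.
Qed.

Lemma sweep_rowP q s y (row : nat -> R) : env s -> has_query q s -> nv s 18 = y -> (y < M)%N ->
  (forall x, (x < N)%N -> rh s (2 * Z + x)%N = row x) ->
  let s' := den orc sweep_row s in
  let fl := left_interval p q delta in let fb := bottom_interval p q delta in
  keep s s' /\ forall x, (x < N)%N ->
    rh s' (2 * Z + x)%N = propagate (fb x y.+1) (reach_left fl row y x) (row x) /\
    rh s' (3 * Z + x)%N = (fb x y.+1).2.
Proof.
move=> E Q hy yM rowE s' fl fb; rewrite {}/s' /sweep_row den_Seq; move D1: (den orc (RSet 6 rtwo) s) => s1.
have f1 : frame (RSet 6 rtwo) s s1 by rewrite -D1; exact: frame_den.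
have k1 : keep s s1 by apply: frame_keep f1.
have r6 : rv s1 6 = 2 by rewrite -D1.
have E1 := keep_env k1 E; have Q1 := keep_query k1 Q.
(* The row is updated in place: entries before x are new, those from x on are still old. *)
pose I x r := [/\ keep s1 r, rv r 6 = reach_left fl row y x,
  forall z, (x <= z < N)%N -> rh r (2 * Z + z)%N = row z &
  forall z, (z < x)%N -> (z < N)%N ->
    rh r (2 * Z + z)%N = propagate (fb z y.+1) (reach_left fl row y z) (row z) /\
    rh r (3 * Z + z)%N = (fb z y.+1).2].
have : I (nv s1 4) (den orc (For 17 4 cell) s1).
  apply: den_loop.
  - move=> i r k [k0 h1 h2 h3]; split=> //; apply: keep_trans k0 _.
    by split=> // x hx; rewrite /= /updN ifF //; lia.
  - by split=> // z /andP[_ zN]; rewrite (frh f1) // rowE.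
  - move=> i r; rewrite (env4 E1) => iN fr ri [k0 h1 h2 h3].
    have [|L Bt K] := @cellP q r i y (keep_env k0 E1) (keep_query k0 Q1) ri _ iN yM.
      by rewrite (fnv fr) // (fnv f1).
    rewrite (h2 i) ?leqnn // h1 in L Bt.
    split.
    + exact: keep_trans k0 K.
    + exact: L.
    + by move=> z hz; rewrite Bt /updR !ifF ?h2 //; lia.
    + move=> z; rewrite ltnS leq_eqVlt => /orP[/eqP-> _|zi zN].
        by rewrite Bt /updR !eqxx ifF //; lia.
      have [g1 g2] := h3 z zi zN.
      by rewrite Bt /updR; split; rewrite !ifF //; lia.
rewrite (env4 E1) => -[K _ _ H]; split; first exact: keep_trans k1 K.
by move=> x xN; apply: H.
Qed.

Lemma startP q s a : env s -> has_query q s -> has_cells s -> nv s 16 = a -> (a < m)%N ->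
  let s' := den orc start s in
  keep s s' /\ forall x, (x < N)%N -> rh s' (2 * Z + x)%N =
    start_row (bottom_interval p q delta) (nh s a) (t a * N%:R - (nh s a)%:R) x.
Proof.
move=> E Q C ha am s'; rewrite {}/s' /start 3!den_Seq.
set c1 := For 17 4 _; set c2 := ival _ _ _; set c3 := RSet 8 _.
move D1: (den orc c1 s) => s1; move D2: (den orc c2 s1) => s2; move D3: (den orc c3 s2) => s3.
have [k1 lo1] : keep s s1 /\ forall x, (x < N)%N -> rh s1 (2 * Z + x)%N = 2.
  pose I i r := keep s r /\ forall x, (x < i)%N -> (x < N)%N -> rh r (2 * Z + x)%N = 2.
  have : I (nv s 4) s1.
    rewrite -D1; apply: den_loop.
    - move=> i r k [k0 h1]; split=> //; apply: keep_trans k0 _.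
      by split=> // x hx; rewrite /= /updN ifF //; lia.
    - by [].
    - move=> i r; rewrite (env4 E) => iN fr ri [k0 h].
      have E' := keep_env k0 E; rewrite den_RPut /= (env10 E') ri; split.
        by apply: keep_trans k0 _; split=> //= x hx; rewrite /updR ifF //; lia.
      move=> x xi xN; rewrite /= /updR; case: eqP => // ne; apply: h => //.
      by move: xi; rewrite ltnS leq_eqVlt => /orP[/eqP xE|//]; rewrite xE in ne.
  by rewrite (env4 E) => -[? H]; split=> // x xN; apply: H.
have f1 : frame c1 s s1 by rewrite -D1; exact: frame_den.
have f2 : frame c2 s1 s2 by rewrite -D2; exact: frame_den.
have f3 : frame c3 s2 s3 by rewrite -D3; exact: frame_den.
have k2 : keep s1 s2 by apply: frame_keep f2.
have k3 : keep s2 s3 by apply: frame_keep f3.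
have E1 := keep_env k1 E; have Q1 := keep_query k1 Q.
have k13 := keep_trans (keep_trans k1 k2) k3; have E3 := keep_env k13 E.
have [[iaN _ _] ua] := C a am.
have a1 : nv s1 16 = a by rewrite (fnv f1).
have a3 : nv s3 16 = a by rewrite (fnv f3) // (fnv f2).
have nh1 : nh s1 = nh s by rewrite (fnh f1).
have nh3 : nh s3 = nh s by rewrite (fnh f3) // (fnh f2).
have I2 : (rv s2 4, rv s2 5) = bottom_interval p q delta (nh s a) 0.
  rewrite -D2; apply: ivalP => // c; split.
  - exact: (ptQE (q := q)).
  - by apply: ptPE => //=; rewrite a1 nh1.
  - by apply: ptPE => //=; rewrite a1 nh1 addn1.
have r8 : rv s3 8 = t a * N%:R - (nh s a)%:R.
  rewrite -D3 den_RSet /= /updR /= (env12 (keep_env (keep_trans k1 k2) E)) (fnv f2) // a1.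
  by case: (keep_trans k1 k2) => _ _ -> //; lia.
have r4 : (rv s3 4, rv s3 5) = bottom_interval p q delta (nh s a) 0 by rewrite !(frv f3).
have rh3 : rh s3 = rh s1 by rewrite (frh f3) // (frh f2).
set u := t a * _ - _ in r8 *.
have cond : ((bottom_interval p q delta (nh s a) 0).1 <= u <=
     (bottom_interval p q delta (nh s a) 0).2) = ~~ (rv s3 8 < rv s3 4) && ~~ (rv s3 5 < rv s3 8).
  by rewrite -r4 r8 -!leNgt.
rewrite den_If /=; case: ifP => h1.
  rewrite den_Skip; split=> // x xN.
  by rewrite rh3 lo1 // /start_row cond h1 andbF.
rewrite den_If /=; case: ifP => h2.
  rewrite den_Skip; split=> // x xN.
  by rewrite rh3 lo1 // /start_row cond h2 andbF andbF.
rewrite den_RPut /= (env10 E3) a3 nh3; split.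
  by apply: keep_trans k13 _; split=> //= z hz; rewrite ?nh3 // /updR ifF //; lia.
move=> x xN; rewrite /= /updR eqn_add2l /start_row cond h1 h2 andbT rh3.
by case: eqP => // _; exact: lo1.
Qed.

Lemma dpP q s a : env s -> has_query q s -> has_cells s -> nv s 16 = a -> (a < m)%N ->
  let s' := den orc dp s in
  keep s s' /\ forall x, (x < N)%N ->
    rh s' (2 * Z + x)%N = final_row p q delta (nh s a) (t a * N%:R - (nh s a)%:R) x /\
    rh s' (3 * Z + x)%N = (bottom_interval p q delta x M).2.
Proof.
move=> E Q C ha am s'; rewrite {}/s' /dp den_Seq.
have [k1 row1] := startP E Q C ha am; move: (den orc start s) => s1 in k1 row1 *.
have E1 := keep_env k1 E; have Q1 := keep_query k1 Q.
set ia := nh s a in row1 *; set ua := _ - ia%:R in row1 *.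
pose row := reach_row (left_interval p q delta) (bottom_interval p q delta)
    (start_row (bottom_interval p q delta) ia ua).
(* Upper ends are written only by [cell], so they are meaningful after the first row; there is at
   least one row. *)
pose I y r := keep s1 r /\ forall x, (x < N)%N -> rh r (2 * Z + x)%N = row y x /\
   ((0 < y)%N -> rh r (3 * Z + x)%N = (bottom_interval p q delta x y).2).
have : I (nv s1 5) (den orc (For 18 5 sweep_row) s1).
  apply: den_loop.
  - move=> i r k [k0 h1]; split=> //; apply: keep_trans k0 _.
    by split=> // x hx; rewrite /= /updN ifF //; lia.
  - by split=> // x xN; split=> //; exact: row1.
  - move=> i r; rewrite (env5 E1) => iM fr ri [k0 h].
    have [|K H] := @sweep_rowP q r i (row i) (keep_env k0 E1) (keep_query k0 Q1) ri iM.
      by move=> x /h[].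
    split; first exact: keep_trans k0 K.
    by move=> x xN; have [g1 g2] := H x xN.
rewrite (env5 E1) => -[K H]; split; first exact: keep_trans k1 K.
move=> x xN; have [h1 h2] := H x xN; rewrite h1 h2 ?edges_gt0 //.
by rewrite /final_row size_tuple.
Qed.

Lemma farthestP q s a : env s -> has_cells s -> nv s 16 = a ->
  (forall x, (x < N)%N ->
    rh s (2 * Z + x)%N = final_row p q delta (nh s a) (t a * N%:R - (nh s a)%:R) x /\
    rh s (3 * Z + x)%N = (bottom_interval p q delta x M).2) ->
  breakpoints m t -> (a < m)%N ->
  let s' := den orc farthest s in
  let ok b := (a < b < m)%N /\
     (frechet (subcurve (polycurve p) (t a) (t b)) (curve_of q) <= delta%:E)%E in
  (forall b, ok b -> (b <= nv s' 25)%N) /\ ((0 < nv s' 25)%N -> ok (nv s' 25)).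
Proof.
clear n0 l0 TBZ PBZ NZ.
move=> E C ha H tP am s' ok; rewrite {}/s' /farthest den_Seq; move D1: (den orc (NSet 25 (NC 0)) s) => s1.
have f1 : frame (NSet 25 (NC 0)) s s1 by rewrite -D1; exact: frame_den.
have J0 : nv s1 25 = 0%N by rewrite -D1.
pose I i (r : store R) := (forall b, ok b -> (b < i)%N -> (b <= nv r 25)%N) /\
   ((0 < nv r 25)%N -> ok (nv r 25)).
suff : I (nv s1 2) (den orc (For 19 2 farthest_body) s1).
  rewrite (fnv f1) // (env2 E) => -[h1 h2]; split=> // b okb; apply: h1 => //.
  by case: okb => /andP[].
apply: den_loop.
- by [].
- by split=> //; rewrite J0.
- move=> i r; rewrite (fnv f1) // (env2 E) => im fr ri [h1 h2].
  have ra : nv r 16 = a by rewrite (fnv fr) // (fnv f1).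
  have v10 : nv r 10 = (2 * Z)%N by rewrite (fnv fr) // (fnv f1) // (env10 E).
  have v11 : nv r 11 = (3 * Z)%N by rewrite (fnv fr) // (fnv f1) // (env11 E).
  have v12 : nv r 12 = (4 * Z)%N by rewrite (fnv fr) // (fnv f1) // (env12 E).
  have rhE : rh r = rh s by rewrite (frh fr) // (frh f1).
  have nhE : nh r = nh s by rewrite (fnh fr) // (fnh f1).
  have skip : ~ ok i -> I i.+1 r.
    move=> nok; split; last exact: h2.
    move=> b okb; rewrite ltnS leq_eqVlt => /orP[/eqP bi|]; last exact: h1.
    by case: nok; rewrite -bi.
  rewrite /farthest_body den_If /= ra ri; case: ifP => ai; last first.
    by rewrite den_Skip; apply: skip => -[/andP[]]; rewrite ai.
  have [ci ui] := C i im; have [ca _] := C a am; have [iN _ _] := ci.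
  have [lo_i hi_i] := H (nh s i) iN.
  have dec := @frechet_decision R d p l q delta (t a) (t i) (nh s a) (nh s i) d0.
  have [m1 [t0 [t1 tm]]] := tP.
  have ta0 : 0 <= t a by rewrite -t0; apply: (t_le tP); rewrite leq0n.
  have tai : t a < t i by apply: tm; rewrite ai.
  have ti1 : t i <= 1 by rewrite -t1; apply: (t_le tP); apply/andP; split; lia.
  have {}dec := dec ta0 tai ti1 ca ci.
  rewrite den_Seq; move D2: (den orc (RSet 8 _) r) => r1.
  have r1E : r1 = Store (nv r) (nh r) (updR (rv r) 8 (t i * N%:R - (nh s i)%:R)) (rh r).
    by rewrite -D2 den_RSet /= v12 ri rhE ui.
  have rE : nv r1 = nv r /\ rv r1 8 = t i * N%:R - (nh s i)%:R by rewrite r1E.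
  have [nv1 rv1] := rE; have rh1 : rh r1 = rh s by rewrite r1E.
  have nh1 : nh r1 = nh s by rewrite r1E.
  rewrite den_If /= rv1 nv1 v10 ri nh1 rh1 lo_i.
  have skip' r' : nv r' 25 = nv r 25 -> ~ ok i -> I i.+1 r'.
    by move=> e /skip; rewrite /I e.
  case: ifP => g1.
    rewrite den_Skip; apply: skip'; first by rewrite nv1.
    case=> _ /dec/andP[].
    by rewrite leNgt g1.
  rewrite den_If /= rv1 nv1 v11 ri nh1 rh1 hi_i; case: ifP => g2.
    rewrite den_Skip; apply: skip'; first by rewrite nv1.
    case=> _ /dec/andP[_].
    by rewrite leNgt g2.
  have oki : ok i.
    split; first by rewrite ai.
    by apply/dec; rewrite !leNgt g1 g2.
  rewrite den_NSet /I /= /updN /= nv1 ri; split; last by [].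
  by move=> b okb; rewrite ltnS.
Qed.

End DynamicProgram.

(** * Breakpoint cells and the coverage table *)

Definition cell_scan : cmd := If (CR (RV 8) (RN vx)) Skip (NPut vb vx).
Definition cells_body : cmd :=
  RSet 8 (RT (RL (NP (NV 7) vb)) (RN (NV 4))) ;;
  For 17 4 cell_scan ;;
  RPut (uu vb) (RM (RV 8) (RN (NL vb))).
Definition cells : cmd := For 19 2 cells_body.

Definition tab (a b e : nexp) : nexp :=
  NP (NT (NC 4) (NV 2)) (NP (NT (NP (NT a (NV 2)) b) (NV 2)) e).
Definition mark : cmd :=
  If (CN ve va) Skip (If (CN ve (NV 25)) (NPut (tab vi vj ve) (NC 1)) Skip).
Definition from_start : cmd := dp ;; farthest ;; For 20 6 mark.
(** All candidates are written to the same place, since each is needed only for its own block of the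
    table. *)
Definition decide : cmd := Ask vi vj (NV 13) ;; For 16 2 from_start.
Definition table_body : cmd := If (CN vi vj) decide Skip.
Definition table : cmd := For 14 2 (For 15 2 table_body).

Section CoverageTable.
Variables (R : realType) (d m l : nat).
Variables (p : seq 'rV[R]_d) (t : nat -> R) (delta : R) (TB PB Z : nat).
Variable (S : nat -> nat -> l.-tuple 'rV[R]_d).
Implicit Types (s : store R).
Let orc := oracle_of m S.
Let n := size p.
Let N := edges n.
Let M := edges l.
Hypotheses (n0 : (0 < n)%N) (l0 : (0 < l)%N) (d0 : 0 <= delta).
Hypotheses (TBZ : (TB + m <= 2 * Z)%N) (PBZ : (PB + n * d <= 2 * Z)%N).
Hypotheses (NZ : (N <= Z)%N) (mZ : (m <= Z)%N) (tP : breakpoints m t).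
Local Notation env := (env m l p t delta TB PB Z).
Local Notation has_cells := (has_cells m p t Z).
Local Notation has_query := (has_query Z).

Lemma env_low s s' : (forall x, (x < 14)%N -> nv s' x = nv s x) -> rv s' 0%N = rv s 0%N ->
  (forall x, (x < 2 * Z)%N -> rh s' x = rh s x) -> env s -> env s'.
Proof.
move=> k1 k2 k3 [*]; split; rewrite ?k1 ?k2 //.
- by move=> i im; rewrite k3; auto; lia.
- move=> i c im; rewrite k3; auto.
  have := ltn_ord c; have : (i * d + d <= size p * d)%N by rewrite -mulSnr leq_mul2r im orbT.
  by move: PBZ; rewrite /n; lia.
Qed.

Lemma t01 b : (b < m)%N -> 0 <= t b <= 1.
Proof.
move=> bm; have [m1 [t0 [t1 _]]] := tP; apply/andP; split.
  by rewrite -t0; apply: (t_le tP).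
by rewrite -t1; apply: (t_le tP); apply/andP; split; lia.
Qed.

(** The machine has no floor operation: the scan keeps the last cell whose left end does not exceed
    x. If this is the cell tested last, no upper bound on x is known, which is the second
    alternative of [is_cell]. *)
Lemma cell_scanP s b x : env s -> nv s 19 = b -> rv s 8 = x -> 0 <= x ->
  let s' := den orc (For 17 4 cell_scan) s in
  [/\ is_cell N x (nh s' b) & forall y, y != b -> nh s' y = nh s y].
Proof.
move=> E hb hx x0.
pose I i (r : store R) := [/\ (0 < i)%N -> (nh r b < i)%N /\ (nh r b)%:R <= x,
  (0 < i)%N -> x < (nh r b)%:R + 1 \/ (nh r b).+1 = i & forall y, y != b -> nh r y = nh s y].
have : I (nv s 4) (den orc (For 17 4 cell_scan) s).
  apply: den_loop => // i r iN fr ri [h1 h2 h3].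
  rewrite /cell_scan den_If /= ri (frv fr) // hx; case: ifP => lt.
    rewrite den_Skip; have i0 : (0 < i)%N by case: (posnP i) lt => // ->; lra.
    have [g1 g2] := h1 i0; split=> // _; first by split=> //; lia.
    left; case: (h2 i0) => // e; by move: lt; rewrite -e -natr1.
  have xi : i%:R <= x by rewrite leNgt lt.
  rewrite den_NPut /= ri (fnv fr) // hb; split=> /= [_|_|y yb]; rewrite /updN ?eqxx //.
  - by right.
  - by rewrite (negbTE yb) h3.
have N0 : (0 < N)%N := edges_gt0 _.
by rewrite (env4 E) => -[/(_ N0)[h1 h2] /(_ N0) h3 h4]; split.
Qed.

Lemma cellsP s : env s -> let s' := den orc cells s in
  [/\ env s', has_cells s' & forall x, (m <= x)%N -> nh s' x = nh s x].
Proof.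
move=> E s'; rewrite {}/s' /cells.
pose I b r := [/\ env r, forall x, (m <= x)%N -> nh r x = nh s x &
  forall z, (z < b)%N -> (z < m)%N -> is_cell N (t z * N%:R) (nh r z) /\
    rh r (4 * Z + z)%N = t z * N%:R - (nh r z)%:R].
have : I (nv s 2) (den orc (For 19 2 cells_body) s).
  apply: den_loop.
  - move=> i r k [E0 h1 h2]; split=> //; apply: env_low E0 => // x hx.
    by rewrite /= /updN ifF //; lia.
  - by [].
  - move=> b r; rewrite (env2 E) => bm fr rb [E0 h1 h2].
    rewrite /cells_body 2!den_Seq; move D1: (den orc (RSet 8 _) r) => r1.
    have r1E : r1 = Store (nv r) (nh r) (updR (rv r) 8 (t b * N%:R)) (rh r).
      by rewrite -D1 den_RSet /= rb (env7 E0) (env4 E0) (envt E0).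
    have E1 : env r1 by apply: env_low E0; rewrite r1E.
    have b1 : nv r1 19 = b by rewrite r1E.
    have x1 : rv r1 8 = t b * N%:R by rewrite r1E /= /updR.
    have x10 : 0 <= t b * N%:R by have /andP[? _] := t01 bm; rewrite mulr_ge0.
    have [c1 c2] := cell_scanP E1 b1 x1 x10.
    move: c1 c2; have f2 := frame_den orc (For 17 4 cell_scan) r1.
    move: (den orc (For 17 4 cell_scan) r1) f2 => r2 f2 c1 c2.
    have E2 : env r2.
      apply: env_low E1; [by move=> x hx; rewrite (fnv f2) //= inE; lia|by rewrite (frv f2)|].
      by move=> x _; rewrite (frh f2).
    rewrite den_RPut /= (env12 E2) (fnv f2) // b1 (frv f2) // x1; split=> /=.
    + by apply: env_low E2 => // x hx; rewrite /= /updR ifF //; lia.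
    + by move=> x mx; rewrite c2 ?r1E /= ?h1 //; lia.
    + move=> z; rewrite /updR eqn_add2l ltnS leq_eqVlt => /orP[/eqP-> _|zb zm].
        by rewrite eqxx.
      by rewrite c2 ?ltn_eqF // (frh f2) // r1E /=; exact: h2.
rewrite (env2 E) => -[h1 h2 h3]; split; [exact: h1|by move=> z zm; apply: h3|exact: h2].
Qed.

Definition cov_from (q : l.-tuple 'rV[R]_d) (a e : nat) : Prop := exists2 b, (a <= e < b)%N &
  (b < m)%N /\ (frechet (subcurve (polycurve p) (t a) (t b)) (curve_of q) <= delta%:E)%E.

Let addr i j e : nat := (4 * m + ((i * m + j) * m + e))%N.

Let same_but i j (f g : nat -> nat) : Prop :=
  forall x, ~~ (addr i j 0 <= x < addr i j 0 + m)%N -> g x = f x.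

Lemma m_lt_addr i j e : (0 < m)%N -> (m <= addr i j e)%N.
Proof. by rewrite /addr; lia. Qed.

Lemma from_startP q s i j a : env s -> has_query q s -> has_cells s ->
  nv s 14 = i -> nv s 15 = j -> nv s 16 = a -> (a < m)%N ->
  let s' := den orc from_start s in
  [/\ keep m Z s s', same_but i j (nh s) (nh s') & forall e, (e < m.-1)%N ->
     nh s' (addr i j e) = if `[< cov_from q a e >] then 1%N else nh s (addr i j e)].
Proof.
move=> E Q C hi hj ha am s'; rewrite {}/s' /from_start 2!den_Seq.
have [k1 D] := dpP orc n0 l0 d0 TBZ PBZ NZ E Q C ha am.
have f1 := frame_den orc dp s; move: (den orc dp s) f1 k1 D => s1 f1 k1 D.
have a1 : nv s1 16 = a by rewrite (fnv f1).
have E1 := keep_env TBZ PBZ k1 E; have C1 := keep_cells l k1 C.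
have nh1 : nh s1 = nh s by rewrite (fnh f1).
rewrite -nh1 in D.
have := @farthestP R d m l orc p t delta TB PB Z d0 q s1 a E1 C1 a1 D tP am.
have f2 := frame_den orc farthest s1; move: (den orc farthest s1) f2 => s2 f2 [J1 J2].
have k2 : keep m Z s1 s2 by apply: (@frame_keep R d m l p Z farthest) f2.
have E2 := keep_env TBZ PBZ k2 E1.
(* Any accepted endpoint beyond e will do, so the intervals covered from [a] form a range ending at
   the farthest one. *)
have covE e : cov_from q a e <-> (a <= e < nv s2 25)%N.
  split=> [[b /andP[ae eb] [bm fr]]|/andP[ae eJ]].
    rewrite ae /=; apply: (leq_trans eb); apply: J1; split=> //.
    by rewrite bm andbT; exact: leq_ltn_trans ae eb.
  have [/andP[aJ Jm] fr] := J2 (leq_ltn_trans (leq0n _) eJ).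
  by exists (nv s2 25); rewrite ?ae.
have nh2 : nh s2 = nh s by rewrite (fnh f2).
have v14 : nv s2 14 = i by rewrite (fnv f2) // (fnv f1).
have v15 : nv s2 15 = j by rewrite (fnv f2) // (fnv f1).
have v16 : nv s2 16 = a by rewrite (fnv f2) // (fnv f1).
pose I k r := [/\ keep m Z s2 r, same_but i j (nh s2) (nh r),
  forall e, (k <= e)%N -> (e < m.-1)%N -> nh r (addr i j e) = nh s2 (addr i j e) &
  forall e, (e < k)%N -> (e < m.-1)%N -> nh r (addr i j e) =
     if `[< cov_from q a e >] then 1%N else nh s2 (addr i j e)].
have : I (nv s2 6) (den orc (For 20 6 mark) s2).
  apply: den_loop.
  - move=> e r k [k0 h1 h2 h3]; split=> //; apply: keep_trans k0 _.
    by split=> // x hx; rewrite /= /updN ifF //; lia.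
  - by [].
  - move=> e r; rewrite (env6 E2) => em fr re [k0 h1 h2 h3].
    have E0 := keep_env TBZ PBZ k0 E2.
    have r16 : nv r 16 = a by rewrite (fnv fr).
    have r25 : nv r 25 = nv s2 25 by rewrite (fnv fr).
    have skip : ~ cov_from q a e -> I e.+1 r.
      move=> nc; split=> // e'; first by move=> /ltnW; exact: h2.
      rewrite ltnS leq_eqVlt => /orP[/eqP-> em'|]; last exact: h3.
      by rewrite h2 //; case: asboolP.
    rewrite /mark den_If /= re r16; case: ifP => c1.
      by rewrite den_Skip; apply: skip => /covE/andP[]; rewrite leqNgt c1.
    rewrite den_If /= re r25; case: ifP => c2; last first.
      by rewrite den_Skip; apply: skip => /covE/andP[_]; rewrite c2.
    have ce : cov_from q a e by apply/covE; rewrite leqNgt c1 c2.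
    have vE : evn r (tab vi vj ve) = addr i j e.
      by rewrite /= (env2 E0) re !(fnv fr) // v14 v15.
    rewrite den_NPut vE /=; split.
    + apply: keep_trans k0 _; split=> //= x hx; rewrite /updN ifF //.
      by have := @m_lt_addr i j e; lia.
    + by move=> x hx; rewrite /= /updN ifF ?h1 //; move: hx; rewrite /addr; lia.
    + by move=> e' ee' em'; rewrite /= /updN ifF ?h2 //; [exact: ltnW|rewrite /addr; lia].
    + move=> e'; rewrite ltnS leq_eqVlt => /orP[/eqP-> em'|ee' em'].
        by rewrite /= /updN eqxx; case: asboolP.
      by rewrite /= /updN ifF ?h3 //; rewrite /addr; lia.
rewrite (env6 E2) => -[K B _ H]; split.
- exact: keep_trans k1 (keep_trans k2 K).
- by move=> x hx; rewrite B // nh2.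
- by move=> e em; rewrite H // nh2.
Qed.

Lemma size_flat_pts (s : seq 'rV[R]_d) : size (flat_pts s) = (size s * d)%N.
Proof.
rewrite /flat_pts size_flatten /shape -map_comp sumnE big_map.
rewrite (eq_bigr (fun=> d)) => [|v _]; last by rewrite /= size_map size_enum_ord.
by rewrite big_const_seq count_predT iter_addn_0 mulnC.
Qed.

Lemma nth_flat_pts (s : seq 'rV[R]_d) j (c : 'I_d) : (j < size s)%N ->
  nth 0 (flat_pts s) (j * d + c) = (nth 0 s j) 0 c.
Proof.
elim: s j => // v s IHs j js; rewrite /flat_pts /=.
have sz : size [seq v ord0 c0 | c0 <- enum 'I_d] = d by rewrite size_map size_enum_ord.
rewrite nth_cat sz; case: j js => [|j] js.
  rewrite mul0n add0n ltn_ord (nth_map c) ?size_enum_ord //.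
  by rewrite nth_ord_enum; congr (v _ _); apply/ord_inj.
rewrite mulSn -addnA ltnNge leq_addr /= addKn.
exact: IHs.
Qed.

Lemma decideP s i j : env s -> has_cells s -> nv s 14 = i -> nv s 15 = j -> (i < j < m)%N ->
  (forall e, (e < m.-1)%N -> nh s (addr i j e) = 0%N) ->
  let s' := den orc decide s in
  [/\ env s', has_cells s', same_but i j (nh s) (nh s') & forall e, (e < m.-1)%N ->
     nh s' (addr i j e) = `[< covers m (polycurve p) t delta (S i j) e >]].
Proof.
move=> E C hi hj ijm z0 s'; rewrite {}/s' /decide den_Seq.
move D1: (den orc (Ask vi vj (NV 13)) s) => s1.
have s1E : s1 = Store (nv s) (nh s) (rv s) (block (rh s) (5 * Z) (flat_pts (S i j))).
  by rewrite -D1 /den /= (env13 E) hi hj /orc /oracle_of ijm.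
have lowblock x : (x < 5 * Z)%N -> rh s1 x = rh s x.
  by move=> hx; rewrite s1E /= /block ifF //; lia.
have E1 : env s1.
  by apply: env_low E; rewrite ?s1E // => x hx; rewrite -s1E lowblock //; lia.
have C1 : has_cells s1.
  move=> b bm; rewrite lowblock; last by lia.
  by rewrite s1E; exact: C.
have Q1 : has_query (S i j) s1.
  move=> j' c jl; rewrite s1E /= /block size_flat_pts size_tuple.
  have := ltn_ord c; have : (j' * d + d <= l * d)%N by rewrite -mulSnr leq_mul2r jl orbT.
  move=> h1 h2; rewrite ifT; last by lia.
  have -> : (5 * Z + j' * d + c - 5 * Z = j' * d + c)%N by lia.
  by rewrite nth_flat_pts // size_tuple.
have v14 : nv s1 14 = i by rewrite s1E.
have v15 : nv s1 15 = j by rewrite s1E.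
have nh1 : nh s1 = nh s by rewrite s1E.
(* [mark] only writes ones into a block that was zero, so the entries are disjunctions over the
   starts treated so far. *)
pose I a r := [/\ keep m Z s1 r, same_but i j (nh s) (nh r) &
  forall e, (e < m.-1)%N -> nh r (addr i j e) =
     `[< exists2 a', (a' < a)%N & cov_from (S i j) a' e >]].
have : I (nv s1 2) (den orc (For 16 2 from_start) s1).
  apply: den_loop.
  - move=> e r k [k0 h1 h2]; split=> //; apply: keep_trans k0 _.
    by split=> // x hx; rewrite /= /updN ifF //; lia.
  - split=> //; first by move=> x _; rewrite nh1.
    by move=> e em; rewrite nh1 z0 //; case: asboolP => // -[].
  - move=> a r; rewrite (env2 E1) => am fr ra [k0 h1 h2].
    have [||k1 b1 c1] := @from_startP (S i j) r i j a (keep_env TBZ PBZ k0 E1)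
       (keep_query p k0 Q1) (keep_cells l k0 C1) _ _ ra am.
    + by rewrite (fnv fr).
    + by rewrite (fnv fr).
    split; first exact: keep_trans k0 k1.
      by move=> x hx; rewrite b1 ?h1.
    move=> e em; rewrite c1 // h2 //.
    case: asboolP => [ca|nca]; first by case: asboolP => // -[]; exists a.
    congr (nat_of_bool _); apply: asbool_equiv_eq; split=> -[a' a'a ca'].
      by exists a'; [exact: ltnW|exact: ca'].
    exists a'; last exact: ca'.
    move: a'a; rewrite ltnS leq_eqVlt => /orP[/eqP a'E|//].
    by rewrite a'E in ca'.
rewrite (env2 E1) => -[K B H]; split.
- exact: (keep_env TBZ PBZ K E1).
- by move=> b bm; apply: (keep_cells l K C1 bm).
- by [].
- move=> e em; rewrite H //; congr (nat_of_bool _); apply: asbool_equiv_eq; split.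
    move=> [a' a'm [b ae [bm fr]]]; exists a', b.
    by split; [exact: ae|split; [exact: bm|exact: fr]].
  move=> [a' [b [ae [bm fr]]]]; exists a'; last first.
    by exists b; [exact: ae|split; [exact: bm|exact: fr]].
  by case/andP: ae => ae eb; apply: leq_ltn_trans bm; apply: leq_trans ae (ltnW eb).
Qed.

Lemma tableP s : env s -> has_cells s -> (forall x, (4 * m <= x)%N -> nh s x = 0%N) ->
  let s' := den orc table s in
  env s' /\ forall i j e, (i < m)%N -> (j < m)%N -> (e < m.-1)%N ->
     nh s' (addr i j e) = (i < j)%N && `[< covers m (polycurve p) t delta (S i j) e >].
Proof.
move=> E C z0 s'; rewrite {}/s' /table.
(* Distinct pairs own disjoint blocks of length m, so filling one block disturbs no other. *)
have addr_out i j i' j' e : (i < m)%N -> (j < m)%N -> (i' < m)%N -> (j' < m)%N ->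
    (e < m.-1)%N -> (i != i') || (j != j') ->
    ~~ (addr i j 0 <= addr i' j' e < addr i j 0 + m)%N.
  move=> im jm im' jm' em ne; rewrite /addr.
  suff : (i * m + j < i' * m + j')%N || (i' * m + j' < i * m + j)%N.
    by case/orP => h; [have := leq_mul2r m (i * m + j).+1 (i' * m + j')
      |have := leq_mul2r m (i' * m + j').+1 (i * m + j)]; rewrite h orbT mulSn; lia.
  case: (ltngtP i i') ne => [lt|lt|->] /=; last first.
  - by rewrite !ltn_add2l; case: ltngtP.
  - by have := leq_mul2r m i'.+1 i; rewrite lt orbT mulSn => h _; lia.
  - by have := leq_mul2r m i.+1 i'; rewrite lt orbT mulSn => h _; lia.
pose entry i j e := nat_of_bool ((i < j)%N && `[< covers m (polycurve p) t delta (S i j) e >]).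
pose J i j r := [/\ env r, has_cells r & forall i' j' e, (i' < m)%N -> (j' < m)%N -> (e < m.-1)%N ->
   nh r (addr i' j' e) = if (i' < i)%N || ((i' == i) && (j' < j)%N) then entry i' j' e else 0%N].
have Jset i j r v k : (14 <= v)%N -> J i j r -> J i j (setv r v k).
  move=> v14 [h1 h2 h3]; split=> //; apply: env_low h1 => // x hx.
  by rewrite /= /updN ifF //; lia.
pose I i r := J i 0%N r.
have : I (nv s 2) (den orc (For 14 2 (For 15 2 table_body)) s).
  apply: den_loop.
  - by move=> i r k; exact: Jset.
  - split=> // i' j' e _ _ _; rewrite !ltn0 andbF /= z0 //.
    by rewrite /addr leq_addr.
  - move=> i r; rewrite (env2 E) => im fr ri Ji.
    have [Er _ _] := Ji.
    have : J i (nv r 2) (den orc (For 15 2 table_body) r).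
      apply: den_loop => //; first by move=> j r' k; exact: Jset.
      move=> j r'; rewrite (env2 Er) => jm fr' rj [h1 h2 h3].
      have r14 : nv r' 14 = i by rewrite (fnv fr').
      rewrite /table_body den_If /= r14 rj; case: ifP => ij.
        have [|e em|g1 g2 g3 g4] := @decideP r' i j h1 h2 r14 rj.
        - by rewrite ij.
        - by rewrite h3 // ltnn eqxx ltnn.
        split=> // i' j' e im' jm' em.
        have [/andP[/eqP-> /eqP->]|ne] := boolP ((i' == i) && (j' == j)).
          by rewrite g4 // ltnn eqxx ltnSn /= /entry ij.
        rewrite g3; last by apply: addr_out => //; rewrite -negb_and eq_sym [j == _]eq_sym.
        rewrite h3 //; move: ne; case: (i' == i) => //=; rewrite ?orbF //.
        by rewrite ltnS [(j' <= j)%N]leq_eqVlt => /negbTE ->.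
      rewrite den_Skip; split=> // i' j' e im' jm' em; rewrite h3 //.
      have [/andP[/eqP-> /eqP->]|ne] := boolP ((i' == i) && (j' == j)).
        by rewrite ltnn eqxx ltnn ltnSn /= /entry ij.
      move: ne; case: (i' == i) => //=; rewrite ?orbF //.
      by rewrite ltnS [(j' <= j)%N]leq_eqVlt => /negbTE ->.
    rewrite (env2 Er) => -[h1 h2 h3]; split=> // i' j' e im' jm' em.
    by rewrite h3 // jm' andbT ltn0 andbF orbF ltnS [(i' <= i)%N]leq_eqVlt orbC.
rewrite (env2 E) => -[h1 h2 h3]; split=> // i j e im jm em.
by rewrite h3 // im.
Qed.

End CoverageTable.

(** * Greedy set cover on the coverage table *)

Notation unc e := (NP (NV 2) e).
(** Variable 32 holds the gain of the current pair, 29 to 31 the best gain with its pair, 27 the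
    number of uncovered intervals and 28 the number of chosen pairs. *)
Definition count_body : cmd :=
  NSet 32 (NP (NV 32) (NT (NL (tab vi vj ve)) (NL (unc ve)))).
Definition try_pair : cmd :=
  NSet 32 (NC 0) ;; For 20 6 count_body ;;
  If (CN (NV 29) (NV 32)) (NSet 29 (NV 32) ;; NSet 30 vi ;; NSet 31 vj) Skip.
Definition best_pair : cmd := NSet 29 (NC 0) ;; For 14 2 (For 15 2 try_pair).
Definition uncover : cmd :=
  NPut (unc ve) (NT (NL (unc ve)) (NM (NC 1) (NL (tab (NV 30) (NV 31) ve)))).
Definition round : cmd :=
  best_pair ;;
  NPut (NP (NT (NC 2) (NV 2)) (NV 28)) (NV 30) ;;
  NPut (NP (NT (NC 3) (NV 2)) (NV 28)) (NV 31) ;;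
  NSet 28 (succ (NV 28)) ;;
  NSet 27 (NM (NV 27) (NV 29)) ;;
  For 20 6 uncover.
(** The bound of the outer loop must be constant, so it runs m times and idles once everything is
    covered. This is enough, because every active round covers a new interval. *)
Definition greedy : cmd :=
  NSet 27 (NV 6) ;; NSet 28 (NC 0) ;;
  For 20 6 (NPut (unc ve) (NC 1)) ;;
  For 26 2 (If (CN (NC 0) (NV 27)) round Skip).

Section Greedy.
Variables (R : realType) (orc : nat -> nat -> seq R) (m k : nat) (T : nat -> nat -> pred nat).
Implicit Types (s : store R) (U : pred nat).
Hypothesis m0 : (0 < m)%N.
Hypothesis T_lt : forall i j e, T i j e -> (i < j)%N.
Let total U := count U (iota 0 m.-1).
Let gain U i j := count (fun e => U e && T i j e) (iota 0 m.-1).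
Hypothesis progress : forall U, (0 < total U)%N ->
  exists i j, (i < j < m)%N /\ (total U <= k * gain U i j)%N.
Let addr i j e : nat := (4 * m + ((i * m + j) * m + e))%N.

Definition has_table s := [/\ nv s 2 = m, nv s 6 = m.-1 & forall i j e, (i < m)%N -> (j < m)%N ->
  (e < m.-1)%N -> nh s (addr i j e) = T i j e].
Definition has_flags U s := forall e, (e < m.-1)%N -> nh s (m + e)%N = U e.

Lemma total_recr (U : pred nat) n : count U (iota 0 n.+1) = (count U (iota 0 n) + U n)%N.
Proof. by rewrite -addn1 iotaD count_cat /= addn0. Qed.

Lemma has_table_same c s s' : frame c s s' -> 2 \notin asg c -> 6 \notin asg c -> nput_free c ->
  has_table s -> has_table s'.
Proof. by move=> f n2 n6 np [h1 h2 h3]; split; rewrite ?(fnv f) // (fnh f). Qed.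

Lemma try_pairP U s i j : has_table s -> has_flags U s -> nv s 14 = i -> nv s 15 = j ->
  (i < m)%N -> (j < m)%N ->
  let s' := den orc try_pair s in
  [/\ (gain U i j <= nv s' 29)%N, (nv s 29 <= nv s' 29)%N &
    [/\ nv s' 29 = nv s 29, nv s' 30 = nv s 30 & nv s' 31 = nv s 31] \/
    [/\ nv s' 29 = gain U i j, nv s' 30 = i & nv s' 31 = j]].
Proof.
move=> H F hi hj im jm s'; rewrite {}/s' /try_pair 2!den_Seq.
move D1: (den orc (NSet 32 (NC 0)) s) => s1.
have f1 : frame (NSet 32 (NC 0)) s s1 by rewrite -D1; exact: frame_den.
have z1 : nv s1 32 = 0%N by rewrite -D1.
have H1 : has_table s1 by apply: has_table_same f1 _ _ _ H.
have [h2 h6 ht] := H1.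
pose I e (r : store R) := nv r 32 = count (fun e => U e && T i j e) (iota 0 e).
have : I (nv s1 6) (den orc (For 20 6 count_body) s1).
  apply: den_loop.
  - by move=> e r q; rewrite /I /= /updN.
  - by rewrite /I z1.
  - move=> e r; rewrite h6 => em fr re Ie.
    rewrite /I total_recr /count_body den_NSet /= /updN /= Ie re.
    have -> : nv r 2 = m by rewrite (fnv fr).
    have -> : nv r 14 = i by rewrite (fnv fr) // (fnv f1).
    have -> : nv r 15 = j by rewrite (fnv fr) // (fnv f1).
    have -> : nh r = nh s1 by rewrite (fnh fr).
    rewrite -/(addr i j e) ht // (fnh f1) // F //.
    by case: (U e); case: (T i j e).
rewrite h6 /I; have f2 := frame_den orc (For 20 6 count_body) s1.
move: (den orc (For 20 6 count_body) s1) f2 => s2 f2 cnt.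
rewrite -/(gain U i j) in cnt.
have e2 x : x \in [:: 14; 15; 29; 30; 31]%N -> nv s2 x = nv s x.
  by rewrite !inE => hx; rewrite (fnv f2) ?(fnv f1) //= ?inE; move: hx; lia.
rewrite den_If /= cnt !e2 //; case: ifP => lt.
  rewrite 2!den_Seq !den_NSet /= /updN /= cnt !e2 // hi hj; split; [by []|exact: ltnW|by right].
by rewrite den_Skip !e2 //; split; [rewrite leqNgt lt|by []|left].
Qed.

Lemma best_pairP U s : has_table s -> has_flags U s -> (0 < total U)%N ->
  let s' := den orc best_pair s in
  exists i j, [/\ nv s' 30 = i, nv s' 31 = j, (i < j < m)%N, nv s' 29 = gain U i j &
    (total U <= k * gain U i j)%N].
Proof.
move=> H F U0 s'; rewrite {}/s' /best_pair den_Seq.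
move D1: (den orc (NSet 29 (NC 0)) s) => s1.
have f1 : frame (NSet 29 (NC 0)) s s1 by rewrite -D1; exact: frame_den.
have z1 : nv s1 29 = 0%N by rewrite -D1.
have H1 : has_table s1 by apply: has_table_same f1 _ _ _ H.
have F1 : has_flags U s1 by move=> e em; rewrite (fnh f1) // F.
pose J i j (r : store R) := [/\ forall i' j', (i' < m)%N -> (j' < m)%N ->
     (i' < i)%N || ((i' == i) && (j' < j)%N) -> (gain U i' j' <= nv r 29)%N &
  (0 < nv r 29)%N -> [/\ (nv r 30 < m)%N, (nv r 31 < m)%N & nv r 29 = gain U (nv r 30) (nv r 31)]].
have [h2 h6 ht] := H1.
have : J (nv s1 2) 0%N (den orc (For 14 2 (For 15 2 try_pair)) s1).
  apply: (den_loop (I := fun i r => J i 0%N r)).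
  - by [].
  - split; last by rewrite z1.
    by move=> i' j' _ _; rewrite !ltn0 andbF.
  - move=> i r; rewrite h2 => im fr ri Ji.
    have Hr : has_table r by apply: has_table_same fr _ _ _ H1.
    have [r2 _ _] := Hr.
    have : J i (nv r 2) (den orc (For 15 2 try_pair) r).
      apply: (den_loop (I := fun j r => J i j r)) => //.
      move=> j r'; rewrite r2 => jm fr' rj [g1 g2].
      have Hr' : has_table r' by apply: has_table_same fr' _ _ _ Hr.
      have Fr' : has_flags U r' by move=> e em; rewrite (fnh fr') // (fnh fr) // F1.
      have ri' : nv r' 14 = i by rewrite (fnv fr').
      have [a1 a2 a3] := try_pairP Hr' Fr' ri' rj im jm.
      split.
        move=> i' j' im' jm'; have [/andP[/eqP-> /eqP->] _ //|ne] := boolP ((i' == i) && (j' == j)).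
        move=> h; apply: leq_trans a2; apply: g1 => //; move: h ne; case: (i' == i) => //=.
        by rewrite ltnS [(j' <= j)%N]leq_eqVlt => h /negbTE j'j; move: h; rewrite j'j.
      case: a3 => [[-> -> ->] //|[-> -> ->] _]; by split.
    rewrite r2 => -[g1 g2]; split; last exact: g2.
    move=> i' j' im' jm'; rewrite ltn0 andbF orbF ltnS [(i' <= i)%N]leq_eqVlt orbC => h.
    by apply: g1 => //; rewrite jm' andbT.
rewrite h2; move: (den orc _ s1) => s2 [g1 g2].
have [i0 [j0 [/andP[ij0 jm0] u0]]] := progress U0.
have le0 : (gain U i0 j0 <= nv s2 29)%N.
  by apply: g1 => //; [exact: ltn_trans ij0 jm0|rewrite (ltn_trans ij0 jm0)].
have uk : (total U <= k * nv s2 29)%N by apply: leq_trans u0 _; rewrite leq_mul2l le0 orbT.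
have b0 : (0 < nv s2 29)%N by move: (leq_trans U0 uk); rewrite muln_gt0 => /andP[].
have [a1 a2 a3] := g2 b0.
exists (nv s2 30), (nv s2 31); split=> //; last by rewrite -a3.
(* A positive gain exhibits an interval covered by the pair, and the table has ones only for i <
   j. *)
rewrite a2 andbT; move: b0; rewrite a3 -has_count => /hasP[e _ /andP[_]].
exact: T_lt.
Qed.

Definition chosen s (c : nat) := (nh s (2 * m + c)%N, nh s (3 * m + c)%N).

(** [u] records the history of the number of uncovered intervals, as needed by [greedy_rounds].
    Chosen pairs and uncovered intervals together number at most m - 1, and no round was idle while
    something was uncovered; so after m rounds nothing is. *)
Definition greedy_inv r s := exists U : pred nat, exists u : nat -> nat,
  [/\ has_table s /\ has_flags U s,
      nv s 27 = total U /\ u (nv s 28) = total U /\ u 0%N = m.-1,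
      (nv s 28 + total U <= m.-1)%N /\ ((0 < total U)%N -> nv s 28 = r),
      forall c, (c < nv s 28)%N -> (0 < u c)%N /\ (u c <= k * (u c - u c.+1))%N &
      (forall c, (c < nv s 28)%N -> ((chosen s c).1 < (chosen s c).2 < m)%N) /\
      forall e, (e < m.-1)%N -> ~~ U e ->
        exists2 c, (c < nv s 28)%N & T (chosen s c).1 (chosen s c).2 e].

Lemma gain_total U i j :
  total (fun e => U e && ~~ T i j e) = (total U - gain U i j)%N.
Proof.
suff -> : total U = (gain U i j + total (fun e => U e && ~~ T i j e))%N by rewrite addKn.
rewrite /total /gain; elim: (iota _ _) => //= e r ->.
by case: (U e); case: (T i j e); rewrite /= ?add0n ?addn0 ?add1n ?addnS ?addSn.
Qed.

Lemma roundP r s : (r < m)%N -> greedy_inv r s -> (0 < nv s 27)%N ->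
  greedy_inv r.+1 (den orc round s).
Proof.
move=> rm [U [u [[H F] [rem [uK u0]] [Km Kr] ug [ch cov]]]]; rewrite rem => U0.
have KE := Kr U0.
rewrite /round 5!den_Seq.
have [i [j [b30 b31 ijm b29 bk]]] := best_pairP H F U0.
have fb := frame_den orc best_pair s.
move: (den orc best_pair s) fb b30 b31 b29 => s1 f1 b30 b31 b29.
have H1 : has_table s1 by apply: has_table_same f1 _ _ _ H.
have [h2 h6 ht] := H1.
have k1 : nv s1 28 = r by rewrite (fnv f1).
have r1 : nv s1 27 = total U by rewrite (fnv f1).
rewrite 2!den_NSet 2!den_NPut /=.
set s2 := Store _ _ _ _.
pose f := updN (updN (nh s) (2 * m + r) i) (3 * m + r) j.
have nh2 : nh s2 = f.
  by rewrite /s2 /= h2 k1 b30 b31 (fnh f1).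
have nv28 : nv s2 28 = r.+1 by rewrite /s2 /= /updN /= k1 addn1.
have nv27 : nv s2 27 = (total U - gain U i j)%N by rewrite /s2 /= /updN /= r1 b29.
have nvo x : x \notin [:: 27; 28]%N -> nv s2 x = nv s1 x.
  by rewrite !inE negb_or => /andP[/negbTE a /negbTE b]; rewrite /s2 /= /updN a b.
move: s2 nh2 nv28 nv27 nvo => s2 nh2 nv28 nv27 nvo.
have v2 : nv s2 2 = m by rewrite nvo.
have v6 : nv s2 6 = m.-1 by rewrite nvo.
have v30 : nv s2 30 = i by rewrite nvo.
have v31 : nv s2 31 = j by rewrite nvo.
pose U' e := U e && ~~ T i j e.
have ftab i' j' e : f (addr i' j' e) = nh s (addr i' j' e).
  by rewrite /f /updN !ifF //; rewrite /addr; lia.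
have fflag e : (e < m.-1)%N -> f (m + e)%N = nh s (m + e)%N.
  by move=> em; rewrite /f /updN !ifF //; lia.
have [_ _ ht0] := H.
have /andP[ij jm] := ijm; have im := ltn_trans ij jm.
pose I e (r' : store R) := [/\ forall x, ~~ (m <= x < 2 * m)%N -> nh r' x = f x,
  forall e', (e' < e)%N -> (e' < m.-1)%N -> nh r' (m + e')%N = U' e' &
  forall e', (e <= e')%N -> (e' < m.-1)%N -> nh r' (m + e')%N = U e'].
have : I (nv s2 6) (den orc (For 20 6 uncover) s2).
  apply: den_loop.
  - by [].
  - split=> // [x _|e' _ em']; first by rewrite nh2.
    by rewrite nh2 fflag // F.
  - move=> e r'; rewrite v6 => em fr re [g1 g2 g3].
    rewrite /uncover den_NPut /= re.
    have -> : nv r' 2 = m by rewrite (fnv fr).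
    have -> : nv r' 30 = i by rewrite (fnv fr).
    have -> : nv r' 31 = j by rewrite (fnv fr).
    rewrite -/(addr i j e) g3 // g1; last by rewrite /addr; lia.
    rewrite ftab ht0 //.
    split=> /= [x hx|e'|e' ee' em']; rewrite /updN.
    + by rewrite ifF ?g1 //; lia.
    + rewrite eqn_add2l ltnS leq_eqVlt => /orP[/eqP-> _|ee' em'].
        by rewrite eqxx /U'; case: (U e); case: (T i j e).
      by rewrite ltn_eqF // g2.
    + by rewrite eqn_add2l gtn_eqF // g3 // ltnW.
have f3 := frame_den orc (For 20 6 uncover) s2.
rewrite v6; move: (den orc (For 20 6 uncover) s2) f3 => s3 f3 [g1 g2 _].
have tU' : total U' = (total U - gain U i j)%N := gain_total U i j.
have gU : (gain U i j <= total U)%N by apply: sub_count => e /andP[].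
have g0 : (0 < gain U i j)%N by move: (leq_trans U0 bk); rewrite muln_gt0 => /andP[].
have K3 : nv s3 28 = r.+1 by rewrite (fnv f3).
have cho c : (c < r)%N -> chosen s3 c = chosen s c.
  by move=> cr; rewrite /chosen !g1 /f /updN ?[in LHS]ifF //; lia.
have chr : chosen s3 r = (i, j).
  rewrite /chosen !g1; [|lia|lia].
  by rewrite /f /updN eqxx ifF ?eqxx //; lia.
(* The history gains one entry and keeps the earlier ones. *)
exists U', (fun c => if c == r.+1 then total U' else u c); split.
- split; last by move=> e em; rewrite g2.
  split; [by rewrite (fnv f3)|by rewrite (fnv f3)|].
  by move=> i' j' e im' jm' em; rewrite g1 ?ftab ?ht0 //; rewrite /addr; lia.
- rewrite K3 eqxx; split; first by rewrite (fnv f3) // nv27.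
  by split.
- rewrite K3; split=> //; rewrite tU'; lia.
- move=> c; rewrite K3 ltnS leq_eqVlt => /orP[/eqP->|cr].
    rewrite (ltn_eqF (ltnSn r)) eqxx -KE uK tU' subKn //; split=> //.
  have c1 : (c == r.+1) = false by rewrite ltn_eqF // ltnW.
  have c2 : (c.+1 == r.+1) = false by rewrite ltn_eqF.
  by rewrite c1 c2; apply: ug; rewrite KE.
- rewrite K3; split.
    move=> c; rewrite ltnS leq_eqVlt => /orP[/eqP->|cr]; first by rewrite chr.
    by rewrite cho //; apply: ch; rewrite KE.
  move=> e em; rewrite /U' negb_and negbK => /orP[nU|Tij]; last by exists r; rewrite ?chr.
  have [c cK Tc] := cov e em nU; rewrite KE in cK.
  by exists c; [exact: ltnW|rewrite cho].
Qed.

Lemma greedyP s : has_table s ->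
  let s' := den orc greedy s in
  let K := nv s' 28 in
  [/\ nv s' 2 = m,
      forall j, (m.-1 < 2 ^ j)%N -> (K <= k * j)%N,
      (K <= m)%N,
      forall c, (c < K)%N -> ((chosen s' c).1 < (chosen s' c).2 < m)%N &
      forall e, (e < m.-1)%N -> exists2 c, (c < K)%N & T (chosen s' c).1 (chosen s' c).2 e].
Proof.
move=> H s'; rewrite {}/s' /greedy 3!den_Seq.
have H0 := H; have [h2 h6 ht] := H.
move D1: (den orc (NSet 28 (NC 0)) (den orc (NSet 27 (NV 6)) s)) => s1.
have s1E : s1 = Store (updN (updN (nv s) 27 m.-1) 28 0) (nh s) (rv s) (rh s).
  by rewrite -D1 !den_NSet /= h6.
have H1 : has_table s1 by rewrite s1E; split.
have v27 : nv s1 27 = m.-1 by rewrite s1E.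
have v28 : nv s1 28 = 0%N by rewrite s1E.
have [a2 a6 at1] := H1.
pose I e (r : store R) := (forall x, ~~ (m <= x < 2 * m)%N -> nh r x = nh s1 x) /\
  forall e', (e' < e)%N -> (e' < m.-1)%N -> nh r (m + e')%N = 1%N.
have : I (nv s1 6) (den orc (For 20 6 (NPut (unc ve) (NC 1))) s1).
  apply: den_loop => // e r; rewrite a6 => em fr re [g1 g2].
  have r2 : nv r 2 = m by rewrite (fnv fr).
  rewrite den_NPut /= re r2; split=> /= [x hx|e']; rewrite /updN.
    by rewrite ifF ?g1 //; lia.
  rewrite eqn_add2l; case: eqP => // ne; rewrite ltnS leq_eqVlt => /orP[/eqP //|]; exact: g2.
have f2 := frame_den orc (For 20 6 (NPut (unc ve) (NC 1))) s1.
rewrite a6; move: (den orc (For 20 6 _) s1) f2 => s2 f2 [g1 g2].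
have H2 : has_table s2.
  split; [by rewrite (fnv f2)|by rewrite (fnv f2)|].
  by move=> i j e im jm em; rewrite g1 ?at1 //; rewrite /addr; lia.
have G0 : greedy_inv 0 s2.
  have tot : total (fun=> true) = m.-1 by rewrite /total count_predT size_iota.
  have z28 : nv s2 28 = 0%N by rewrite (fnv f2).
  exists (fun=> true), (fun=> m.-1); rewrite tot z28; split.
  - by split=> // e em; rewrite g2.
  - by rewrite (fnv f2).
  - by rewrite add0n.
  - by [].
  - by [].
have [b2 _ _] := H2.
have : greedy_inv (nv s2 2) (den orc (For 26 2 (If (CN (NC 0) (NV 27)) round Skip)) s2).
  apply: (den_loop (I := greedy_inv)) => //.
  move=> r s'; rewrite b2 => rm fr _ G; rewrite den_If /=.
  case: ifP => c0; first exact: roundP.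
  rewrite den_Skip; have [U [u [q1 [q2 [q3 q4]] [q5 q6] q7 q8]]] := G.
  by exists U, u; split=> //; split=> //; rewrite -q2 c0.
rewrite b2; move: (den orc _ s2) => s3 [U [u [[[c2 _ _] F] [_ [uK u0]] [Km Kr] ug [ch cov]]]].
have U0 : total U = 0%N.
  by case: (posnP (total U)) => // Up; have := Kr Up; lia.
split=> //.
- by move=> j mj; apply: (greedy_rounds ug); rewrite u0.
- by lia.
- move=> e em; apply: cov => //; apply/negP => Ue.
  have : (0 < total U)%N by rewrite -has_count; apply/hasP; exists e; rewrite ?mem_iota.
  by rewrite U0.
Qed.

End Greedy.

(** * Running time *)

Definition main : cmd := cells ;; table ;; greedy.

(** Variable 4 enters as the length of the input and becomes the number of edges only after all
    addresses have been derived from it. Real variable 0 receives the square of 3 Delta. The edge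
    counts use (n - 1) + (1 - (n - 1)), a maximum by truncated subtraction. *)
Definition prelude : cmd :=
  NSet 9 (NP (NP (NP (NV 4) (NV 1)) (NV 2)) (NT (NV 3) (NV 0))) ;;
  NSet 7 (succ (NV 4)) ;;
  NSet 8 (NP (NV 7) (NV 2)) ;;
  RSet 0 (RT (RT (RN (NC 3)) (RL (NV 4))) (RT (RN (NC 3)) (RL (NV 4)))) ;;
  NSet 10 (NT (NC 2) (NV 9)) ;;
  NSet 11 (NT (NC 3) (NV 9)) ;;
  NSet 12 (NT (NC 4) (NV 9)) ;;
  NSet 13 (NT (NC 5) (NV 9)) ;;
  NSet 4 (NP (NM (NV 1) (NC 1)) (NM (NC 1) (NM (NV 1) (NC 1)))) ;;
  NSet 5 (NP (NM (NV 3) (NC 1)) (NM (NC 1) (NM (NV 3) (NC 1)))) ;;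
  NSet 6 (NM (NV 2) (NC 1)).

Ltac sizes := repeat match goal with |- context [size ?x] =>
  let v := eval vm_compute in (size x) in change (size x) with v end.

Section Time.
Variables (TS : nat) (be : nat -> nat).
Let d := be 0.
Let m := be 2.
Let N := be 4.
Let M := be 5.
Hypotheses (N0 : (0 < N)%N) (M0 : (0 < M)%N) (m0 : (0 < m)%N) (m1 : (be 6 <= m)%N).

Lemma time_cell : time TS cell be = (348 + 196 * d)%N.
Proof.
by cbv [cell ival interval coef coef_body quad prop time]; sizes; rewrite /d; lia.
Qed.

Lemma time_from_start : (time TS from_start be <= 1000 * (1 + d) * (N * M + m))%N.
Proof.
have NM1 : (1 <= N * M)%N by rewrite muln_gt0 N0.
have MN : (M <= N * M)%N by rewrite leq_pmull.
have NN : (N <= N * M)%N by rewrite leq_pmulr.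
have dNM : (d <= d * (N * M))%N by rewrite leq_pmulr.
have cE := time_cell.
have sE : (time TS start be <= 500 * (1 + d) * (N * M))%N.
  by cbv [start ival interval coef coef_body quad time]; sizes; rewrite -/d -/N; lia.
have rE : (time TS sweep_row be <= 400 * (1 + d) * N)%N.
  have -> : time TS sweep_row be = (4 + (3 + N * (time TS cell be + 2)))%N by [].
  by rewrite cE; have : (d <= d * N)%N by [rewrite leq_pmulr]; lia.
have fE : (time TS farthest be <= 100 * m)%N.
  by cbv [farthest farthest_body time]; sizes; rewrite -/m; lia.
have mE : (time TS (For 20 6 mark) be <= 100 * m)%N.
  by cbv [mark time]; sizes; move: m1; rewrite /m; lia.
have -> : time TS from_start be = (time TS start be + (3 + M * (time TS sweep_row be + 2)) +
   (time TS farthest be + time TS (For 20 6 mark) be))%N by [].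
have : (M * time TS sweep_row be <= M * (400 * (1 + d) * N))%N by rewrite leq_mul2l rE orbT.
nia.
Qed.

(** Each of at most m^2 pairs asks the oracle once and runs m sweeps of cost N M + m up to a
    constant. The greedy phase has m rounds, each summing m table entries for m^2 pairs. *)
Lemma time_main : (time TS main be <= 2000 * (1 + d) * (m ^ 3 * (N * M) + m ^ 4 + m ^ 2 * TS))%N.
Proof.
set F := (1000 * (1 + d) * (N * M + m))%N.
have FE : (time TS from_start be <= F)%N := time_from_start.
have aE : (time TS cells be <= 100 * m * N)%N.
  by cbv [cells cells_body cell_scan time]; sizes; rewrite -/m -/N; nia.
have gE : (time TS greedy be <= 500 * (m ^ 4))%N.
  have m4 : (1 <= m ^ 4)%N by rewrite expn_gt0 m0.
  have h1 : (time TS try_pair be <= 100 * m)%N.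
    by cbv [try_pair count_body time]; sizes; move: m1; rewrite -/m; lia.
  have h2 : (time TS best_pair be <= 200 * m ^ 3)%N.
    have -> : time TS best_pair be = (2 + (3 + m * (3 + m * (time TS try_pair be + 2) + 2)))%N by [].
    by rewrite !expnS expn0; nia.
  have h3 : (time TS (For 20 6 uncover) be <= 100 * m)%N.
    by cbv [uncover time]; sizes; move: m1; rewrite -/m; lia.
  have h4 : (time TS round be <= 400 * m ^ 3)%N.
    have -> : time TS round be = (time TS best_pair be +
       (26 + time TS (For 20 6 uncover) be))%N by [].
    by move: h2 h3; rewrite !expnS expn0; nia.
  have -> : time TS greedy be = (4 + ((3 + be 6 * 9) +
     (3 + m * (3 + maxn (time TS round be) 1 + 2))))%N by [].
  have h5 : (m * maxn (time TS round be) 1 <= m * (400 * m ^ 3))%N.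
    by rewrite leq_mul2l geq_max h4 muln_gt0 expn_gt0 m0 orbT.
  by move: h5 m1 m4; rewrite -/m !expnS expn0; nia.
have tE : (time TS table be <= 100 * m ^ 2 + m ^ 2 * TS + m ^ 3 * (F + 10))%N.
  have -> : time TS table be = (3 + m * (3 + m * (3 + maxn (time TS decide be) 1 + 2) + 2))%N by [].
  have dE : (time TS decide be <= 8 + TS + m * (F + 2))%N.
    have -> : time TS decide be = (5 + TS + (3 + m * (time TS from_start be + 2)))%N by [].
    have : (m * (time TS from_start be + 2) <= m * (F + 2))%N.
      by rewrite leq_mul2l leq_add2r FE orbT.
    by lia.
  have : (m * m * maxn (time TS decide be) 1 <= m * m * (8 + TS + m * (F + 2)))%N.
    by rewrite leq_mul2l geq_max dE orbT.
  by rewrite !expnS expn0; nia.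
have -> : time TS main be = (time TS cells be + (time TS table be + time TS greedy be))%N by [].
have NM1 : (1 <= N * M)%N by rewrite muln_gt0 N0.
have NN : (N <= N * M)%N by rewrite leq_pmulr.
have m23 : (m ^ 2 <= m ^ 4)%N by rewrite leq_pexp2l.
have m34 : (m ^ 3 <= m ^ 4)%N by rewrite leq_pexp2l.
have mm3 : (m * N <= m ^ 3 * (N * M))%N by rewrite leq_mul // -{1}[m]expn1 leq_pexp2l.
have FE3 : (m ^ 3 * F = 1000 * (1 + d) * (m ^ 3 * (N * M) + m ^ 4))%N.
  by rewrite /F [(m ^ 4)%N]expnSr; lia.
move: aE gE tE; rewrite mulnDr FE3; set X := (m ^ 3 * (N * M))%N in mm3 *.
nia.
Qed.
End Time.

(** * Input and output *)

(** Real cell 0 is saved first because it then serves as the transfer register. The destination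
    starts at heap address W, so it cannot overlap the W input cells. *)
Definition copy_init : seq instr :=
  [:: NMul 4 1 0; NAdd 4 4 2; NAdd 4 4 39; NConst 5 32; NAdd 5 5 4; RStore 5 0; NConst 6 1].
Definition copy_body : seq instr := [:: NAdd 5 5 39; RLoad 0 6; RStore 5 0; NAdd 6 6 39].
(* The input is moved to the heap, since it occupies the cells of the registers. *)
Definition prologue : seq instr :=
  [:: NConst 38 0; NConst 39 1; JmpNLt 38 3 5; NConst 0 1; Halt] ++
  copy_init ++ copy_body ++ [:: JmpNLt 6 4 12].

(** The output overwrites real memory from cell 0 on, in the order in which [output] decodes it.
    This is safe, as from here on the program itself reads integer cells only. *)
Definition out_init : seq instr :=
  [:: NConst 4 64; NAdd 5 2 2; NAdd 4 4 5; NAdd 5 4 2; NMul 6 3 0; NConst 7 0; NConst 8 0].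
Definition epilogue (p : nat) : seq instr :=
  out_init ++ [:: JmpNLt 38 39 (p + 15)] ++
  [:: NLoad 10 4; NLoad 11 5] ++ [:: Oracle 10 11 7] ++
  [:: NAdd 4 4 39; NAdd 5 5 39; NAdd 7 7 6; NAdd 8 8 39] ++
  [:: JmpNLt 8 28 (p + 8)] ++ [:: NAdd 0 28 38; Halt].

(** The number 17 is the length of the prologue. *)
Definition program : seq instr :=
  let cp := comp prelude 17 in
  let cm := comp main (17 + size cp) in
  prologue ++ cp ++ cm ++ epilogue (17 + size cp + size cm).

Section Machine.
Variables (R : realType) (d l m : nat) (p : seq 'rV[R]_d) (t : nat -> R) (Delta : R).
Variables (S : nat -> nat -> l.-tuple 'rV[R]_d) (TS : nat) (prog : seq instr).
Let orc := oracle_of m S.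
Let n := size p.
Let W := (n * d + m + 1)%N.
Let Z := (W + n + m + l * d)%N.
Let input : seq R := Delta :: [seq t i | i <- iota 0 m] ++ flat_pts p.
Hypotheses (m1 : (1 < m)%N) (l0 : (0 < l)%N) (n0 : (0 < n)%N).
Local Notation steps := (steps prog orc TS).
Local Notation code_at := (code_at prog).

Lemma input_t i : (i < m)%N -> nth 0 input i.+1 = t i.
Proof.
move=> im; rewrite /input /= nth_cat size_map size_iota im.
by rewrite (nth_map 0%N) ?size_iota // nth_iota.
Qed.

Lemma input_p i (c : 'I_d) : (i < n)%N -> nth 0 input (m + i * d + c).+1 = (nth 0 p i) 0 c.
Proof.
move=> im; rewrite /input /= nth_cat size_map size_iota -addnA ltnNge leq_addr /= addKn.
exact: nth_flat_pts.
Qed.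

Lemma preludeP s : nv s 0 = d -> nv s 1 = n -> nv s 2 = m -> nv s 3 = l -> nv s 4 = W ->
  (forall x, (x < W)%N -> rh s (W + x)%N = nth 0 input x) ->
  let s' := den orc prelude s in
  env m l p t (3 * Delta) W.+1 (W + m).+1 Z s' /\ nh s' = nh s.
Proof.
move=> h0 h1 h2 h3 h4 hi s'; rewrite {}/s' /prelude.
have step v e x f h a b : evn (@Store R f h a b) e = x ->
    den orc (NSet v e) (Store f h a b) = Store (updN f v x) h a b by move=> <-.
have rstep v e x f h a b : evr (@Store R f h a b) e = x ->
    den orc (RSet v e) (Store f h a b) = Store f h (updR a v x) b by move=> <-.
have [w wE] : exists w, w = W by exists W.
have [z zE] : exists z, z = Z by exists Z.
rewrite -wE -zE in h4 hi *; case: s h0 h1 h2 h3 h4 hi => f g a b /= h0 h1 h2 h3 h4 hi.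
rewrite den_Seq (@step 9 _ z); last by rewrite /= h4 h1 h2 h3 h0 zE wE.
rewrite den_Seq (@step 7 _ w.+1); last by rewrite /= /updN /= h4 addn1.
rewrite den_Seq (@step 8 _ (w + m).+1); last by rewrite /= /updN /= h2.
rewrite den_Seq (@rstep 0 _ (3 * Delta * (3 * Delta))); last first.
  by rewrite /= /updN /= h4 -[w in b w]addn0 hi // wE /W addn1.
rewrite den_Seq (@step 10 _ (2 * z)%N); last by rewrite /= /updN /=.
rewrite den_Seq (@step 11 _ (3 * z)%N); last by rewrite /= /updN /=.
rewrite den_Seq (@step 12 _ (4 * z)%N); last by rewrite /= /updN /=.
rewrite den_Seq (@step 13 _ (5 * z)%N); last by rewrite /= /updN /=.
rewrite den_Seq (@step 4 _ (edges n)); last by rewrite /= /updN /= h1 /edges; lia.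
rewrite den_Seq (@step 5 _ (edges l)); last by rewrite /= /updN /= h3 /edges; lia.
rewrite (@step 6 _ m.-1); last by rewrite /= /updN /= h2; lia.
split; last by [].
split; rewrite ?[nv _]/= ?[rv _]/= ?[rh _]/= /updN /updR.
- exact: h0.
- exact: h1.
- exact: h2.
- exact: h3.
- by [].
- by [].
- by [].
- by [].
- by [].
- by [].
- by [].
- by [].
- by [].
- by [].
- by move=> i im; rewrite addSnnS hi ?input_t // wE /W; lia.
- move=> i c im; have -> : ((w + m).+1 + i * d + c = w + (m + i * d + c).+1)%N by lia.
  have h : (i * d + d <= n * d)%N by rewrite -mulSnr leq_mul2r im orbT.
  by rewrite hi ?input_p // wE /W; have := ltn_ord c; lia.
Qed.

Lemma step_jmp s a b q : nth Halt prog (pc s) = JmpNLt a b q ->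
  steps s (mkState (if (nmem s a < nmem s b)%N then q else (pc s).+1) (nmem s) (rmem s)) 1.
Proof. by move=> h; have := steps1 orc TS h isT. Qed.

Lemma prologueP : code_at 0 prologue -> exists s k,
  [/\ steps (init_state l m p t Delta) s k, (k <= 20 + 5 * W)%N, pc s = 17 &
   [/\ nmem s 0 = d, nmem s 1 = n, nmem s 2 = m, nmem s 3 = l & nmem s 4 = W] /\
   [/\ nmem s 38 = 0%N, nmem s 39 = 1%N, forall x, nmem s (64 + x)%N = 0%N &
   forall x, (x < W)%N -> rmem s (32 + (W + x))%N = nth 0 input x]].
Proof.
move=> cp; set s0 := init_state l m p t Delta.
have [c1 c2] := @code_at_cat _ _ [:: NConst 38 0; NConst 39 1] _ cp.
have [cj c3] := code_at_cons c2; have [_ c4] := code_at_cons c3; have [_ c5] := code_at_cons c4.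
have [c6 c7] := code_at_cat c5; have [c8 /code_at1 c9] := code_at_cat c7.
have [st1 pc1] := steps_run orc TS (isT : all simple [:: NConst 38 0; NConst 39 1])
  (erefl : pc s0 = 0%N) c1.
move: st1 pc1; set s1 := run _ _ _ _ => st1 pc1.
have st2 := @step_jmp s1 38 3 5; rewrite pc1 in st2; have {}st2 := st2 cj.
have {}st2 : steps s1 (mkState 5 (nmem s1) (rmem s1)) 1 by move: st2; rewrite /= /updN /= l0.
set s2 := mkState _ _ _ in st2.
have [st3 pc3] := steps_run orc TS (isT : all simple copy_init) (erefl : pc s2 = 5) c6.
set s3 := run _ _ _ _ in st3 pc3.
(* Cell 5 points to the last cell written, hence [x.-1]. The source is intact except for real cell
   0, the transfer register. *)
pose J x (s : state R) := [/\ pc s = 12,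
   [/\ nmem s 0 = d, nmem s 1 = n, nmem s 2 = m, nmem s 3 = l & nmem s 4 = W],
   [/\ nmem s 5 = (32 + W + x.-1)%N, nmem s 6 = x, nmem s 38 = 0%N, nmem s 39 = 1%N &
     forall y, nmem s (64 + y)%N = 0%N] &
   (forall y, (0 < y < W)%N -> rmem s y = nth 0 input y) /\
   forall y, (y < x)%N -> rmem s (32 + (W + y))%N = nth 0 input y].
have W2 : (1 < W)%N by rewrite /W; lia.
have J1 : J 1%N s3.
  have WE : (n * d + m + 1)%N = W by [].
  split=> //.
  - by rewrite /s3 /= /updN /= -/n WE addn0.
  - split=> [y hy|[|//] _]; rewrite /s3 /= /updN /= -/n WE /updR.
      by rewrite ifF //; lia.
    by rewrite addn0 eqxx.
have body x s : (0 < x)%N -> (x < W)%N -> J x s ->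
    exists2 s', steps s s' 5 & J x.+1 (mkState 12 (nmem s') (rmem s')) /\
      pc s' = if (x.+1 < W)%N then 12 else 17.
  move=> x0 xW [hpc [h0 h1 h2 h3 h4] [h5 h6 h38 h39 hz] [hi ho]].
  have [stb pcb] := steps_run orc TS (isT : all simple copy_body) hpc c8.
  set sb := run _ _ _ _ in stb pcb.
  have b6 : nmem sb 6 = x.+1 by rewrite /sb /= /updN /= h6 h39 addn1.
  have b4 : nmem sb 4 = W by rewrite /sb /= /updN /= h4.
  have b5 : nmem sb 5 = (32 + W + x)%N.
    by rewrite /sb /= /updN /= h5 h39 -addnA addn1 prednK.
  have bo y : (y != 5)%N -> (y != 6)%N -> nmem sb y = nmem s y.
    by move=> /negbTE y5 /negbTE y6; rewrite /sb /= /updN y5 y6.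
  have br : rmem sb = updR (updR (rmem s) 0 (rmem s x)) (32 + W + x) (rmem s x).
    by rewrite /sb /= /updN /= h5 h39 h6 -addnA addn1 prednK.
  have stj := @step_jmp sb 6 4 12; rewrite pcb b6 b4 in stj; have {}stj := stj c9.
  move: sb stb stj b6 b4 b5 bo br {pcb} => sb stb stj b6 b4 b5 bo br.
  exists (mkState (if (x.+1 < W)%N then 12 else 17) (nmem sb) (rmem sb)).
    exact: (steps_trans stb stj).
  split; last by [].
  split; [by []| | |]; rewrite ?[nmem (mkState _ _ _)]/= ?[rmem (mkState _ _ _)]/=.
  - by rewrite !bo.
  - rewrite b5 b6 !bo //; split=> // y; rewrite bo //; lia.
  - rewrite br; split=> y.
      by move=> hy; rewrite /updR !ifF ?hi //; lia.
    rewrite ltnS leq_eqVlt /updR => /orP[/eqP->|yx].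
      by rewrite addnA eqxx hi // x0.
    by rewrite !ifF ?ho //; lia.
have loop x : (0 < x)%N -> (x < W)%N -> exists2 s', steps s3 s' (5 * x) &
   J x.+1 (mkState 12 (nmem s') (rmem s')) /\ pc s' = if (x.+1 < W)%N then 12 else 17.
  elim: x => // x IH _ xW; case: (posnP x) => [->|x0].
    by have [|s' st' [J' pc']] := body 1%N s3 isT _ J1; [rewrite (leq_ltn_trans _ xW)|exists s'].
  have [s' st' [J' pc']] := IH x0 (ltnW xW).
  have Js' : J x.+1 s' by move: J' pc'; rewrite xW; case: (s') => ? ? ? /= H ->.
  have [s'' st'' HJ] := body x.+1 s' isT xW Js'.
  by exists s'' => //; rewrite mulnS addnC; apply: steps_trans st' st''.
have Wp0 : (0 < W.-1)%N by rewrite -ltnS prednK // ltnW.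
have WpW : (W.-1 < W)%N by rewrite prednK // ltnW.
have [sW stW [[_ HW1 [_ _ HW2 HW3 HW4] [_ HW5]] pcW]] := loop _ Wp0 WpW.
have WK : (W.-1).+1 = W by rewrite prednK // ltnW.
exists sW, (2 + (1 + (7 + 5 * W.-1)))%N; split.
- by apply: steps_trans st1 _; apply: steps_trans st2 _; apply: steps_trans st3 stW.
- by lia.
- by rewrite pcW WK ltnn.
- by rewrite WK in HW5; split.
Qed.

Lemma epilogueP q s (K : nat) : code_at q (epilogue q) -> pc s = q ->
  nmem s 0 = d -> nmem s 2 = m -> nmem s 3 = l -> nmem s 28 = K ->
  nmem s 38 = 0%N -> nmem s 39 = 1%N -> (K <= m)%N ->
  let ch c := (nmem s (64 + (2 * m + c))%N, nmem s (64 + (3 * m + c))%N) in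
  (forall c, (c < K)%N -> ((ch c).1 < (ch c).2 < m)%N) ->
  exists sf k, [/\ steps s sf k, nth Halt prog (pc sf) = Halt, (k <= 20 + K * (10 + TS))%N &
    nmem sf 0 = K /\ forall c z, (c < K)%N -> (z < l * d)%N ->
     rmem sf (c * (l * d) + z)%N = nth 0 (flat_pts (S (ch c).1 (ch c).2)) z].
Proof.
move=> cq pcs h0 h2 h3 h28 h38 h39 Km ch chP.
have [c1 c1'] := code_at_cat cq; have [/code_at1 cj c2'] := code_at_cat c1'.
have [c3 c3'] := code_at_cat c2'; have [/code_at1 co c4'] := code_at_cat c3'.
have [c5 c5'] := code_at_cat c4'; have [/code_at1 ct c6'] := code_at_cat c5'.
have [cl /code_at_cons[ch1 _]] := code_at_cons c6'.
rewrite -!addnA /= in cj c3 co c5 ct cl ch1.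
have [st1 pc1] := steps_run orc TS (isT : all simple out_init) pcs c1.
set s1 := run _ _ _ _ in st1 pc1.
have st2 := @step_jmp s1 38 39 (q + 15); rewrite pc1 in st2; have {}st2 := st2 cj.
have {}st2 : steps s1 (mkState (q + 15) (nmem s1) (rmem s1)) 1.
  by move: st2; rewrite /= /updN /= h38 h39.
set s2 := mkState _ _ _ in st2.
(* The invariant sits at the loop test; cell 7 is the write position of the next curve. *)
pose J c (r : state R) := [/\ pc r = (q + 15)%N,
  [/\ nmem r 4 = (64 + (2 * m + c))%N, nmem r 5 = (64 + (3 * m + c))%N,
    nmem r 6 = (l * d)%N, nmem r 7 = (c * (l * d))%N & nmem r 8 = c],
  [/\ nmem r 28 = K, nmem r 38 = 0%N, nmem r 39 = 1%N &
    forall x, nmem r (64 + x)%N = nmem s (64 + x)%N] &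
  forall c' z, (c' < c)%N -> (z < l * d)%N ->
     rmem r (c' * (l * d) + z)%N = nth 0 (flat_pts (S (ch c').1 (ch c').2)) z].
have J0 : J 0%N s2.
  split=> //.
  - by rewrite /s2 /s1 /= /updN /= h2 h3 h0 mul0n; split=> //; lia.
have body c r : (c < K)%N -> J c r -> exists2 r', steps r r' (7 + TS) & J c.+1 r'.
  move=> cK [hpc [g4 g5 g6 g7 g8] [g28 g38 g39 gh] gr].
  have stj := @step_jmp r 8 28 (q + 8); rewrite hpc in stj; have {}stj := stj ct.
  rewrite g8 g28 cK in stj; set r1 := mkState _ _ _ in stj.
  have [st3 pc3] := steps_run orc TS (isT : all simple [:: NLoad 10 4; NLoad 11 5])
     (erefl : pc r1 = (q + 8)%N) c3.
  set r2 := run _ _ _ _ in st3 pc3.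
  have st4 := @steps1 R prog orc TS r2 (Oracle 10 11 7).
  rewrite pc3 -addnA in st4; have {}st4 := st4 co isT.
  set r3 := (step _ _ _ _).1 in st4.
  have oE : orc (nmem r2 10) (nmem r2 11) = flat_pts (S (ch c).1 (ch c).2).
    rewrite /r2 /= /updN /= g4 g5 !gh /orc /oracle_of -/(ch c).1 -/(ch c).2.
    by rewrite (chP c cK).
  have r3E : r3 = mkState (q + 11) (nmem r2) (fun x =>
     if (c * (l * d) <= x < c * (l * d) + l * d)%N
     then nth 0 (flat_pts (S (ch c).1 (ch c).2)) (x - c * (l * d)) else rmem r x).
    rewrite /r3 /= in oE *; rewrite oE size_flat_pts size_tuple; congr mkState.
      by lia.
    by apply/funext => x; rewrite /updN /= g7.
  clearbody r3.
  have pcr3 : pc r3 = (q + 11)%N by rewrite r3E.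
  have [st5 pc5] := steps_run orc TS
    (isT : all simple [:: NAdd 4 4 39; NAdd 5 5 39; NAdd 7 7 6; NAdd 8 8 39]) pcr3 c5.
  set r4 := run _ _ _ _ in st5 pc5.
  exists r4.
    have -> : (7 + TS = 1 + (2 + (TS + 4)))%N by lia.
    by apply: steps_trans stj _; apply: steps_trans st3 _; apply: steps_trans st4 st5.
  split.
  - by rewrite pc5 -addnA.
  - rewrite /r4 /= r3E /= /updN /= g4 g5 g6 g7 g8 g39 mulSn !addn1.
    by split=> //; rewrite ?addnS // addnC.
  - by rewrite /r4 /= r3E /= /updN /=; split.
  - move=> c' z; rewrite /r4 /= r3E /= ltnS leq_eqVlt => /orP[/eqP->|c'c] zl.
      by rewrite leq_addr ltn_add2l zl /= addKn.
    rewrite ifF ?gr //.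
    have : (c'.+1 * (l * d) <= c * (l * d))%N by rewrite leq_mul2r c'c orbT.
    by rewrite mulSn; lia.
have loop c : (c <= K)%N -> exists2 r, steps s2 r (c * (7 + TS)) & J c r.
  elim: c => [_|c IH cK]; first by exists s2 => //; rewrite mul0n; exact: steps_refl.
  have [r st Jr] := IH (ltnW cK); have [r' st' Jr'] := body c r cK Jr.
  by exists r' => //; rewrite mulSn addnC; apply: steps_trans st st'.
have [r str [hpc [g4 g5 g6 g7 g8] [g28 g38 g39 gh] gr]] := loop K (leqnn K).
have stj := @step_jmp r 8 28 (q + 8); rewrite hpc in stj; have {}stj := stj ct.
rewrite g8 g28 ltnn in stj; set r1 := mkState _ _ _ in stj.
have qE : pc r1 = (q + (7 + (1 + (2 + (1 + (4 + 1))))))%N by rewrite /= -addnS.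
rewrite -qE in cl ch1; have stl := @steps1 R prog orc TS r1 (NAdd 0 28 38) cl isT.
eexists _, _; split.
- by apply: steps_trans st1 _; apply: steps_trans st2 _; apply: steps_trans str _;
    apply: steps_trans stj stl.
- exact: ch1.
- by rewrite /=; lia.
- by rewrite /= /updN /= g28 g38 addn0; split.
Qed.

End Machine.

Lemma wf_main : wf main. Proof. by vm_compute. Qed.
Lemma wf_prelude : wf prelude. Proof. by vm_compute. Qed.

Lemma time_prelude TS be : time TS prelude be = 75%N.
Proof. by cbv [prelude time]; sizes. Qed.

Definition main_start : nat := 17 + size (comp prelude 17).
Definition epilogue_start : nat := main_start + size (comp main main_start).

Lemma program_code : [/\ code_at program 0 prologue, code_at program 17 (comp prelude 17),
  code_at program main_start (comp main main_start) &
  code_at program epilogue_start (epilogue epilogue_start)].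
Proof.
have : code_at program 0 program by move=> i _; rewrite add0n.
rewrite {2}/program -/main_start -/epilogue_start.
move=> /code_at_cat[h1 /code_at_cat[h2 /code_at_cat[h3 h4]]].
by split.
Qed.

(** * Correctness of the whole program *)

Section Correctness.
Variables (R : realType) (d : nat) (p : seq 'rV[R]_d) (m l : nat) (t : nat -> R).
Variables (Delta : R) (Cs : {fset l.-tuple 'rV[R]_d}).
Variables (S : nat -> nat -> l.-tuple 'rV[R]_d) (TS : nat).
Hypotheses (n0 : (0 < size p)%N) (tP : breakpoints m t) (D0 : 0 < Delta).
Hypotheses (CsP : (phi m (polycurve p) t Cs <= Delta%:E)%E).
Hypothesis SP : forall i j, (i < j < m)%N ->
  is_simplification (subcurve (polycurve p) (t i) (t j)) (S i j).
Let orc := oracle_of m S.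
Let T i j e := (i < j)%N && `[< covers m (polycurve p) t (3 * Delta) (S i j) e >].

Lemma main_correct TB PB Z (s : store R) : (0 < l)%N ->
  (TB + m <= 2 * Z)%N -> (PB + size p * d <= 2 * Z)%N ->
  (edges (size p) <= Z)%N -> (m <= Z)%N ->
  env m l p t (3 * Delta) TB PB Z s -> (forall x, nh s x = 0%N) ->
  let s' := den orc main s in
  let K := nv s' 28 in
  [/\ (K <= #|` Cs| * up_log 2 m)%N, (K <= m)%N,
      forall c, (c < K)%N -> ((chosen m s' c).1 < (chosen m s' c).2 < m)%N &
      forall e, (e < m.-1)%N -> exists2 c, (c < K)%N &
        covers m (polycurve p) t (3 * Delta) (S (chosen m s' c).1 (chosen m s' c).2) e].
Proof.
move=> l0 hTB hPB hN hZ E z0 s'; rewrite {}/s' /main 2!den_Seq.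
have d30 : 0 <= 3 * Delta by rewrite mulr_ge0 // ltW.
have m1 : (1 < m)%N by case: tP.
have [E1 C1 h1] := cellsP S n0 l0 d30 hTB hPB hN hZ tP E.
move: (den _ cells s) E1 C1 h1 => s1 E1 C1 h1.
have [|E2 tab] := tableP S n0 l0 d30 hTB hPB hN hZ tP E1 C1.
  by move=> x hx; rewrite h1 ?z0 //; lia.
move: (den _ table s1) E2 tab => s2 E2 tab.
have H2 : has_table m T s2 by split; [exact: env2 E2|exact: env6 E2|exact: tab].
have prog (U : pred nat) : (0 < count U (iota 0 m.-1))%N -> exists i j, (i < j < m)%N /\
    (count U (iota 0 m.-1) <= #|` Cs| * count (fun e => U e && T i j e) (iota 0 m.-1))%N.
  move=> U0; have [i [j [ijm le]]] := greedy_progress tP CsP SP U0.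
  exists i, j; split=> //; apply: leq_trans le _.
  have /andP[ij _] := ijm.
  by rewrite leq_mul2l; apply/orP; right; apply: sub_count => e; rewrite /T ij.
have Tlt i j e : T i j e -> (i < j)%N by case/andP.
have [_ hK Km ch cov] := greedyP orc (ltnW m1) Tlt prog H2.
split=> //.
- by apply: hK; have := @up_logP 2 m isT; lia.
- move=> e em; have [c cK /andP[_ /asboolP Tc]] := cov e em.
  by exists c; [exact: cK|exact: Tc].
Qed.

Lemma decode_flat (s : state R) c (q : l.-tuple 'rV[R]_d) :
  (forall z, (z < l * d)%N -> rmem s (c * (l * d) + z)%N = nth 0 (flat_pts q) z) ->
  decode_curve d l s c = q.
Proof.
move=> H; apply: eq_from_tnth => j; rewrite tnth_mktuple; apply/rowP => i; rewrite mxE.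
have il := ltn_ord i; have jl := ltn_ord j.
have jd : (j * d + d <= l * d)%N by rewrite -mulSnr leq_mul2r jl orbT.
rewrite -mulnA -addnA H; last by lia.
by rewrite nth_flat_pts ?size_tuple // (tnth_nth 0).
Qed.

Lemma program_correct : (0 < l)%N -> exists fuel (sf : state R) (cost : nat),
  exec program orc TS fuel (init_state l m p t Delta) = Some (sf, cost) /\
  (cost <= 4000 * (1 + d) * (m ^ 3 * size p * l + m ^ 4 + m ^ 2 * TS))%N /\
  (#|` output d l sf| <= #|` Cs| * up_log 2 m)%N /\
  (phi m (polycurve p) t (output d l sf) <= (3 * Delta)%:E)%E.
Proof.
move=> l0; have m1 : (1 < m)%N by case: tP.
have [c1 c2 c3 c4] := program_code.
have [s1 [k1 [st1 K1 pc1 [[v0 v1 v2 v3 v4] [v38 v39 z1 in1]]]]] :=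
  prologueP t Delta S TS m1 l0 n0 c1.
have n0' := n0; set n := size p in n0' K1 in1 v1 v4 *.
set W := (n * d + m + 1)%N in K1 in1 v4.
(* The initial store is read off the machine memory, which makes the simulation relation hold by
   definition. *)
pose g1 : store R := Store (nmem s1) (fun x => nmem s1 (64 + x)%N) (rmem s1) (fun x => rmem s1 (32 + x)%N).
have S1 : sim g1 s1 by [].
have [//|s2 [k2 [st2 pc2 S2 K2]]] := @comp_ok R program orc TS prelude wf_prelude 17 s1 g1 (fun=> 0%N)
  c2 pc1 S1.
rewrite time_prelude in K2.
have [E2 nh2] := @preludeP R d l m p t Delta S m1 l0 n0 g1 v0 v1 v2 v3 v4 in1.
rewrite -/orc in E2 nh2; move: (den orc prelude g1) S2 E2 nh2 => g2 S2 E2 nh2.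
set Z := (W + n + m + l * d)%N in E2.
have [//|s3 [k3 [st3 pc3 S3 K3]]] := @comp_ok R program orc TS main wf_main main_start s2 g2 (nv g2)
  c3 pc2 S2.
have z2 x : nh g2 x = 0%N by rewrite nh2 /= z1.
have hTB : (W.+1 + m <= 2 * Z)%N by rewrite /Z /W; lia.
have hPB : ((W + m).+1 + n * d <= 2 * Z)%N by rewrite /Z /W; lia.
have hN : (edges n <= Z)%N by rewrite /edges /Z; lia.
have hm : (m <= Z)%N by rewrite /Z; lia.
have [hK Km chP cov] := main_correct l0 hTB hPB hN hm E2 z2.
have keepv v : v \in [:: 0; 2; 3]%N -> nv (den orc main g2) v = nv g2 v.
  by rewrite !inE => /or3P[]/eqP->; apply: den_nv; vm_compute.
move: (den orc main g2) S3 hK Km chP cov keepv => g3 S3 hK Km chP cov keepv.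
have [sv [s38 s39] sh _ _] := S3.
have chE c : chosen m g3 c = (nmem s3 (64 + (2 * m + c)), nmem s3 (64 + (3 * m + c)))%N.
  by rewrite /chosen !sh.
have [sf [k4 [st4 halt K4 [out0 out]]]] := @epilogueP R d l m p S TS program m1 l0 n0 epilogue_start s3 (nv g3 28)
  c4 pc3 (etrans (sv 0%N isT) (etrans (keepv 0%N isT) (env0 E2)))
  (etrans (sv 2%N isT) (etrans (keepv 2%N isT) (env2 E2)))
  (etrans (sv 3%N isT) (etrans (keepv 3%N isT) (env3 E2)))
  (sv 28%N isT) s38 s39 Km (fun c cK => eq_ind _ (fun u => (u.1 < u.2 < m)%N) (chP c cK) _ (chE c)).
have [f0 F0] := steps_trans st1 (steps_trans st2 (steps_trans st3 st4)).
exists (f0 + 1)%N, sf, (k1 + (k2 + (k3 + k4)) + 0)%N; split.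
  by rewrite F0 /= halt.
split; last split.
- have eN := env4 E2; have eM := env5 E2.
  have b2 : nv g2 2 = m := env2 E2; have b0 : nv g2 0 = d := env0 E2.
  have b6 : nv g2 6 = m.-1 := env6 E2.
  have K3' : (k3 <= 2000 * (1 + d) * (m ^ 3 * (edges n * edges l) + m ^ 4 + m ^ 2 * TS))%N.
    apply: (leq_trans K3); have := @time_main TS (nv g2).
    by rewrite eN eM b2 b0 b6 => /(_ (edges_gt0 _) (edges_gt0 _) (ltnW m1) (leq_pred _)).
  have NM : (edges n * edges l <= n * l)%N.
    by apply: leq_mul; rewrite /edges; lia.
  have m4 : (m <= m ^ 4)%N by rewrite -{1}[m]expn1 leq_pexp2l // ltnW.
  have mT : (m * TS <= m ^ 2 * TS)%N by rewrite leq_mul2r -{1}[m]expn1 leq_pexp2l ?orbT // ltnW.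
  have nl : (n <= m ^ 3 * n * l)%N by rewrite mulnAC leq_pmull // muln_gt0 expn_gt0 ltnW.
  have NM3 : (m ^ 3 * (edges n * edges l) <= m ^ 3 * n * l)%N by rewrite -mulnA leq_mul2l NM orbT.
  (* The epilogue asks the oracle again at most m times, which m^2 TS absorbs. *)
  have KT : (nv g3 28 * (10 + TS) <= m * (10 + TS))%N by rewrite leq_mul2r Km orbT.
  have X0 : (0 < m ^ 4)%N by rewrite expn_gt0 ltnW.
  set X := (m ^ 3 * n * l + m ^ 4 + m ^ 2 * TS)%N.
  have K3'' : (k3 <= 2000 * (1 + d) * X)%N.
    by apply: leq_trans K3' _; rewrite leq_mul2l !leq_add2r NM3 orbT.
  have K4' : (k4 <= 20 + 20 * X)%N by rewrite /X; lia.
  have X1 : (1 <= X)%N by rewrite /X; lia.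
  have nX : (n <= X)%N by rewrite /X; lia.
  have mX : (m <= X)%N by rewrite /X; lia.
  have nd : (n * d <= X * d)%N by rewrite leq_mul2r nX orbT.
  move: X K3'' K4' X1 mX nd {nX} => X K3'' K4' X1 mX nd.
  have W1 : (W <= X * d + X + X)%N by rewrite /W; lia.
  clear -K1 K2 K3'' K4' X1 W1; lia.
- apply: leq_trans hK; rewrite -out0; apply: leq_trans (leq_imfset_card _ _ _) _.
  have -> : enum_finmem (mem_fin (fin_finpred (iota 0 (nmem sf 0)))) = undup (iota 0 (nmem sf 0)) by [].
  by rewrite (leq_trans (size_undup _)) ?size_iota.
- apply: phi_of_covers => // e em; have [c cK cv] := cov e em.
  exists (S (chosen m g3 c).1 (chosen m g3 c).2); last exact: cv.
  apply/imfsetP; exists c; first by rewrite /= mem_iota out0 add0n.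
  apply/esym/decode_flat => z zl; rewrite chE; exact: out.
Qed.

End Correctness.

(** Some pair must contain the time 0, and it needs a centre. *)
Lemma phi_nonempty (R : realType) (d l m : nat) (P : R -> 'rV[R]_d) (t : nat -> R) (C : {fset l.-tuple 'rV[R]_d})
    (delta : R) : (phi m P t C <= delta%:E)%E -> exists q, q \in C.
Proof.
move=> /phi_leP[I [_ Icov] IP].
have [|ij ijI _] := Icov 0; first by rewrite lexx ler01.
by have [q qC _] := IP ij ijI; exists q.
Qed.

(** For l = 0 the test in the prologue fails, and the program announces one curve and halts: the
    empty tuple is decoded from any memory. *)
Lemma exec_no_vertices (R : realType) (d m : nat) (p : seq 'rV[R]_d) (t : nat -> R) (Delta : R)
    (orc : nat -> nat -> seq R) (TS : nat) (prog : seq instr) : code_at prog 0 prologue ->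
  exists fuel (sf : state R),
    exec prog orc TS fuel (init_state 0 m p t Delta) = Some (sf, 4%N) /\ nmem sf 0 = 1%N.
Proof.
move=> /(@code_at_cat _ _ [:: NConst 38 0; NConst 39 1])[c1 c2].
have [cj c3] := code_at_cons c2; have [c4 c5] := code_at_cons c3; have [c6 _] := code_at_cons c5.
set s0 := init_state 0 m p t Delta.
have [st1 pc1] := steps_run orc TS (isT : all simple [:: NConst 38 0; NConst 39 1])
  (erefl : pc s0 = 0%N) c1.
move: st1 pc1; set s1 := run _ _ _ _ => st1 pc1.
have st2 := @steps1 R prog orc TS s1 (JmpNLt 38 3 5); rewrite pc1 in st2.
have {}st2 := st2 cj isT.
have {}st2 : steps prog orc TS s1 (mkState 3 (nmem s1) (rmem s1)) 1 by [].
have st3 := @steps1 R prog orc TS (mkState 3 (nmem s1) (rmem s1)) (NConst 0 1) c4 isT.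
have [f0 F0] := steps_trans st1 (steps_trans st2 st3).
eexists (f0 + 1)%N, _; split; first by rewrite F0 /= [nth _ _ _]c6.
by [].
Qed.

Theorem mainTheorem14 :
  exists prog : seq instr, forall d : nat, exists c : nat,
  forall (R : realType) (p : seq 'rV[R]_d) (m l : nat) (t : nat -> R)
         (Delta : R) (k : nat),
    (0 < size p)%N -> breakpoints m t -> 0 < Delta ->
    (exists Cs : {fset l.-tuple 'rV[R]_d},
        #|` Cs| = k /\ (phi m (polycurve p) t Cs <= Delta%:E)%E) ->
    forall S : nat -> nat -> l.-tuple 'rV[R]_d,
    (forall i j, (i < j < m)%N ->
        is_simplification (subcurve (polycurve p) (t i) (t j)) (S i j)) ->
    forall TS : nat, (0 < TS)%N ->
    exists fuel (sf : state R) (cost : nat),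
      exec prog (oracle_of m S) TS fuel (init_state l m p t Delta)
        = Some (sf, cost) /\
      (cost <= c * (m ^ 3 * size p * l + m ^ 4 + m ^ 2 * TS))%N /\
      (#|` output d l sf| <= c * k * up_log 2 m)%N /\
      (phi m (polycurve p) t (output d l sf) <= (3 * Delta)%:E)%E.
Proof.
exists program => d; exists (4000 * (1 + d))%N => R p m l t Delta k n0 tP D0 [Cs [<- CsP]] S SP TS _.
have c0 : (0 < 4000 * (1 + d))%N by lia.
have [l0|l0] := posnP l; last first.
  have [fuel [sf [cost [h1 [h2 [h3 h4]]]]]] := program_correct TS n0 tP D0 CsP SP l0.
  exists fuel, sf, cost; split=> //; split=> //; split=> //.
  by apply: leq_trans h3 _; rewrite -mulnA leq_pmull.
have m1 : (1 < m)%N by case: tP.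
have [q qC] := phi_nonempty CsP.
move: Cs CsP S SP q qC; rewrite l0 => Cs CsP S SP q qC.
(* There is only one curve without vertices, so the nonempty [Cs] and the output coincide. *)
have one (q1 q2 : 0.-tuple 'rV[R]_d) : q1 = q2 by rewrite [q1]tuple0 [q2]tuple0.
have [c1 _ _ _] := program_code.
have [fuel [sf [ex out]]] := exec_no_vertices m p t Delta (oracle_of m S) TS c1.
have outE : output d 0 sf = Cs.
  apply/fsetP => x; rewrite (one x q) qC; apply/imfsetP; exists 0%N; last exact: one.
  by rewrite out.
exists fuel, sf, 4%N; split; [exact: ex|split; last split].
- have : (0 < m ^ 4)%N by rewrite expn_gt0 ltnW.
  by move: (m ^ 4)%N (m ^ 3 * size p * 0)%N (m ^ 2 * TS)%N => a b c' a0; nia.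
- rewrite outE -mulnA mulnCA leq_pmulr // muln_gt0 c0.
  by rewrite up_log_gt0.
- rewrite outE; apply: le_trans CsP _; rewrite lee_fin; lra.
Qed.
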